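(* Let $\zeta,\varsigma,\tau,\delta,\lambda\in\mathbb{T}$ with $|\operatorname{Im}_j(\varsigma)|<\operatorname{Re}(\varsigma)$, $|\operatorname{Im}_j(\tau)|<\operatorname{Re}(\tau)$, $|\operatorname{Im}_j(\zeta)|<\operatorname{Re}(\zeta)$, and $|\lambda\zeta^{-\varsigma}|_j\prec 1$, i.e. $|\lambda_1\zeta_1^{-\varsigma_1}|<1$ and $|\lambda_2\zeta_2^{-\varsigma_2}|<1$. Then the bicomplex Laplace transform of $t^{\tau-1}\mathbb{E}^{\delta}_{\varsigma,\tau}(\lambda t^{\varsigma})$ is $$\mathcal{L}\left(t^{\tau-1}\mathbb{E}_{\varsigma,\tau}^{\delta}(\lambda t^{\varsigma})\right)(\zeta)=\int_{0}^{\infty}e^{-\zeta t}\,\mathbb{E}_{\varsigma,\tau}^{\delta}(\lambda t^{\varsigma})\,t^{\tau-1}\,dt=\frac{\zeta^{\varsigma\delta-\tau}}{(\zeta^{\varsigma}-\lambda)^{\delta}}.$$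
   Context: $\mathbb{T}=\{x_0+i_1x_1+i_2x_2+jx_3: x_0,\dots,x_3\in\mathbb{R}\}$ is the commutative algebra of bicomplex numbers, with $i_1^2=i_2^2=-1$, $j=i_1i_2=i_2i_1$, $j^2=1$; write $\operatorname{Re}=x_0$, $\operatorname{Im}_j=x_3$. $\mathbb{C}$ is identified with $\{x_0+i_1x_1\}$. With $e_1=\frac{1+i_1i_2}{2}$, $e_2=\frac{1-i_1i_2}{2}$, every $\xi=w_1+i_2w_2$ ($w_1,w_2\in\mathbb{C}$) is uniquely $\xi=\xi_1e_1+\xi_2e_2$ with $\xi_1=w_1-i_1w_2$, $\xi_2=w_1+i_1w_2\in\mathbb{C}$; algebraic operations, limits, integrals over $t\in(0,\infty)$, $\exp$, $\Gamma$ and powers are componentwise, e.g. $\xi^{\eta}=\xi_1^{\eta_1}e_1+\xi_2^{\eta_2}e_2$, and $|\xi|_j=|\xi_1|e_1+|\xi_2|e_2$. Powers of $\zeta_r$ (which has positive real part) use the principal branch, and the quotient $\zeta_r^{\varsigma_r\delta_r-\tau_r}/(\zeta_r^{\varsigma_r}-\lambda_r)^{\delta_r}$ is taken with the branch for which it equals $\zeta_r^{-\tau_r}(1-\lambda_r\zeta_r^{-\varsigma_r})^{-\delta_r}$, the last power being principal. The bicomplex Prabhakar function is $$\mathbb{E}_{\varsigma,\tau}^{\delta}(\zeta)=\sum_{k=0}^{\infty}\frac{(\delta)_k}{k!\,\Gamma(\varsigma k+\tau)}\zeta^k,\qquad (\delta)_k=\delta(\delta+1)\cdots(\delta+k-1),\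 (\delta)_0=1.$$
   Formalization: The integral can diverge under the stated conditions (ς=τ=δ=1, λ=5, ζ=1/10+10i₁), so the equality is claimed for those ζ at which the Laplace integral converges; its convergence is proved for all z with Re(z) > |Im_j(z)| + K, for some real K. *)

(* Defs.v *)
From Stdlib Require Import Reals Lra Factorial.
From Coquelicot Require Import Coquelicot.
Open Scope R_scope.

Definition Cexp (z : C) : C := (exp (Re z) * cos (Im z), exp (Re z) * sin (Im z)).

(** Principal argument, in (-PI, PI]. *)
Definition Carg (z : C) : R :=
  if Rle_dec 0 (Im z) then acos (Re z / Cmod z) else - acos (Re z / Cmod z).

Definition Clog (z : C) : C := (ln (Cmod z), Carg z).

Definition Cpower (z s : C) : C := Cexp (s * Clog z)%C.

(** Integral over (0, +oo), improper at both ends. *)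
Definition ex_CInt0oo (f : R -> C) : Prop :=
  ex_RInt_gen (V := C_R_NormedModule) f (at_right 0) (Rbar_locally p_infty).

Definition CInt0oo (f : R -> C) : C :=
  RInt_gen (V := C_R_CompleteNormedModule) f (at_right 0) (Rbar_locally p_infty).

(** Euler's integral: meaningful for [0 < Re z], the only range used below. *)
Definition CGamma (z : C) : C :=
  CInt0oo (fun t => Cpower (RtoC t) (z - 1)%C * RtoC (exp (- t)))%C.

Definition CSeries (a : nat -> C) : C :=
  (Series (fun n => Re (a n)), Series (fun n => Im (a n))).

(** The branch of [z^(s*d-t) / (z^s-l)^d] obtained by choosing
    [s * Log z + Log (1 - l * z^(-s))] as the logarithm of [z^s - l]
    (see [Clog_branch_correct] and [Cquot_branchE]). *)
Definition Clog_branch (z s l : C) : C :=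
  (s * Clog z + Clog (1 - l * Cpower z (- s)))%C.

Definition Cquot_branch (z s t d l : C) : C :=
  (Cpower z (s * d - t) / Cexp (d * Clog_branch z s l))%C.

(** [mkT w1 w2] is [w1 + i2 w2] with [w1, w2] in C = {x0 + i1 x1}; hence
    x0 = Re w1, x1 = Im w1, x2 = Re w2, x3 = Im w2. *)
Record bicomplex : Type := mkT { bc_w1 : C; bc_w2 : C }.

Declare Scope bc_scope.
Delimit Scope bc_scope with BC.
Bind Scope bc_scope with bicomplex.

Definition TRe (x : bicomplex) : R := Re (bc_w1 x).
Definition TImj (x : bicomplex) : R := Im (bc_w2 x).

Definition CtoT (z : C) : bicomplex := mkT z 0%C.
Definition RtoT (x : R) : bicomplex := CtoT (RtoC x).

Definition Ti1 : bicomplex := mkT Ci 0%C.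
Definition Ti2 : bicomplex := mkT 0%C 1%C.

Definition Tadd (x y : bicomplex) : bicomplex :=
  mkT (bc_w1 x + bc_w1 y)%C (bc_w2 x + bc_w2 y)%C.
Definition Topp (x : bicomplex) : bicomplex := mkT (- bc_w1 x)%C (- bc_w2 x)%C.
Definition Tsub (x y : bicomplex) : bicomplex := Tadd x (Topp y).
Definition Tmul (x y : bicomplex) : bicomplex :=
  mkT (bc_w1 x * bc_w1 y - bc_w2 x * bc_w2 y)%C
      (bc_w1 x * bc_w2 y + bc_w2 x * bc_w1 y)%C.

Notation "x + y" := (Tadd x y) : bc_scope.
Notation "- x" := (Topp x) : bc_scope.
Notation "x - y" := (Tsub x y) : bc_scope.
Notation "x * y" := (Tmul x y) : bc_scope.

Definition Te1 : bicomplex := (RtoT (/ 2) * (RtoT 1 + Ti1 * Ti2))%BC.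
Definition Te2 : bicomplex := (RtoT (/ 2) * (RtoT 1 - Ti1 * Ti2))%BC.

(** Idempotent components. *)
Definition idem1 (x : bicomplex) : C := (bc_w1 x - Ci * bc_w2 x)%C.
Definition idem2 (x : bicomplex) : C := (bc_w1 x + Ci * bc_w2 x)%C.
Definition of_idem (a b : C) : bicomplex := (CtoT a * Te1 + CtoT b * Te2)%BC.

Definition Tinv (x : bicomplex) : bicomplex := of_idem (/ idem1 x)%C (/ idem2 x)%C.
Definition Tdiv (x y : bicomplex) : bicomplex := (x * Tinv y)%BC.
Notation "x / y" := (Tdiv x y) : bc_scope.

Fixpoint Tpow (x : bicomplex) (n : nat) : bicomplex :=
  match n with O => RtoT 1 | S n' => (x * Tpow x n')%BC end.

Definition Texp (x : bicomplex) : bicomplex :=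
  of_idem (Cexp (idem1 x)) (Cexp (idem2 x)).
Definition Tpower (x y : bicomplex) : bicomplex :=
  of_idem (Cpower (idem1 x) (idem1 y)) (Cpower (idem2 x) (idem2 y)).
Definition TGamma (x : bicomplex) : bicomplex :=
  of_idem (CGamma (idem1 x)) (CGamma (idem2 x)).
Definition TSeries (a : nat -> bicomplex) : bicomplex :=
  of_idem (CSeries (fun n => idem1 (a n))) (CSeries (fun n => idem2 (a n))).

Definition Tmodj (x : bicomplex) : bicomplex :=
  of_idem (RtoC (Cmod (idem1 x))) (RtoC (Cmod (idem2 x))).

(** Strict order on hyperbolic numbers: [y - x] has positive real components. *)
Definition Tprec (x y : bicomplex) : Prop :=
  exists a b : R, 0 < a /\ 0 < b /\ (y - x)%BC = of_idem (RtoC a) (RtoC b).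

Fixpoint Tpoch (d : bicomplex) (k : nat) : bicomplex :=
  match k with O => RtoT 1 | S k' => (Tpoch d k' * (d + RtoT (INR k')))%BC end.

(** [Prabhakar s t d z] is E_{s,t}^d(z). *)
Definition Prabhakar (s t d z : bicomplex) : bicomplex :=
  TSeries (fun k =>
    Tpoch d k / (RtoT (INR (fact k)) * TGamma (s * RtoT (INR k) + t)) * Tpow z k)%BC.

Definition ex_TInt0oo (f : R -> bicomplex) : Prop :=
  ex_CInt0oo (fun t => idem1 (f t)) /\ ex_CInt0oo (fun t => idem2 (f t)).
Definition TInt0oo (f : R -> bicomplex) : bicomplex :=
  of_idem (CInt0oo (fun t => idem1 (f t))) (CInt0oo (fun t => idem2 (f t))).

(** [ex_Laplace f z]: [z] lies in the region of convergence of the Laplace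
    transform of [f]; [Laplace f z] is its value there, and is unspecified
    elsewhere.  The conditions [0 < Re z] and [|l z^(-s)| < 1] do not imply
    convergence: for s = t = d = 1 the transformed function is [exp (l t)], and
    z = 1/10 + 10 i1, l = 5 gives a divergent integral. *)
Definition ex_Laplace (f : R -> bicomplex) (z : bicomplex) : Prop :=
  ex_TInt0oo (fun t => Texp (- (z * RtoT t)) * f t)%BC.
Definition Laplace (f : R -> bicomplex) (z : bicomplex) : bicomplex :=
  TInt0oo (fun t => Texp (- (z * RtoT t)) * f t)%BC.

Definition Tquot_branch (z s t d l : bicomplex) : bicomplex :=
  of_idem (Cquot_branch (idem1 z) (idem1 s) (idem1 t) (idem1 d) (idem1 l))
          (Cquot_branch (idem2 z) (idem2 s) (idem2 t) (idem2 d) (idem2 l)).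

Local Ltac Csolve :=
  apply injective_projections;
  unfold idem1, idem2, Tsub, Tadd, Topp, Tmul, RtoT, CtoT, Ti1, Ti2;
  cbn; lra.

Lemma idem1_add (x y : bicomplex) : idem1 (x + y)%BC = (idem1 x + idem1 y)%C.
Proof. Csolve. Qed.

Lemma idem2_add (x y : bicomplex) : idem2 (x + y)%BC = (idem2 x + idem2 y)%C.
Proof. Csolve. Qed.

Lemma idem1_opp (x : bicomplex) : idem1 (- x)%BC = (- idem1 x)%C.
Proof. Csolve. Qed.

Lemma idem2_opp (x : bicomplex) : idem2 (- x)%BC = (- idem2 x)%C.
Proof. Csolve. Qed.

Lemma idem1_mul (x y : bicomplex) : idem1 (x * y)%BC = (idem1 x * idem1 y)%C.
Proof. destruct x as [[a b] [c d]], y as [[a' b'] [c' d']]; Csolve. Qed.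

Lemma idem2_mul (x y : bicomplex) : idem2 (x * y)%BC = (idem2 x * idem2 y)%C.
Proof. destruct x as [[a b] [c d]], y as [[a' b'] [c' d']]; Csolve. Qed.

Lemma idem1_CtoT (z : C) : idem1 (CtoT z) = z.
Proof. Csolve. Qed.

Lemma idem2_CtoT (z : C) : idem2 (CtoT z) = z.
Proof. Csolve. Qed.

Lemma idem_e : idem1 Te1 = 1%C /\ idem2 Te1 = 0%C /\ idem1 Te2 = 0%C /\ idem2 Te2 = 1%C.
Proof.
unfold Te1, Te2; rewrite !idem1_mul, !idem2_mul; repeat split; Csolve.
Qed.

Lemma of_idem1 (a b : C) : idem1 (of_idem a b) = a.
Proof.
destruct idem_e as (E1 & _ & E2 & _).
unfold of_idem; rewrite idem1_add, !idem1_mul, !idem1_CtoT, E1, E2; ring.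
Qed.

Lemma of_idem2 (a b : C) : idem2 (of_idem a b) = b.
Proof.
destruct idem_e as (_ & E1 & _ & E2).
unfold of_idem; rewrite idem2_add, !idem2_mul, !idem2_CtoT, E1, E2; ring.
Qed.

Lemma idem_inj (x y : bicomplex) : idem1 x = idem1 y -> idem2 x = idem2 y -> x = y.
Proof.
destruct x as [[a b] [c d]], y as [[a' b'] [c' d']]; unfold idem1, idem2; cbn.
intros H1 H2; injection H1; injection H2; intros; f_equal; f_equal; lra.
Qed.

Lemma of_idemK (x : bicomplex) : of_idem (idem1 x) (idem2 x) = x.
Proof. apply idem_inj; [apply of_idem1 | apply of_idem2]. Qed.

Lemma Tprec_modj1 (x : bicomplex) :
  Tprec (Tmodj x) (RtoT 1) <-> Cmod (idem1 x) < 1 /\ Cmod (idem2 x) < 1.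
Proof.
assert (E : (RtoT 1 - Tmodj x)%BC
  = of_idem (RtoC (1 - Cmod (idem1 x))) (RtoC (1 - Cmod (idem2 x)))).
{ unfold Tmodj, Tsub, RtoT; apply idem_inj.
  - rewrite idem1_add, idem1_opp, idem1_CtoT, !of_idem1, RtoC_minus; ring.
  - rewrite idem2_add, idem2_opp, idem2_CtoT, !of_idem2, RtoC_minus; ring. }
unfold Tprec; rewrite E; split.
- intros (a & b & Ha & Hb & H); split.
  + apply (f_equal idem1) in H; rewrite !of_idem1 in H.
    apply RtoC_inj in H; lra.
  + apply (f_equal idem2) in H; rewrite !of_idem2 in H.
    apply RtoC_inj in H; lra.
- intros [H1 H2]; exists (1 - Cmod (idem1 x)), (1 - Cmod (idem2 x)).
  repeat split; lra.
Qed.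

Lemma half_plane_idem (x : bicomplex) :
  Rabs (TImj x) < TRe x <-> 0 < Re (idem1 x) /\ 0 < Re (idem2 x).
Proof.
destruct x as [[a b] [c d]]; unfold TImj, TRe, idem1, idem2; cbn.
split; [intros H; apply Rabs_def2 in H | intros H; apply Rabs_def1]; lra.
Qed.

Lemma Cexp_add (z w : C) : Cexp (z + w)%C = (Cexp z * Cexp w)%C.
Proof.
destruct z as [a b], w as [c d]; unfold Cexp, Cplus, Cmult, Re, Im; cbn [fst snd].
rewrite exp_plus, cos_plus, sin_plus; f_equal; ring.
Qed.

Lemma Cexp_0 : Cexp 0%C = 1%C.
Proof.
unfold Cexp, RtoC, Re, Im; cbn [fst snd].
rewrite exp_0, cos_0, sin_0; f_equal; ring.
Qed.

Lemma Cexp_opp (z : C) : Cexp (- z)%C = (/ Cexp z)%C.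
Proof.
assert (H : (Cexp z * Cexp (- z))%C = 1%C).
{ rewrite <- Cexp_add; rewrite Cplus_opp_r; apply Cexp_0. }
assert (Hz : Cexp z <> 0%C).
{ intros E; rewrite E, Cmult_0_l in H; injection H; lra. }
replace (Cexp (- z)) with (/ Cexp z * (Cexp z * Cexp (- z)))%C by (field; exact Hz).
rewrite H; ring.
Qed.

Lemma Cexp_Clog (z : C) : z <> 0%C -> Cexp (Clog z) = z.
Proof.
intros Hz; pose proof (Cmod_gt_0 z) as [Hm _]; specialize (Hm Hz).
assert (Hn : Cmod z * Cmod z = Re z * Re z + Im z * Im z).
{ unfold Cmod, Re, Im; rewrite sqrt_sqrt; [ring | nra]. }
set (u := Re z / Cmod z).
assert (Hu : u * Cmod z = Re z) by (unfold u; field; lra).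
assert (Hu1 : -1 <= u <= 1).
{ apply Rabs_le_between; unfold u; rewrite Rabs_div, (Rabs_pos_eq (Cmod z)) by lra.
  apply Rle_div_l; [lra|]; rewrite Rmult_1_l; exact (Rle_trans _ _ _ (Rmax_l _ _) (Rmax_Cmod z)). }
assert (Hs : sqrt (1 - u²) = Rabs (Im z) / Cmod z).
{ replace (1 - u²) with ((Im z / Cmod z)²).
  - rewrite sqrt_Rsqr_abs, Rabs_div by lra; rewrite (Rabs_pos_eq (Cmod z)); lra.
  - unfold u, Rsqr; apply (Rmult_eq_reg_r (Cmod z * Cmod z)); [|nra].
    field_simplify; nra. }
unfold Cexp, Clog, Carg; cbn [Re Im fst snd].
fold u; rewrite exp_ln by exact Hm.
rewrite (surjective_pairing z) at 5; destruct (Rle_dec 0 (Im z)) as [H|H].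
- rewrite cos_acos, sin_acos by exact Hu1; rewrite Hs, Rabs_pos_eq by exact H.
  f_equal; [rewrite Rmult_comm; exact Hu | unfold Im; field; lra].
- rewrite cos_neg, sin_neg, cos_acos, sin_acos by exact Hu1.
  rewrite Hs, Rabs_left by lra.
  f_equal; [rewrite Rmult_comm; exact Hu | unfold Im; field; lra].
Qed.

Lemma Clog_branch_correct (z s l : C) :
  Cmod (l * Cpower z (- s)) < 1 -> Cexp (Clog_branch z s l) = (Cpower z s - l)%C.
Proof.
intros H; unfold Clog_branch; rewrite Cexp_add, Cexp_Clog.
- fold (Cpower z s).
  unfold Cminus; rewrite Cmult_plus_distr_l, Cmult_1_r; f_equal.
  transitivity (- (l * (Cpower z s * Cpower z (- s))))%C; [ring|].
  unfold Cpower; rewrite <- Cexp_add, <- Cmult_plus_distr_r, Cplus_opp_r, Cmult_0_l.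
  rewrite Cexp_0, Cmult_1_r; reflexivity.
- intros E.
  assert (E1 : (l * Cpower z (- s))%C = 1%C).
  { transitivity (1 - (1 - l * Cpower z (- s)))%C; [|rewrite E; Csolve].
    generalize (l * Cpower z (- s))%C; intros x; Csolve. }
  rewrite E1, Cmod_1 in H; lra.
Qed.

Lemma Cquot_branchE (z s t d l : C) :
  Cquot_branch z s t d l
  = (Cpower z (- t) * Cpower (1 - l * Cpower z (- s)) (- d))%C.
Proof.
unfold Cquot_branch, Clog_branch, Cdiv; rewrite <- Cexp_opp.
unfold Cpower at 1 3 4; rewrite <- !Cexp_add; f_equal.
generalize (Clog (1 - l * Cpower z (- s)))%C (Clog z); intros x y; ring.
Qed.

(* Main.v *)
(** Componentwise the claim is about complex parameters.  For [Re z] large the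
    Prabhakar series may be integrated term by term (this needs
    [Gamma (s k + t)] to be bounded below), which gives
    [sum (d)_k / k! l^k z^(-s k - t)].  If the integral merely converges at [z],
    integration by parts shows that it converges at [x z] for every [x > 1] and
    is real-analytic in [x].  The condition [|l w^(-s)| < 1] persists along this
    ray (though not along the horizontal one), so the series is real-analytic
    there too, and both sides agree for all [x > 1] because they agree for large
    [x].  Letting [x] tend to 1, Abel's theorem and the binomial series conclude. *)

Require Import Defs.
From Stdlib Require Import Reals Lra Lia Psatz Factorial FunctionalExtensionality.
From Coquelicot Require Import Coquelicot.
Open Scope R_scope.

(** * Improper integrals over the positive half-line *)

(** At the given [z] the integrand need not be absolutely integrable, so nothing can be dominated
    there. The way out is its primitive [Phi], which is bounded as soon as the integral converges:
    the transform of [Phi] at [p z] converges absolutely for every [p > 0], and the values on the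
    ray are expressed through it. Analyticity is a purely real notion here: a sequence of successive
    derivatives with bounds [M n! r^n], continued by Taylor steps of fixed length. For the series
    these bounds must be uniform in the index [k], although the exponents [a = s k + t] are
    unbounded. The growth of [(a)_n] is paid for by [x^(-Re a)], with constants that degenerate as
    [x] tends to 1; hence the separate limit at the end. Gamma is available only as Euler's
    integral, so its lower bound at complex points is extracted from that integral. The points
    [s k + t] stay in one sector, where passing from [Gamma (Re a)] to [|Gamma a|] loses at most a
    factor exponential in [Re a], that is, geometric in [k]. Derivatives pass through integrals and
    sums by means of quadratic remainder bounds, which can be integrated or summed as they stand. *)

Definition is_int0oo (f : R -> R) (l : R) : Prop :=
  is_RInt_gen f (at_right 0) (Rbar_locally p_infty) l.

(** The premise [a < b] comes for free: the neighbourhood of infinity is taken beyond both [M] and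
    [d]. *)
Lemma is_int0oo_intro (f : R -> R) (l : R) :
  (forall eps : R, 0 < eps -> exists d M : R, 0 < d /\ forall a b : R,
     0 < a -> a < d -> M < b -> a < b ->
     exists y : R, is_RInt f a b y /\ Rabs (y - l) < eps) ->
  is_int0oo f l.
Proof.
intros H P [eps HP].
destruct (H eps (cond_pos eps)) as (d & M & Hd & HH).
apply (Filter_prod _ _ _ (fun a => 0 < a /\ a < d) (fun b => M < b /\ d < b)).
- exists (mkposreal d Hd); intros y Hy Hy0; split; [exact Hy0|].
  unfold ball in Hy; cbn in Hy; unfold AbsRing_ball, abs, minus, plus, opp in Hy; cbn in Hy.
  apply Rabs_def2 in Hy; lra.
- exists (Rmax M d); intros x Hx.
  pose proof (Rmax_l M d); pose proof (Rmax_r M d); lra.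
- intros a b [Ha1 Ha2] [Hb1 Hb2].
  destruct (HH a b Ha1 Ha2 Hb1 ltac:(lra)) as (y & Hy & Hyl).
  exists y; split; [exact Hy|]; apply HP; exact Hyl.
Qed.

Lemma is_int0oo_elim (f : R -> R) (l : R) : is_int0oo f l ->
  forall eps : R, 0 < eps -> exists d M : R, 0 < d /\ forall a b : R,
     0 < a -> a < d -> M < b ->
     exists y : R, is_RInt f a b y /\ Rabs (y - l) < eps.
Proof.
intros H eps Heps.
destruct (H (fun y => Rabs (y - l) < eps)) as [P1 P2 [d Hd] [M HM] HP].
{ exists (mkposreal eps Heps); intros y Hy; exact Hy. }
exists d, M; split; [apply cond_pos|].
intros a b Ha Had HMb.
apply HP; [apply Hd; [|exact Ha] | apply HM; exact HMb].
unfold ball; cbn; unfold AbsRing_ball, abs, minus, plus, opp; cbn.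
apply Rabs_def1; lra.
Qed.

Lemma is_int0oo_unique (f : R -> R) (l1 l2 : R) : is_int0oo f l1 -> is_int0oo f l2 -> l1 = l2.
Proof.
intros H1 H2.
assert (E1 := is_RInt_gen_unique (V := R_CompleteNormedModule) f l1 H1).
assert (E2 := is_RInt_gen_unique (V := R_CompleteNormedModule) f l2 H2).
congruence.
Qed.

Lemma is_int0oo_ext (f g : R -> R) (l : R) :
  (forall u, 0 < u -> f u = g u) -> is_int0oo f l -> is_int0oo g l.
Proof.
intros E H; apply is_int0oo_intro; intros eps Heps.
destruct (is_int0oo_elim f l H eps Heps) as (d & M & Hd & HH).
exists d, M; split; [exact Hd|]; intros a b Ha Had Hb Hab.
destruct (HH a b Ha Had Hb) as (y & Hy & Hyl); exists y; split; [|exact Hyl].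
apply (is_RInt_ext f); [|exact Hy].
intros x Hx; apply E; rewrite Rmin_left in Hx by lra; lra.
Qed.

Lemma is_int0oo_plus (f g : R -> R) (l m : R) :
  is_int0oo f l -> is_int0oo g m -> is_int0oo (fun u => f u + g u) (l + m).
Proof. intros Hf Hg; exact (is_RInt_gen_plus (V := R_NormedModule) f g l m Hf Hg). Qed.

Lemma is_int0oo_scal (f : R -> R) (k l : R) :
  is_int0oo f l -> is_int0oo (fun u => k * f u) (k * l).
Proof. intros Hf; exact (is_RInt_gen_scal (V := R_NormedModule) f k l Hf). Qed.

Lemma is_int0oo_minus (f g : R -> R) (l m : R) :
  is_int0oo f l -> is_int0oo g m -> is_int0oo (fun u => f u - g u) (l - m).
Proof. intros Hf Hg; exact (is_RInt_gen_minus (V := R_NormedModule) f g l m Hf Hg). Qed.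

Lemma is_int0oo_le (f g : R -> R) (l m : R) :
  (forall u, 0 < u -> f u <= g u) -> is_int0oo f l -> is_int0oo g m -> l <= m.
Proof.
intros E Hf Hg; apply Rnot_lt_le; intros Hlt.
destruct (is_int0oo_elim f l Hf ((l - m) / 2) ltac:(lra)) as (d & M & Hd & HH).
destruct (is_int0oo_elim g m Hg ((l - m) / 2) ltac:(lra)) as (d' & M' & Hd' & HH').
set (a := Rmin d d' / 2); set (b := Rmax (Rmax M M') a + 1).
assert (Ha : 0 < a < d /\ a < d').
{ unfold a; pose proof (Rmin_l d d'); pose proof (Rmin_r d d').
  pose proof (Rmin_glb_lt d d' 0 Hd Hd'); lra. }
assert (Hb : M < b /\ M' < b /\ a < b).
{ unfold b; pose proof (Rmax_l (Rmax M M') a); pose proof (Rmax_r (Rmax M M') a).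
  pose proof (Rmax_l M M'); pose proof (Rmax_r M M'); lra. }
destruct (HH a b) as (y & Hy & Hyl); try lra.
destruct (HH' a b) as (y' & Hy' & Hyl'); try lra.
assert (Hyy : y <= y').
{ apply (is_RInt_le f g a b); try lra; try assumption.
  intros x Hx; apply E; lra. }
apply Rabs_def2 in Hyl; apply Rabs_def2 in Hyl'; lra.
Qed.

Lemma RInt_eq (f : R -> R) (a b y : R) : is_RInt f a b y -> RInt f a b = y.
Proof. exact (is_RInt_unique (V := R_CompleteNormedModule) f a b y). Qed.

Lemma ex_RInt_pos (f : R -> R) (a b : R) :
  (forall u, 0 < u -> continuous f u) -> 0 < a -> 0 < b -> ex_RInt f a b.
Proof.
intros Hf Ha Hb; apply (ex_RInt_continuous (V := R_CompleteNormedModule)).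
intros z Hz; apply Hf; pose proof (Rmin_glb_lt a b 0 Ha Hb); lra.
Qed.

Lemma RInt_abs_le (f h : R -> R) (a b : R) : a <= b ->
  ex_RInt f a b -> ex_RInt h a b -> (forall u, a < u < b -> Rabs (f u) <= h u) ->
  Rabs (RInt f a b) <= RInt h a b.
Proof.
intros Hab Hf Hh H; apply Rabs_le; split.
- assert (E : RInt (fun u => - h u) a b = - RInt h a b)
    by exact (RInt_opp (V := R_CompleteNormedModule) h a b Hh).
  rewrite <- E.
  apply RInt_le; [exact Hab | exact (ex_RInt_opp (V := R_NormedModule) h a b Hh) | exact Hf |].
  intros x Hx; specialize (H x Hx); apply Rabs_le_between in H; lra.
- apply RInt_le; [exact Hab | exact Hf | exact Hh |].
  intros x Hx; specialize (H x Hx); apply Rabs_le_between in H; lra.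
Qed.

Lemma RInt_Chasles_R (f : R -> R) (a b c : R) :
  (forall u, 0 < u -> continuous f u) -> 0 < a -> 0 < b -> 0 < c ->
  RInt f a b + RInt f b c = RInt f a c.
Proof.
intros Hf Ha Hb Hc.
apply (RInt_Chasles (V := R_CompleteNormedModule)); apply ex_RInt_pos; assumption.
Qed.

(** The limit is the supremum of the integrals over compact subintervals; by nonnegativity,
    enlarging an interval that comes close to it can only come closer. *)
Lemma is_int0oo_monotone (g : R -> R) (B : R) :
  (forall u, 0 < u -> continuous g u) -> (forall u, 0 < u -> 0 <= g u) ->
  (forall a b, 0 < a -> a < b -> RInt g a b <= B) -> exists l, is_int0oo g l.
Proof.
intros Cg Pg HB.
assert (N : forall a b, 0 < a -> a <= b -> 0 <= RInt g a b).
{ intros a b Ha Hab; apply RInt_ge_0; [exact Hab | apply ex_RInt_pos; assumption || lra |].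
  intros x Hx; apply Pg; lra. }
destruct (completeness (fun y => exists a b, 0 < a /\ a < b /\ y = RInt g a b)) as [l [Hub Hl]].
- exists B; intros y (a & b & Ha & Hab & ->); auto.
- exists (RInt g 1 2), 1, 2; repeat split; lra.
- exists l; apply is_int0oo_intro; intros eps Heps.
  assert (Hx : exists a b, 0 < a /\ a < b /\ l - eps < RInt g a b).
  { apply Classical_Prop.NNPP; intros Hn.
    assert (l <= l - eps); [|lra].
    apply Hl; intros y (a & b & Ha & Hab & ->).
    apply Rnot_lt_le; intros Hlt; apply Hn; exists a, b; auto. }
  destruct Hx as (a0 & b0 & Ha0 & Hab0 & H0).
  exists a0, b0; split; [exact Ha0|]; intros a b Ha Haa Hbb Hab.
  exists (RInt g a b); split.
  + apply (RInt_correct (V := R_CompleteNormedModule)), ex_RInt_pos; assumption || lra.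
  + assert (RInt g a b <= l) by (apply Hub; exists a, b; auto).
    rewrite <- (RInt_Chasles_R g a a0 b), <- (RInt_Chasles_R g a0 b0 b) in * by (assumption || lra).
    pose proof (N a a0 Ha ltac:(lra)); pose proof (N b0 b ltac:(lra) ltac:(lra)).
    apply Rabs_def1; lra.
Qed.

Lemma is_int0oo_RInt_le (h : R -> R) (H a b : R) :
  (forall u, 0 < u -> continuous h u) -> (forall u, 0 < u -> 0 <= h u) ->
  is_int0oo h H -> 0 < a -> a <= b -> RInt h a b <= H.
Proof.
intros Ch Ph Hh Ha Hab.
assert (N : forall a b, 0 < a -> a <= b -> 0 <= RInt h a b).
{ intros x y Hx Hxy; apply RInt_ge_0; [exact Hxy | apply ex_RInt_pos; assumption || lra |].
  intros u Hu; apply Ph; lra. }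
apply Rnot_lt_le; intros Hlt.
destruct (is_int0oo_elim h H Hh (RInt h a b - H) ltac:(lra)) as (d & M & Hd & HH).
set (a' := Rmin d a / 2); set (b' := Rmax M b + 1).
assert (Ha' : 0 < a' < d /\ a' < a).
{ unfold a'; pose proof (Rmin_l d a); pose proof (Rmin_r d a).
  pose proof (Rmin_glb_lt d a 0 Hd Ha); lra. }
assert (Hb' : M < b' /\ b < b').
{ unfold b'; pose proof (Rmax_l M b); pose proof (Rmax_r M b); lra. }
destruct (HH a' b') as (y & Hy & Hyl); try lra.
apply RInt_eq in Hy.
rewrite <- (RInt_Chasles_R h a' a b'), <- (RInt_Chasles_R h a b b') in Hy by (assumption || lra).
pose proof (N a' a ltac:(lra) ltac:(lra)); pose proof (N b b' ltac:(lra) ltac:(lra)).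
apply Rabs_def2 in Hyl; lra.
Qed.

(** Since [0 <= f + h <= 2 h], the monotone criterion applies to [f + h], and [f = (f + h) - h]. *)
Lemma is_int0oo_dominated (f h : R -> R) (H : R) :
  (forall u, 0 < u -> continuous f u) -> (forall u, 0 < u -> continuous h u) ->
  (forall u, 0 < u -> Rabs (f u) <= h u) -> is_int0oo h H ->
  exists l, is_int0oo f l /\ Rabs l <= H.
Proof.
intros Cf Ch Hfh Hh.
assert (Ph : forall u, 0 < u -> 0 <= h u).
{ intros u Hu; exact (Rle_trans _ _ _ (Rabs_pos _) (Hfh u Hu)). }
assert (Cs : forall u, 0 < u -> continuous (fun v => f v + h v) u).
{ intros u Hu; apply (continuous_plus (V := R_NormedModule)); auto. }
destruct (is_int0oo_monotone (fun u => f u + h u) (2 * H)) as [m Hm].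
- exact Cs.
- intros u Hu; specialize (Hfh u Hu); apply Rabs_le_between in Hfh; lra.
- intros a b Ha Hab.
  pose proof (is_int0oo_RInt_le h H a b Ch Ph Hh Ha ltac:(lra)).
  assert (RInt (fun u => f u + h u) a b <= RInt (fun u => 2 * h u) a b).
  { apply RInt_le; [lra | apply ex_RInt_pos; assumption || lra | |].
    - apply (ex_RInt_scal (V := R_NormedModule)), ex_RInt_pos; assumption || lra.
    - intros u Hu; specialize (Hfh u ltac:(lra)); apply Rabs_le_between in Hfh; lra. }
  assert (RInt (fun u => 2 * h u) a b = 2 * RInt h a b).
  { apply (RInt_scal (V := R_CompleteNormedModule)), ex_RInt_pos; assumption || lra. }
  lra.
- exists (m - H); assert (Hl : is_int0oo f (m - H)).
  { apply (is_int0oo_ext (fun u => (f u + h u) - h u)); [intros; ring | apply is_int0oo_minus; assumption]. }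
  split; [exact Hl|].
  apply Rabs_le; split.
  + apply Ropp_le_cancel; rewrite Ropp_involutive.
    apply (is_int0oo_le (fun u => - 1 * f u) h); [| |exact Hh].
    * intros u Hu; specialize (Hfh u Hu); apply Rabs_le_between in Hfh; lra.
    * replace (- (m - H)) with (-1 * (m - H)) by ring; apply is_int0oo_scal, Hl.
  + apply (is_int0oo_le f h); [| exact Hl |exact Hh].
    intros u Hu; specialize (Hfh u Hu); apply Rabs_le_between in Hfh; lra.
Qed.

(** * One-sided limits at 0 and infinity, and primitives *)

Definition lim0 (F : R -> R) (l : R) : Prop := filterlim F (at_right 0) (locally l).
Definition limoo (F : R -> R) (l : R) : Prop := filterlim F (Rbar_locally p_infty) (locally l).

Lemma lim0P (F : R -> R) (l : R) : lim0 F l <->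
  forall eps, 0 < eps -> exists d, 0 < d /\ forall a, 0 < a -> a < d -> Rabs (F a - l) < eps.
Proof.
split.
- intros H eps Heps; destruct (H (fun y => Rabs (y - l) < eps)) as [d Hd].
  { exists (mkposreal eps Heps); intros y Hy; exact Hy. }
  exists d; split; [apply cond_pos|]; intros a Ha Had; apply Hd; [|exact Ha].
  unfold ball; cbn; unfold AbsRing_ball, abs, minus, plus, opp; cbn; apply Rabs_def1; lra.
- intros H P [eps HP]; destruct (H eps (cond_pos eps)) as (d & Hd & Hf).
  exists (mkposreal d Hd); intros y Hy Hy0; apply HP, Hf; [exact Hy0|].
  unfold ball in Hy; cbn in Hy; unfold AbsRing_ball, abs, minus, plus, opp in Hy; cbn in Hy.
  apply Rabs_def2 in Hy; lra.
Qed.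

Lemma limooP (F : R -> R) (l : R) : limoo F l <->
  forall eps, 0 < eps -> exists M, forall a, M < a -> Rabs (F a - l) < eps.
Proof.
split.
- intros H eps Heps; destruct (H (fun y => Rabs (y - l) < eps)) as [M HM].
  { exists (mkposreal eps Heps); intros y Hy; exact Hy. }
  exists M; exact HM.
- intros H P [eps HP]; destruct (H eps (cond_pos eps)) as (M & HM).
  exists M; intros y Hy; apply HP, HM, Hy.
Qed.

Lemma is_int0oo_derive (F f : R -> R) (la lb : R) :
  (forall u, 0 < u -> is_derive F u (f u)) -> (forall u, 0 < u -> continuous f u) ->
  lim0 F la -> limoo F lb -> is_int0oo f (lb - la).
Proof.
intros HF Cf H0 Hoo; rewrite lim0P in H0; rewrite limooP in Hoo.
apply is_int0oo_intro; intros eps Heps.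
destruct (H0 (eps / 2)) as (d & Hd & Hd'); [lra|].
destruct (Hoo (eps / 2)) as (M & HM); [lra|].
exists d, M; split; [exact Hd|]; intros a b Ha Had HMb Hab.
exists (F b - F a); split.
- apply (is_RInt_derive (V := R_CompleteNormedModule) F f); intros x Hx;
  rewrite Rmin_left in Hx by lra; [apply HF | apply Cf]; lra.
- specialize (Hd' a Ha Had); specialize (HM b HMb).
  apply Rabs_def2 in Hd'; apply Rabs_def2 in HM; apply Rabs_def1; lra.
Qed.

(** The joint limit in both endpoints splits into two separate ones. The limit at 0 exists by
    Cauchy's criterion, and the one at infinity then follows by subtraction. *)
Lemma is_int0oo_primitive_limits (f : R -> R) (l : R) :
  (forall u, 0 < u -> continuous f u) -> is_int0oo f l ->
  exists l0 loo, lim0 (fun u => RInt f 1 u) l0 /\ limoo (fun u => RInt f 1 u) loo /\ l = loo - l0.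
Proof.
intros Cf Hf.
assert (K : forall eps, 0 < eps -> exists d M, 0 < d /\ forall a b, 0 < a -> a < d -> M < b -> 0 < b ->
  Rabs (RInt f 1 b - RInt f 1 a - l) < eps).
{ intros eps Heps; destruct (is_int0oo_elim f l Hf eps Heps) as (d & M & Hd & HH).
  exists d, M; split; [exact Hd|]; intros a b Ha Had HMb Hb.
  destruct (HH a b Ha Had HMb) as (y & Hy & Hyl); apply RInt_eq in Hy.
  pose proof (RInt_Chasles_R f 1 a b Cf ltac:(lra) Ha Hb).
  replace (RInt f 1 b - RInt f 1 a - l) with (y - l) by lra; exact Hyl. }
assert (E0 : exists l0, lim0 (fun u => RInt f 1 u) l0).
{ apply (filterlim_locally_cauchy (U := R_CompleteSpace)); intros eps.
  destruct (K (eps / 2)) as (d & M & Hd & HK); [pose proof (cond_pos eps); lra|].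
  exists (fun a => 0 < a < d); split.
  - exists (mkposreal d Hd); intros y Hy Hy0; split; [exact Hy0|].
    unfold ball in Hy; cbn in Hy; unfold AbsRing_ball, abs, minus, plus, opp in Hy; cbn in Hy.
    apply Rabs_def2 in Hy; lra.
  (* Both small endpoints are paired with the same far endpoint [b], whose contribution cancels in
     the difference. *)
  - intros u v Hu Hv; change (Rabs (RInt f 1 v - RInt f 1 u) < eps).
    set (b := Rmax M 0 + 1); pose proof (Rmax_l M 0); pose proof (Rmax_r M 0).
    pose proof (HK u b ltac:(lra) ltac:(lra) ltac:(unfold b; lra) ltac:(unfold b; lra)) as H1.
    pose proof (HK v b ltac:(lra) ltac:(lra) ltac:(unfold b; lra) ltac:(unfold b; lra)) as H2.
    apply Rabs_def2 in H1; apply Rabs_def2 in H2; apply Rabs_def1; lra. }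
destruct E0 as [l0 E0]; exists l0, (l + l0); split; [exact E0|]; split; [|ring].
rewrite lim0P in E0; apply limooP; intros eps Heps.
destruct (K (eps / 2)) as (d & M & Hd & HK); [lra|].
destruct (E0 (eps / 2)) as (d' & Hd' & HE); [lra|].
exists (Rmax M 0); intros b Hb; pose proof (Rmax_l M 0); pose proof (Rmax_r M 0).
set (a := Rmin d d' / 2).
assert (0 < a < d /\ a < d').
{ unfold a; pose proof (Rmin_l d d'); pose proof (Rmin_r d d').
  pose proof (Rmin_glb_lt d d' 0 Hd Hd'); lra. }
specialize (HK a b ltac:(lra) ltac:(lra) ltac:(lra) ltac:(lra)).
specialize (HE a ltac:(lra) ltac:(lra)).
apply Rabs_def2 in HK; apply Rabs_def2 in HE; apply Rabs_def1; lra.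
Qed.

(** * Tails of real series, and termwise integration *)

Lemma sum_n_m_abs_le (f : nat -> R) (m : nat -> R) (N M : nat) :
  (forall k, Rabs (f k) <= m k) -> Rabs (sum_n_m f N M) <= sum_n_m m N M.
Proof.
intros H; eapply Rle_trans; [apply (norm_sum_n_m (K := R_AbsRing) (V := R_NormedModule))|].
apply sum_n_m_le; exact H.
Qed.

Lemma ex_series_dom (f m : nat -> R) :
  (forall k, Rabs (f k) <= m k) -> ex_series m -> ex_series f.
Proof. intros H; apply (ex_series_le (K := R_AbsRing) (V := R_CompleteNormedModule)), H. Qed.

Lemma Series_nonneg (a : nat -> R) : (forall k, 0 <= a k) -> ex_series a -> 0 <= Series a.
Proof.
intros Pa Ha; apply Rle_trans with (Rabs (Series a)); [apply Rabs_pos|].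
assert (E : forall k, Rabs (a k) = a k) by (intros k; apply Rabs_pos_eq, Pa).
rewrite <- (Series_ext _ _ E) at 2.
apply Series_Rabs, (ex_series_ext a); [|exact Ha].
intros k; apply eq_sym, E.
Qed.

Lemma Series_tail_le (f m : nat -> R) (N : nat) :
  (forall k, Rabs (f k) <= m k) -> ex_series m ->
  Rabs (Series f - sum_n f N) <= Series (fun k => m (S N + k)%nat).
Proof.
intros H Hm.
assert (Hf := ex_series_dom f m H Hm).
rewrite (Series_incr_n f (S N)) by (lia || exact Hf); cbn [pred].
replace (sum_f_R0 f N) with (sum_n f N) by (apply sum_n_Reals).
replace (sum_n f N + Series (fun k => f (S N + k)%nat) - sum_n f N)
  with (Series (fun k => f (S N + k)%nat)) by ring.
assert (Hm' : ex_series (fun k => m (S N + k)%nat)) by (apply ex_series_incr_n; exact Hm).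
assert (Ha : ex_series (fun k => Rabs (f (S N + k)%nat))).
{ apply (ex_series_dom _ (fun k => m (S N + k)%nat)); [|exact Hm'].
  intros k; rewrite Rabs_Rabsolu; apply H. }
eapply Rle_trans; [apply Series_Rabs; exact Ha|].
apply Series_le; [|exact Hm']; intros k; split; [apply Rabs_pos | apply H].
Qed.

Lemma Series_tail_lim (m : nat -> R) : (forall k, 0 <= m k) -> ex_series m ->
  forall eps, 0 < eps -> exists N, forall n, (N <= n)%nat ->
    Series (fun k => m (S n + k)%nat) < eps.
Proof.
intros Pm Hm eps Heps.
assert (Hs := Series_correct _ Hm).
apply is_series_Reals in Hs.
destruct (Hs eps Heps) as [N HN]; exists N; intros n Hn.
specialize (HN n Hn); unfold R_dist in HN.
rewrite (Series_incr_n m (S n)) in HN by (lia || exact Hm); cbn [pred] in HN.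
apply Rabs_def2 in HN; lra.
Qed.

Lemma continuous_R (f : R -> R) (x : R) : continuous f x <->
  forall eps, 0 < eps -> exists d, 0 < d /\ forall y, Rabs (y - x) < d -> Rabs (f y - f x) < eps.
Proof.
split.
- intros H eps Heps; destruct (H (fun y => Rabs (y - f x) < eps)) as [d Hd].
  { exists (mkposreal eps Heps); intros y Hy; exact Hy. }
  exists d; split; [apply cond_pos | exact Hd].
- intros H P [eps HP]; destruct (H eps (cond_pos eps)) as (d & Hd & Hf).
  exists (mkposreal d Hd); intros y Hy; apply HP, Hf; exact Hy.
Qed.

Lemma continuous_sum_n (f : nat -> R -> R) (N : nat) (x : R) :
  (forall k, continuous (f k) x) -> continuous (fun y => sum_n (fun k => f k y) N) x.
Proof.
intros H; induction N as [|N IH].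
- apply (continuous_ext (f 0%nat)); [intros y; now rewrite sum_O | apply H].
- apply (continuous_ext (fun y => sum_n (fun k => f k y) N + f (S N) y)).
  + intros y; now rewrite sum_Sn.
  + apply (continuous_plus (V := R_NormedModule)); auto.
Qed.

(** Weierstrass's M-test at a point: two tails of the majorant and one finite sum, each contributing
    at most [eps / 3]. *)
Lemma continuous_Series (f : nat -> R -> R) (m : nat -> R) (x d : R) : 0 < d ->
  (forall k, continuous (f k) x) ->
  (forall k y, Rabs (y - x) < d -> Rabs (f k y) <= m k) -> ex_series m ->
  continuous (fun y => Series (fun k => f k y)) x.
Proof.
intros Hd Cf Hm Sm; apply continuous_R; intros eps Heps.
assert (Pm : forall k, 0 <= m k).
{ intros k; eapply Rle_trans; [apply Rabs_pos | apply (Hm k x)].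
  rewrite Rminus_eq_0, Rabs_R0; exact Hd. }
destruct (Series_tail_lim m Pm Sm (eps / 3)) as [N HN]; [lra|].
specialize (HN N (le_n N)).
destruct (proj1 (continuous_R _ x) (continuous_sum_n f N x Cf) (eps / 3)) as (d' & Hd' & Hc); [lra|].
exists (Rmin d d'); split; [now apply Rmin_glb_lt|]; intros y Hy.
specialize (Hc y (Rlt_le_trans _ _ _ Hy (Rmin_r d d'))).
pose proof (Series_tail_le (fun k => f k y) m N
  (fun k => Hm k y (Rlt_le_trans _ _ _ Hy (Rmin_l d d'))) Sm) as T1.
assert (Hx : Rabs (x - x) < d) by (rewrite Rminus_eq_0, Rabs_R0; exact Hd).
pose proof (Series_tail_le (fun k => f k x) m N (fun k => Hm k x Hx) Sm) as T2.
apply Rabs_def2 in Hc; apply Rabs_le_between in T1; apply Rabs_le_between in T2.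
cbn beta in *; apply Rabs_def1; lra.
Qed.

Lemma RInt_sum_n (f : nat -> R -> R) (a b : R) (N : nat) :
  (forall k, ex_RInt (f k) a b) ->
  is_RInt (fun u => sum_n (fun k => f k u) N) a b (sum_n (fun k => RInt (f k) a b) N).
Proof.
intros H; induction N as [|N IH].
- rewrite sum_O; apply (is_RInt_ext (f 0%nat)); [intros x _; now rewrite sum_O|].
  apply (RInt_correct (V := R_CompleteNormedModule)), H.
- rewrite sum_Sn; apply (is_RInt_ext (fun u => sum_n (fun k => f k u) N + f (S N) u)).
  + intros x _; now rewrite sum_Sn.
  + apply (is_RInt_plus (V := R_NormedModule)); [exact IH|].
    apply (RInt_correct (V := R_CompleteNormedModule)), H.
Qed.

Lemma is_int0oo_sum_n (f : nat -> R -> R) (l : nat -> R) (N : nat) :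
  (forall k, is_int0oo (f k) (l k)) -> is_int0oo (fun u => sum_n (fun k => f k u) N) (sum_n l N).
Proof.
intros H; induction N as [|N IH].
- rewrite sum_O; apply (is_int0oo_ext (f 0%nat)); [intros x _; now rewrite sum_O|]; apply H.
- rewrite sum_Sn; apply (is_int0oo_ext (fun u => sum_n (fun k => f k u) N + f (S N) u)).
  + intros x _; now rewrite sum_Sn.
  + apply is_int0oo_plus; auto.
Qed.

(* On [[a, b]] the series converges uniformly, so its integral is the sum of
   the integrals there; the error made by truncating at [N] is bounded by the
   tail of [H], uniformly in [a] and [b]. *)
Lemma is_int0oo_Series (f h : nat -> R -> R) (l H : nat -> R) :
  (forall k u, 0 < u -> continuous (f k) u) -> (forall k u, 0 < u -> continuous (h k) u) ->
  (forall k u, 0 < u -> Rabs (f k u) <= h k u) ->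
  (forall k, is_int0oo (f k) (l k)) -> (forall k, is_int0oo (h k) (H k)) -> ex_series H ->
  (forall a b, 0 < a -> a < b -> exists m : nat -> R, ex_series m /\
     forall k u, a <= u <= b -> Rabs (f k u) <= m k) ->
  is_int0oo (fun u => Series (fun k => f k u)) (Series l).
Proof.
intros Cf Ch Hfh Hf Hh SH Hloc.
assert (Ph : forall k u, 0 < u -> 0 <= h k u).
{ intros k u Hu; exact (Rle_trans _ _ _ (Rabs_pos _) (Hfh k u Hu)). }
assert (PH : forall k a b, 0 < a -> a <= b -> RInt (h k) a b <= H k).
{ intros k a b Ha Hab; apply is_int0oo_RInt_le; auto. }
assert (Hl : forall k, Rabs (l k) <= H k).
{ intros k; destruct (is_int0oo_dominated (f k) (h k) (H k)) as (l' & Hl' & Hb); auto.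
  rewrite (is_int0oo_unique _ _ _ (Hf k) Hl'); exact Hb. }
assert (PH0 : forall k, 0 <= H k).
{ intros k; exact (Rle_trans _ _ _ (Rabs_pos _) (Hl k)). }
set (F := fun u => Series (fun k => f k u)).
assert (CF : forall u, 0 < u -> continuous F u).
{ intros u Hu; destruct (Hloc (u / 2) (2 * u)) as (m & Sm & Hm); try lra.
  apply (continuous_Series f m u (u / 2)); [lra | auto | | exact Sm].
  intros k y Hy; apply Hm; apply Rabs_def2 in Hy; lra. }
assert (T : forall N a b, 0 < a -> a < b ->
  Rabs (RInt F a b - sum_n (fun k => RInt (f k) a b) N) <= Series (fun k => H (S N + k)%nat)).
{ intros N a b Ha Hab; apply Rnot_lt_le; intros Hlt.
  (* [g] is the supposed excess over the bound. Truncating at a later index [M], chosen so that the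
     uniform error on [[a, b]] integrates to at most [g / 2], leaves an excess of at most [g / 2], a
     contradiction. *)
  set (g := Rabs (RInt F a b - sum_n (fun k => RInt (f k) a b) N)
            - Series (fun k => H (S N + k)%nat)) in *.
  destruct (Hloc a b Ha Hab) as (m & Sm & Hm).
  assert (Pm : forall k, 0 <= m k).
  { intros k; exact (Rle_trans _ _ _ (Rabs_pos _) (Hm k a ltac:(lra))). }
  destruct (Series_tail_lim m Pm Sm (g / (2 * (b - a)))) as [M0 HM0].
  { apply Rdiv_lt_0_compat; unfold g; lra. }
  set (M := (M0 + N)%nat); specialize (HM0 M ltac:(unfold M; lia)).
  assert (Ef : forall k, ex_RInt (f k) a b) by (intros; apply ex_RInt_pos; auto || lra).
  pose proof (RInt_sum_n f a b M Ef) as HS.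
  assert (ES : ex_RInt (fun u => sum_n (fun k => f k u) M) a b) by (eexists; exact HS).
  apply RInt_eq in HS.
  assert (EF : ex_RInt F a b) by (apply ex_RInt_pos; auto || lra).
  assert (D1 : Rabs (RInt F a b - sum_n (fun k => RInt (f k) a b) M) <= g / 2).
  { rewrite <- HS, <- (RInt_minus (V := R_CompleteNormedModule)) by assumption.
    replace (g / 2) with (RInt (fun _ => g / (2 * (b - a))) a b).
    - apply RInt_abs_le; [lra | apply (ex_RInt_minus (V := R_NormedModule)); assumption
        | apply ex_RInt_const |].
      intros u Hu; apply Rlt_le, Rle_lt_trans with (2 := HM0).
      apply (Series_tail_le (fun k => f k u) m M); [|exact Sm].
      intros k; apply Hm; lra.
    - rewrite RInt_const; unfold scal; cbn; unfold mult; cbn; field; lra. }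
  assert (D2 : Rabs (sum_n (fun k => RInt (f k) a b) M - sum_n (fun k => RInt (f k) a b) N)
     <= Series (fun k => H (S N + k)%nat)).
  { assert (B : forall k, Rabs (RInt (f k) a b) <= H k).
    { intros k; eapply Rle_trans; [|apply (PH k a b); lra].
      apply RInt_abs_le; [lra | auto | apply ex_RInt_pos; auto || lra |].
      intros u Hu; apply Hfh; lra. }
    assert (EE : sum_n (fun k => RInt (f k) a b) M - sum_n (fun k => RInt (f k) a b) N
       = sum_n_m (fun k => RInt (f k) a b) (S N) M).
    { unfold sum_n; rewrite (sum_n_m_Chasles _ 0 N M) by (unfold M; lia).
      unfold plus; cbn; ring. }
    rewrite EE; eapply Rle_trans; [apply (sum_n_m_abs_le _ H); exact B|].
    assert (EX : sum_n_m H (S N) M = sum_n H M - sum_n H N).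
    { unfold sum_n; rewrite (sum_n_m_Chasles _ 0 N M) by (unfold M; lia).
      unfold plus; cbn; ring. }
    rewrite EX.
    assert (Z1 := Series_incr_n H (S N) ltac:(lia) SH).
    assert (Z2 := Series_incr_n H (S M) ltac:(lia) SH).
    cbn [pred] in *; rewrite <- !sum_n_Reals in Z1, Z2.
    assert (0 <= Series (fun k => H (S M + k)%nat)); [|lra].
    apply Series_nonneg; [intros k; apply PH0|].
    apply (ex_series_incr_n H (S M)); exact SH. }
  apply Rabs_le_between in D1; apply Rabs_le_between in D2.
  assert (Eg : g + Series (fun k => H (S N + k)%nat)
    = Rabs (RInt F a b - sum_n (fun k => RInt (f k) a b) N)) by (unfold g; ring).
  assert (Pg : 0 < g) by (unfold g; lra).
  assert (Rabs (RInt F a b - sum_n (fun k => RInt (f k) a b) N)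
    <= g / 2 + Series (fun k => H (S N + k)%nat)); [|lra].
  apply Rabs_le; lra. }
apply is_int0oo_intro; intros eps Heps.
destruct (Series_tail_lim H PH0 SH (eps / 3)) as [N HN]; [lra|].
specialize (HN N (le_n N)).
destruct (is_int0oo_elim _ _ (is_int0oo_sum_n f l N Hf) (eps / 3)) as (d & M & Hd & HH); [lra|].
exists d, M; split; [exact Hd|]; intros a b Ha Had HMb Hab.
exists (RInt F a b); split.
- apply (RInt_correct (V := R_CompleteNormedModule)), ex_RInt_pos; auto || lra.
- destruct (HH a b Ha Had HMb) as (y & Hy & Hyl); apply RInt_eq in Hy.
  assert (Ef : forall k, ex_RInt (f k) a b) by (intros; apply ex_RInt_pos; auto || lra).
  rewrite (RInt_eq _ _ _ _ (RInt_sum_n f a b N Ef)) in Hy.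
  specialize (T N a b Ha Hab).
  pose proof (Series_tail_le l H N Hl SH) as T2.
  apply Rabs_le_between in T; apply Rabs_le_between in T2; apply Rabs_def2 in Hyl.
  apply Rabs_def1; lra.
Qed.

(** * Real and imaginary parts, modulus, and the complex exponential *)

Lemma im_le_Cmod (z : C) : Rabs (Im z) <= Cmod z.
Proof. exact (Rle_trans _ _ _ (Rmax_r _ _) (Rmax_Cmod z)). Qed.

Lemma Cmod_le_sum (z : C) : Cmod z <= Rabs (Re z) + Rabs (Im z).
Proof.
replace z with (RtoC (Re z) + Ci * RtoC (Im z))%C at 1
  by (destruct z; apply injective_projections; cbn; ring).
eapply Rle_trans; [apply Cmod_triangle|].
rewrite Cmod_mult, Cmod_Ci, !Cmod_R; lra.
Qed.

Lemma C_eq (z w : C) : Re z = Re w -> Im z = Im w -> z = w.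
Proof. exact (injective_projections z w). Qed.

Lemma Re_plus (z w : C) : Re (z + w) = Re z + Re w. Proof. reflexivity. Qed.
Lemma Im_plus (z w : C) : Im (z + w) = Im z + Im w. Proof. reflexivity. Qed.
Lemma Re_minus (z w : C) : Re (z - w) = Re z - Re w. Proof. reflexivity. Qed.
Lemma Im_minus (z w : C) : Im (z - w) = Im z - Im w. Proof. reflexivity. Qed.
Lemma Re_opp (z : C) : Re (- z) = - Re z. Proof. reflexivity. Qed.
Lemma Im_opp (z : C) : Im (- z) = - Im z. Proof. reflexivity. Qed.
Lemma Re_mult (z w : C) : Re (z * w) = Re z * Re w - Im z * Im w. Proof. reflexivity. Qed.
Lemma Im_mult (z w : C) : Im (z * w) = Re z * Im w + Im z * Re w. Proof. reflexivity. Qed.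
Lemma Re_R (x : R) : Re (RtoC x) = x. Proof. reflexivity. Qed.
Lemma Im_R (x : R) : Im (RtoC x) = 0. Proof. reflexivity. Qed.
Lemma Re_Rmult (x : R) (z : C) : Re (RtoC x * z) = x * Re z.
Proof. rewrite Re_mult, Re_R, Im_R; ring. Qed.
Lemma Im_Rmult (x : R) (z : C) : Im (RtoC x * z) = x * Im z.
Proof. rewrite Im_mult, Re_R, Im_R; ring. Qed.
Lemma Re_multR (x : R) (z : C) : Re (z * RtoC x) = Re z * x.
Proof. rewrite Re_mult, Re_R, Im_R; ring. Qed.
Lemma Im_multR (x : R) (z : C) : Im (z * RtoC x) = Im z * x.
Proof. rewrite Im_mult, Re_R, Im_R; ring. Qed.

Lemma Cmod_Cexp (z : C) : Cmod (Cexp z) = exp (Re z).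
Proof.
unfold Cmod, Cexp, Re, Im; cbn [fst snd].
replace ((exp (fst z) * cos (snd z)) ^ 2 + (exp (fst z) * sin (snd z)) ^ 2)
  with (Rsqr (exp (fst z)) * (Rsqr (sin (snd z)) + Rsqr (cos (snd z)))) by (unfold Rsqr; ring).
rewrite sin2_cos2, Rmult_1_r; apply sqrt_Rsqr, Rlt_le, exp_pos.
Qed.

Lemma Cexp_neq_0 (z : C) : Cexp z <> 0%C.
Proof. apply Cmod_gt_0; rewrite Cmod_Cexp; apply exp_pos. Qed.

Lemma Cexp_R (x : R) : Cexp (RtoC x) = RtoC (exp x).
Proof. unfold Cexp; rewrite Re_R, Im_R, cos_0, sin_0; apply C_eq; cbn; ring. Qed.

(** * Complex-valued functions of a real variable *)

Definition contC (f : R -> C) (x : R) : Prop :=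
  continuous (fun t => Re (f t)) x /\ continuous (fun t => Im (f t)) x.

(** Taken coordinatewise because the mean value theorem, on which the estimates below rest, holds
    for each coordinate but not for complex values. *)
Definition derC (f : R -> C) (x : R) (l : C) : Prop :=
  is_derive (fun t => Re (f t)) x (Re l) /\ is_derive (fun t => Im (f t)) x (Im l).

Lemma derC_contC (f : R -> C) (x : R) (l : C) : derC f x l -> contC f x.
Proof.
intros [H1 H2]; split; apply (ex_derive_continuous (K := R_AbsRing) (V := R_NormedModule));
  eexists; eassumption.
Qed.

Lemma derC_eq (f : R -> C) (x : R) (l m : C) : derC f x l -> l = m -> derC f x m.
Proof. now intros H <-. Qed.

Lemma derC_ext (f g : R -> C) (x : R) (l : C) :
  (forall t, f t = g t) -> derC f x l -> derC g x l.
Proof.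
intros E [H1 H2]; split; (eapply is_derive_ext; [|eassumption]); intros t; cbn; now rewrite E.
Qed.

Lemma derC_const (c : C) (x : R) : derC (fun _ => c) x 0%C.
Proof.
split; [exact (is_derive_const (K := R_AbsRing) (V := R_NormedModule) (Re c) x)
  | exact (is_derive_const (K := R_AbsRing) (V := R_NormedModule) (Im c) x)].
Qed.

Lemma derC_R (f : R -> R) (x l : R) : is_derive f x l -> derC (fun t => RtoC (f t)) x (RtoC l).
Proof.
intros H; split; [exact H|].
exact (is_derive_const (K := R_AbsRing) (V := R_NormedModule) 0 x).
Qed.

Lemma derC_id (x : R) : derC RtoC x 1%C.
Proof. exact (derC_R (fun t => t) x 1 (is_derive_id (K := R_AbsRing) x)). Qed.

Lemma derC_plus (f g : R -> C) (x : R) (l m : C) :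
  derC f x l -> derC g x m -> derC (fun t => f t + g t)%C x (l + m)%C.
Proof.
intros [H1 H2] [K1 K2]; split;
  [exact (is_derive_plus (K := R_AbsRing) (V := R_NormedModule) _ _ _ _ _ H1 K1)
  | exact (is_derive_plus (K := R_AbsRing) (V := R_NormedModule) _ _ _ _ _ H2 K2)].
Qed.

Lemma derC_mult (f g : R -> C) (x : R) (l m : C) :
  derC f x l -> derC g x m -> derC (fun t => f t * g t)%C x (l * g x + f x * m)%C.
Proof.
assert (M : forall a b x l m, is_derive a x l -> is_derive b x m ->
  is_derive (fun t => a t * b t) x (l * b x + a x * m)).
{ intros a b y p q Ha Hb.
  apply (is_derive_mult (K := R_AbsRing) a b y p q Ha Hb); intros; apply Rmult_comm. }
assert (S : forall a b x l m, is_derive a x l -> is_derive b x m ->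
  is_derive (fun t => a t - b t) x (l - m)) by
  (intros a b y p q Ha Hb; exact (is_derive_minus (K := R_AbsRing) (V := R_NormedModule) a b y p q Ha Hb)).
assert (P : forall a b x l m, is_derive a x l -> is_derive b x m ->
  is_derive (fun t => a t + b t) x (l + m)) by
  (intros a b y p q Ha Hb; exact (is_derive_plus (K := R_AbsRing) (V := R_NormedModule) a b y p q Ha Hb)).
intros [H1 H2] [K1 K2]; split.
- rewrite Re_plus, !Re_mult.
  replace (Re l * Re (g x) - Im l * Im (g x) + (Re (f x) * Re m - Im (f x) * Im m))
    with ((Re l * Re (g x) + Re (f x) * Re m) - (Im l * Im (g x) + Im (f x) * Im m)) by ring.
  exact (S (fun t => Re (f t) * Re (g t)) (fun t => Im (f t) * Im (g t)) _ _ _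
    (M _ _ _ _ _ H1 K1) (M _ _ _ _ _ H2 K2)).
- rewrite Im_plus, !Im_mult.
  replace (Re l * Im (g x) + Im l * Re (g x) + (Re (f x) * Im m + Im (f x) * Re m))
    with ((Re l * Im (g x) + Re (f x) * Im m) + (Im l * Re (g x) + Im (f x) * Re m)) by ring.
  exact (P (fun t => Re (f t) * Im (g t)) (fun t => Im (f t) * Re (g t)) _ _ _
    (M _ _ _ _ _ H1 K2) (M _ _ _ _ _ H2 K1)).
Qed.

Lemma derC_scal (c : C) (f : R -> C) (x : R) (l : C) :
  derC f x l -> derC (fun t => c * f t)%C x (c * l)%C.
Proof.
intros H; eapply derC_eq; [apply derC_mult; [apply derC_const | exact H]|].
cbv beta; ring.
Qed.

Lemma derC_opp (f : R -> C) (x : R) (l : C) : derC f x l -> derC (fun t => - f t)%C x (- l)%C.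
Proof.
intros H; apply (derC_ext (fun t => -1 * f t)%C); [intros; ring|].
eapply derC_eq; [apply derC_scal, H | ring].
Qed.

Lemma derC_minus (f g : R -> C) (x : R) (l m : C) :
  derC f x l -> derC g x m -> derC (fun t => f t - g t)%C x (l - m)%C.
Proof. intros Hf Hg; apply derC_plus, derC_opp; assumption. Qed.

Lemma derC_Cexp (f : R -> C) (x : R) (l : C) :
  derC f x l -> derC (fun t => Cexp (f t)) x (l * Cexp (f x))%C.
Proof.
intros [H1 H2]; split; unfold Cexp; cbn [Re Im fst snd]; fold (Re (f x)) (Im (f x)).
- evar_last.
  + apply (is_derive_mult (K := R_AbsRing) (fun t => exp (Re (f t))) (fun t => cos (Im (f t)))).
    * apply (is_derive_comp (K := R_AbsRing) (V := R_NormedModule) exp (fun t => Re (f t)));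
        [apply is_derive_exp | exact H1].
    * apply (is_derive_comp (K := R_AbsRing) (V := R_NormedModule) cos (fun t => Im (f t)));
        [apply is_derive_cos | exact H2].
    * intros; apply Rmult_comm.
  + rewrite Re_mult; unfold scal, plus; cbn; unfold mult; cbn; unfold Re, Im; ring.
- evar_last.
  + apply (is_derive_mult (K := R_AbsRing) (fun t => exp (Re (f t))) (fun t => sin (Im (f t)))).
    * apply (is_derive_comp (K := R_AbsRing) (V := R_NormedModule) exp (fun t => Re (f t)));
        [apply is_derive_exp | exact H1].
    * apply (is_derive_comp (K := R_AbsRing) (V := R_NormedModule) sin (fun t => Im (f t)));
        [apply is_derive_sin | exact H2].
    * intros; apply Rmult_comm.
  + rewrite Im_mult; unfold scal, plus; cbn; unfold mult; cbn; unfold Re, Im; ring.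
Qed.

(** The uniqueness tool for the linear differential equations below: the solution times an
    integrating factor has derivative 0. *)
Lemma derC_zero_const (f : R -> C) (a b : R) : a <= b ->
  (forall x, a <= x <= b -> derC f x 0%C) -> f a = f b.
Proof.
intros Hab H.
assert (K : forall g : R -> R, (forall x, a <= x <= b -> is_derive g x 0) -> g a = g b).
{ intros g Hg.
  destruct (MVT_gen g a b (fun _ => 0)) as (c & _ & Hc).
  - intros x Hx; rewrite Rmin_left, Rmax_right in Hx by lra; apply Hg; lra.
  - intros x Hx; rewrite Rmin_left, Rmax_right in Hx by lra.
    apply continuity_pt_filterlim.
    apply (ex_derive_continuous (K := R_AbsRing) (V := R_NormedModule)).
    eexists; apply Hg; lra.
  - lra. }
apply C_eq.
- apply (K (fun t => Re (f t))); intros x Hx; apply (H x Hx).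
- apply (K (fun t => Im (f t))); intros x Hx; apply (H x Hx).
Qed.

(** The mean value theorem applied twice: [f (x + h) - f x = h f1 c], then
    [f1 c - f1 x = f2 c' (c - x)] with [|c - x| <= |h|]. This costs the factor 1/2 of Taylor's
    formula. *)
Lemma taylor2_R (f f1 f2 : R -> R) (x h B : R) :
  (forall y, Rmin x (x + h) <= y <= Rmax x (x + h) -> is_derive f y (f1 y)) ->
  (forall y, Rmin x (x + h) <= y <= Rmax x (x + h) -> is_derive f1 y (f2 y)) ->
  (forall y, Rmin x (x + h) <= y <= Rmax x (x + h) -> Rabs (f2 y) <= B) ->
  Rabs (f (x + h) - f x - h * f1 x) <= B * h ^ 2.
Proof.
intros H1 H2 HB.
assert (HC : forall g g1 a b, (forall y, Rmin a b <= y <= Rmax a b -> is_derive g y (g1 y)) ->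
  exists c, Rmin a b <= c <= Rmax a b /\ g b - g a = g1 c * (b - a)).
{ intros g g1 a b Hg; apply MVT_gen.
  - intros y Hy; apply Hg; lra.
  - intros y Hy; apply continuity_pt_filterlim.
    apply (ex_derive_continuous (K := R_AbsRing) (V := R_NormedModule)).
    eexists; apply Hg; lra. }
destruct (HC f f1 x (x + h) H1) as (c & Hc & E1).
destruct (HC f1 f2 x c) as (c' & Hc' & E2).
{ intros y Hy; apply H2; revert Hy Hc; unfold Rmin, Rmax; destruct Rle_dec; destruct Rle_dec; lra. }
replace (f (x + h) - f x - h * f1 x) with (f2 c' * ((c - x) * h))
  by (rewrite E1; replace (f1 c) with (f1 x + f2 c' * (c - x)) by lra; ring).
assert (Hb : Rabs (f2 c') <= B).
{ apply HB; revert Hc Hc'; unfold Rmin, Rmax; destruct Rle_dec; destruct Rle_dec; lra. }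
assert (Hch : Rabs ((c - x) * h) <= h ^ 2).
{ apply Rabs_le; revert Hc; unfold Rmin, Rmax; destruct Rle_dec; intros; nra. }
rewrite Rabs_mult; apply Rmult_le_compat; auto using Rabs_pos.
Qed.

Lemma taylor2_C (f f1 f2 : R -> C) (x h B : R) :
  (forall y, Rmin x (x + h) <= y <= Rmax x (x + h) -> derC f y (f1 y)) ->
  (forall y, Rmin x (x + h) <= y <= Rmax x (x + h) -> derC f1 y (f2 y)) ->
  (forall y, Rmin x (x + h) <= y <= Rmax x (x + h) -> Cmod (f2 y) <= B) ->
  Cmod (f (x + h)%R - f x - RtoC h * f1 x) <= 2 * B * h ^ 2.
Proof.
intros H1 H2 HB.
eapply Rle_trans; [apply Cmod_le_sum|].
rewrite !Re_minus, !Im_minus, Re_Rmult, Im_Rmult.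
assert (R1 := taylor2_R (fun t => Re (f t)) (fun t => Re (f1 t)) (fun t => Re (f2 t)) x h B
  (fun y Hy => proj1 (H1 y Hy)) (fun y Hy => proj1 (H2 y Hy))
  (fun y Hy => Rle_trans _ _ _ (re_le_Cmod _) (HB y Hy))).
assert (R2 := taylor2_R (fun t => Im (f t)) (fun t => Im (f1 t)) (fun t => Im (f2 t)) x h B
  (fun y Hy => proj2 (H1 y Hy)) (fun y Hy => proj2 (H2 y Hy))
  (fun y Hy => Rle_trans _ _ _ (im_le_Cmod _) (HB y Hy))).
cbn beta in *; lra.
Qed.

(** Taylor's estimate for [t -> exp (t h)] between 0 and 1. The second derivative is
    [h^2 exp (t h)], of modulus at most [|h|^2 exp |h|]. *)
Lemma Cexp_quad (h : C) : Cmod (Cexp h - 1 - h) <= 2 * Cmod h ^ 2 * exp (Cmod h).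
Proof.
assert (D : forall c y, derC (fun t => c * Cexp (RtoC t * h))%C y (c * h * Cexp (RtoC y * h))%C).
{ intros c y; eapply derC_eq.
  - apply derC_scal, derC_Cexp, derC_mult; [apply derC_id | apply derC_const].
  - cbv beta; ring. }
pose proof (taylor2_C (fun t => 1 * Cexp (RtoC t * h))%C (fun t => 1 * h * Cexp (RtoC t * h))%C
  (fun t => 1 * h * h * Cexp (RtoC t * h))%C 0 1 (Cmod h ^ 2 * exp (Cmod h))
  (fun y _ => D _ y) (fun y _ => D _ y)) as T.
cbv beta in T; rewrite Rplus_0_l, !Cmult_1_l in T.
rewrite Cmult_0_l, Cexp_0, Cmult_1_r in T.
eapply Rle_trans; [|eapply Rle_trans; [apply T|]]; [right; f_equal; ring| |right; ring].
intros y Hy; rewrite Rmin_left, Rmax_right in Hy by lra.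
rewrite !Cmod_mult, Cmod_Cexp.
replace (Cmod h * Cmod h) with (Cmod h ^ 2) by ring.
apply Rmult_le_compat_l; [apply pow2_ge_0|].
assert (Hr : Re (RtoC y * h) <= Cmod h).
{ rewrite Re_Rmult; pose proof (re_le_Cmod h) as Hh; apply Rabs_le_between in Hh.
  pose proof (Cmod_ge_0 h); nra. }
destruct Hr as [Hr|Hr]; [left; now apply exp_increasing | right; now rewrite Hr].
Qed.

(** This reduces differentiation under an integral or a sum to an inequality between the remainders
    of the integrands or terms, so that no exchange of limits occurs. *)
Lemma derC_quad (f : R -> C) (x : R) (l : C) (K r : R) : 0 < r ->
  (forall h, Rabs h < r -> Cmod (f (x + h)%R - f x - RtoC h * l) <= K * h ^ 2) -> derC f x l.
Proof.
intros Hr H.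
assert (Q : forall (g : R -> R) m,
  (forall h, Rabs h < r -> Rabs (g (x + h) - g x - h * m) <= K * h ^ 2) -> is_derive g x m).
{ intros g m Hg; apply is_derive_Reals; intros eps Heps.
  assert (PK : 0 < Rabs K + 1) by (pose proof (Rabs_pos K); lra).
  assert (Hd : 0 < Rmin r (eps / (Rabs K + 1))).
  { apply Rmin_glb_lt; [exact Hr | now apply Rdiv_lt_0_compat]. }
  exists (mkposreal _ Hd); intros h Hh0 Hh; cbn in Hh.
  assert (Hhr := Rlt_le_trans _ _ _ Hh (Rmin_l _ _)).
  assert (Hhe := Rlt_le_trans _ _ _ Hh (Rmin_r _ _)).
  specialize (Hg h Hhr).
  replace ((g (x + h) - g x) / h - m) with ((g (x + h) - g x - h * m) / h) by (field; exact Hh0).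
  assert (Ph : 0 < Rabs h) by (apply Rabs_pos_lt, Hh0).
  rewrite Rabs_div by exact Hh0.
  apply Rlt_div_l; [exact Ph|]; eapply Rle_lt_trans; [exact Hg|].
  apply Rlt_div_r in Hhe; [|exact PK].
  rewrite <- (pow2_abs h).
  pose proof (Rle_abs K); nra. }
split; apply Q; intros h Hh; eapply Rle_trans; [|apply (H h Hh)| |apply (H h Hh)].
- eapply Rle_trans; [|apply re_le_Cmod]; rewrite !Re_minus, Re_Rmult; right; reflexivity.
- eapply Rle_trans; [|apply im_le_Cmod]; rewrite !Im_minus, Im_Rmult; right; reflexivity.
Qed.

(** * Complex improper integrals *)

(** A working form to which the real lemmas apply coordinate by coordinate; [is_Cint0oo_correct] and
    [is_Cint0oo_complete] identify it with convergence in the normed module of complex numbers. *)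
Definition is_Cint0oo (f : R -> C) (l : C) : Prop :=
  is_int0oo (fun u => Re (f u)) (Re l) /\ is_int0oo (fun u => Im (f u)) (Im l).

Lemma is_Cint0oo_correct (f : R -> C) (l : C) : is_Cint0oo f l ->
  is_RInt_gen (V := C_R_NormedModule) f (at_right 0) (Rbar_locally p_infty) l.
Proof.
intros [H1 H2] P [eps HP].
assert (Q1 : locally (Re l) (fun y => ball (Re l) eps y)) by (now exists eps).
assert (Q2 : locally (Im l) (fun y => ball (Im l) eps y)) by (now exists eps).
specialize (H1 _ Q1); specialize (H2 _ Q2); unfold filtermapi in *.
assert (Q := filter_and _ _ H1 H2).
apply filter_imp with (2 := Q); intros [a b] [(y1 & I1 & B1) (y2 & I2 & B2)].
exists (y1, y2); split.
- apply (is_RInt_fct_extend_pair (U := R_NormedModule) (V := R_NormedModule)); assumption.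
- apply HP; split; assumption.
Qed.

Lemma is_Cint0oo_complete (f : R -> C) (l : C) :
  is_RInt_gen (V := C_R_NormedModule) f (at_right 0) (Rbar_locally p_infty) l -> is_Cint0oo f l.
Proof.
intros H; split; intros P [eps HP].
- assert (Q : locally (T := C_R_NormedModule) l (fun y => P (Re y))).
  { exists eps; intros y Hy; apply HP, Hy. }
  specialize (H _ Q); unfold filtermapi in *; apply filter_imp with (2 := H).
  intros [a b] (y & I & B); exists (Re y); split; [|exact B].
  apply (is_RInt_fct_extend_fst (U := R_NormedModule) (V := R_NormedModule)); exact I.
- assert (Q : locally (T := C_R_NormedModule) l (fun y => P (Im y))).
  { exists eps; intros y Hy; apply HP, Hy. }
  specialize (H _ Q); unfold filtermapi in *; apply filter_imp with (2 := H).
  intros [a b] (y & I & B); exists (Im y); split; [|exact B].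
  apply (is_RInt_fct_extend_snd (U := R_NormedModule) (V := R_NormedModule)); exact I.
Qed.

Lemma CInt0oo_eq (f : R -> C) (l : C) : is_Cint0oo f l -> CInt0oo f = l.
Proof.
intros H; exact (is_RInt_gen_unique (V := C_R_CompleteNormedModule) f l (is_Cint0oo_correct f l H)).
Qed.

Lemma is_Cint0oo_unique (f : R -> C) (l m : C) : is_Cint0oo f l -> is_Cint0oo f m -> l = m.
Proof.
intros [H1 H2] [K1 K2]; apply C_eq; eapply is_int0oo_unique; eassumption.
Qed.

Lemma is_Cint0oo_eq (f : R -> C) (l m : C) : is_Cint0oo f l -> l = m -> is_Cint0oo f m.
Proof. now intros H <-. Qed.

Lemma is_Cint0oo_ext (f g : R -> C) (l : C) :
  (forall u, 0 < u -> f u = g u) -> is_Cint0oo f l -> is_Cint0oo g l.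
Proof.
intros E [H1 H2]; split; (eapply is_int0oo_ext; [|eassumption]); intros u Hu; cbn; now rewrite E.
Qed.

Lemma is_Cint0oo_plus (f g : R -> C) (l m : C) :
  is_Cint0oo f l -> is_Cint0oo g m -> is_Cint0oo (fun u => f u + g u)%C (l + m)%C.
Proof. intros [H1 H2] [K1 K2]; split; apply is_int0oo_plus; assumption. Qed.

Lemma is_Cint0oo_scal (f : R -> C) (c l : C) :
  is_Cint0oo f l -> is_Cint0oo (fun u => c * f u)%C (c * l)%C.
Proof.
intros [H1 H2]; split.
- rewrite Re_mult; apply (is_int0oo_ext (fun u => Re c * Re (f u) - Im c * Im (f u)));
    [reflexivity|].
  apply is_int0oo_minus; apply is_int0oo_scal; assumption.
- rewrite Im_mult; apply (is_int0oo_ext (fun u => Re c * Im (f u) + Im c * Re (f u)));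
    [reflexivity|].
  apply is_int0oo_plus; apply is_int0oo_scal; assumption.
Qed.

Lemma is_Cint0oo_minus (f g : R -> C) (l m : C) :
  is_Cint0oo f l -> is_Cint0oo g m -> is_Cint0oo (fun u => f u - g u)%C (l - m)%C.
Proof. intros [H1 H2] [K1 K2]; split; apply is_int0oo_minus; assumption. Qed.

Lemma is_Cint0oo_dominated (f : R -> C) (h : R -> R) (H : R) :
  (forall u, 0 < u -> contC f u) -> (forall u, 0 < u -> continuous h u) ->
  (forall u, 0 < u -> Cmod (f u) <= h u) -> is_int0oo h H ->
  exists l, is_Cint0oo f l /\ Cmod l <= 2 * H.
Proof.
intros Cf Ch Hfh Hh.
destruct (is_int0oo_dominated (fun u => Re (f u)) h H) as (l1 & I1 & B1); [..|exact Hh|].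
- intros u Hu; apply (Cf u Hu).
- exact Ch.
- intros u Hu; eapply Rle_trans; [apply re_le_Cmod | auto].
- destruct (is_int0oo_dominated (fun u => Im (f u)) h H) as (l2 & I2 & B2); [..|exact Hh|].
  + intros u Hu; apply (Cf u Hu).
  + exact Ch.
  + intros u Hu; eapply Rle_trans; [apply im_le_Cmod | auto].
  + exists (l1, l2); split; [split; assumption|].
    eapply Rle_trans; [apply Cmod_le_sum|]; cbn; lra.
Qed.

Lemma is_Cint0oo_bound (f : R -> C) (l : C) (h : R -> R) (H : R) :
  (forall u, 0 < u -> Cmod (f u) <= h u) -> is_Cint0oo f l -> is_int0oo h H -> Cmod l <= 2 * H.
Proof.
intros Hfh [H1 H2] Hh.
assert (Neg : forall g k, is_int0oo g k -> is_int0oo (fun u => - 1 * g u) (- k)).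
{ intros g k Hg; replace (- k) with (-1 * k) by ring; apply is_int0oo_scal, Hg. }
assert (B : forall g k, (forall u, 0 < u -> Rabs (g u) <= h u) -> is_int0oo g k -> Rabs k <= H).
{ intros g k Hg Hk; apply Rabs_le; split.
  - apply Ropp_le_cancel; rewrite Ropp_involutive.
    apply (is_int0oo_le (fun u => - 1 * g u) h); [|apply Neg, Hk | exact Hh].
    intros u Hu; specialize (Hg u Hu); apply Rabs_le_between in Hg; lra.
  - apply (is_int0oo_le g h); [|exact Hk | exact Hh].
    intros u Hu; specialize (Hg u Hu); apply Rabs_le_between in Hg; lra. }
eapply Rle_trans; [apply Cmod_le_sum|].
apply B in H1; [apply B in H2|].
- lra.
- intros u Hu; eapply Rle_trans; [apply im_le_Cmod | auto].
- intros u Hu; eapply Rle_trans; [apply re_le_Cmod | auto].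
Qed.

Definition lim0C (F : R -> C) (l : C) : Prop :=
  lim0 (fun u => Re (F u)) (Re l) /\ lim0 (fun u => Im (F u)) (Im l).
Definition limooC (F : R -> C) (l : C) : Prop :=
  limoo (fun u => Re (F u)) (Re l) /\ limoo (fun u => Im (F u)) (Im l).

Lemma is_Cint0oo_derive (F f : R -> C) (la lb : C) :
  (forall u, 0 < u -> derC F u (f u)) -> (forall u, 0 < u -> contC f u) ->
  lim0C F la -> limooC F lb -> is_Cint0oo f (lb - la)%C.
Proof.
intros HF Cf [A1 A2] [B1 B2]; split.
- apply (is_int0oo_derive (fun u => Re (F u))); try assumption; intros u Hu;
    [apply (HF u Hu) | apply (Cf u Hu)].
- apply (is_int0oo_derive (fun u => Im (F u))); try assumption; intros u Hu;
    [apply (HF u Hu) | apply (Cf u Hu)].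
Qed.

Lemma lim0CP (F : R -> C) (l : C) : lim0C F l <->
  forall eps, 0 < eps -> exists d, 0 < d /\ forall a, 0 < a -> a < d -> Cmod (F a - l) < eps.
Proof.
unfold lim0C; rewrite !lim0P; split.
- intros [H1 H2] eps Heps.
  destruct (H1 (eps / 2)) as (d1 & Hd1 & K1); [lra|].
  destruct (H2 (eps / 2)) as (d2 & Hd2 & K2); [lra|].
  exists (Rmin d1 d2); split; [now apply Rmin_glb_lt|]; intros a Ha Had.
  eapply Rle_lt_trans; [apply Cmod_le_sum|]; rewrite Re_minus, Im_minus.
  specialize (K1 a Ha (Rlt_le_trans _ _ _ Had (Rmin_l _ _))).
  specialize (K2 a Ha (Rlt_le_trans _ _ _ Had (Rmin_r _ _))); lra.
- intros H; split; intros eps Heps; destruct (H eps Heps) as (d & Hd & K);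
    exists d; (split; [exact Hd|]); intros a Ha Had;
    (eapply Rle_lt_trans; [|apply (K a Ha Had)]).
  + rewrite <- Re_minus; apply re_le_Cmod.
  + rewrite <- Im_minus; apply im_le_Cmod.
Qed.

Lemma limooCP (F : R -> C) (l : C) : limooC F l <->
  forall eps, 0 < eps -> exists M, forall a, M < a -> Cmod (F a - l) < eps.
Proof.
unfold limooC; rewrite !limooP; split.
- intros [H1 H2] eps Heps.
  destruct (H1 (eps / 2)) as (d1 & K1); [lra|].
  destruct (H2 (eps / 2)) as (d2 & K2); [lra|].
  exists (Rmax d1 d2); intros a Ha.
  eapply Rle_lt_trans; [apply Cmod_le_sum|]; rewrite Re_minus, Im_minus.
  specialize (K1 a (Rle_lt_trans _ _ _ (Rmax_l _ _) Ha)).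
  specialize (K2 a (Rle_lt_trans _ _ _ (Rmax_r _ _) Ha)); lra.
- intros H; split; intros eps Heps; destruct (H eps Heps) as (d & K);
    exists d; intros a Ha;
    (eapply Rle_lt_trans; [|apply (K a Ha)]).
  + rewrite <- Re_minus; apply re_le_Cmod.
  + rewrite <- Im_minus; apply im_le_Cmod.
Qed.

Lemma contC_mult (f g : R -> C) (x : R) :
  contC f x -> contC g x -> contC (fun t => f t * g t)%C x.
Proof.
assert (M : forall a b : R -> R, continuous a x -> continuous b x -> continuous (fun t => a t * b t) x)
  by (intros a b; apply (continuous_mult (K := R_AbsRing))).
intros [H1 H2] [K1 K2]; split; unfold Re, Im, Cmult; cbn [fst snd].
- apply (continuous_minus (V := R_NormedModule)); apply M; assumption.
- apply (continuous_plus (V := R_NormedModule)); apply M; assumption.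
Qed.

Lemma contC_plus (f g : R -> C) (x : R) :
  contC f x -> contC g x -> contC (fun t => f t + g t)%C x.
Proof.
intros [H1 H2] [K1 K2]; split;
  [exact (continuous_plus (V := R_NormedModule) _ _ x H1 K1)
  | exact (continuous_plus (V := R_NormedModule) _ _ x H2 K2)].
Qed.

Lemma contC_const (c : C) (x : R) : contC (fun _ => c) x.
Proof. exact (derC_contC _ _ _ (derC_const c x)). Qed.

(** * Real powers against exponentials, and the kernel of Euler's integral *)

Lemma ln_le_sub1 (y : R) : 0 < y -> ln y <= y - 1.
Proof.
intros Hy; pose proof (exp_ineq1_le (ln y)) as H; rewrite exp_ln in H by exact Hy; lra.
Qed.

(** [ln y <= y - 1] at [y = (c / m) (1 + u)], scaled so that the linear term [c u] cancels; the
    remaining constant is the logarithm of [K]. *)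
Lemma Rpower_exp_bounded (m c : R) : 0 < m -> 0 < c ->
  exists K, 0 < K /\ forall u, 0 < u -> Rpower (1 + u) m * exp (- (c * u)) <= K.
Proof.
intros Hm Hc; exists (exp (c - m - m * ln (c / m))); split; [apply exp_pos|]; intros u Hu.
unfold Rpower; rewrite <- exp_plus.
assert (Hcm : 0 < c / m) by (now apply Rdiv_lt_0_compat).
pose proof (ln_le_sub1 (c / m * (1 + u)) ltac:(apply Rmult_lt_0_compat; lra)) as H.
rewrite ln_mult in H by lra.
assert (H' : m * (ln (c / m) + ln (1 + u)) <= m * (c / m * (1 + u) - 1))
  by (apply Rmult_le_compat_l; lra).
replace (m * (c / m * (1 + u) - 1)) with (c * (1 + u) - m) in H' by (field; lra).
apply Rnot_lt_le; intros Hlt; apply exp_lt_inv in Hlt; lra.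
Qed.

Lemma exp_le (x y : R) : x <= y -> exp x <= exp y.
Proof. intros [H| ->]; [left; now apply exp_increasing | right; reflexivity]. Qed.

Lemma Rpower_mono (x y b : R) : 0 <= b -> 0 < x -> x <= y -> Rpower x b <= Rpower y b.
Proof.
intros Hb Hx Hxy; apply exp_le, Rmult_le_compat_l; [exact Hb|].
destruct Hxy as [Hxy| ->]; [left; now apply ln_increasing | right; reflexivity].
Qed.

Lemma is_derive_Rpower (b u : R) : 0 < u ->
  is_derive (fun v => Rpower v b) u (b * Rpower u (b - 1)).
Proof.
intros Hu; apply is_derive_Reals, derivable_pt_lim_power, Hu.
Qed.

Lemma continuous_Rpower (b u : R) : 0 < u -> continuous (fun v => Rpower v b) u.
Proof.
intros Hu; apply (ex_derive_continuous (K := R_AbsRing) (V := R_NormedModule)).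
eexists; apply is_derive_Rpower, Hu.
Qed.

Lemma Rpower_split (u b : R) : 0 < u -> Rpower u b = u * Rpower u (b - 1).
Proof.
intros Hu; rewrite <- (Rpower_1 u) at 2 by exact Hu.
rewrite <- Rpower_plus; f_equal; ring.
Qed.

Definition Gamma_kernel (b c u : R) : R := Rpower u (b - 1) * exp (- (c * u)).

Lemma continuous_Gamma_kernel (b c u : R) : 0 < u -> continuous (Gamma_kernel b c) u.
Proof.
intros Hu; apply (continuous_mult (K := R_AbsRing)); [now apply continuous_Rpower|].
apply (ex_derive_continuous (K := R_AbsRing) (V := R_NormedModule)); auto_derive; trivial.
Qed.

Lemma Gamma_kernel_pos (b c u : R) : 0 < Gamma_kernel b c u.
Proof. apply Rmult_lt_0_compat; apply exp_pos. Qed.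

(* Comparison with the derivative of [(u / (1 + u)) ^ b], which is bounded by 1. *)
Lemma ex_Gamma_kernel (b c : R) : 0 < b -> 0 < c -> exists l, is_int0oo (Gamma_kernel b c) l.
Proof.
intros Hb Hc.
(* The derivative of [(u / (1 + u))^b] is [b u^(b-1) (1 + u)^(-(b+1))], so [K / b] times it
   dominates the kernel exactly when [(1 + u)^(b+1) exp (- c u) <= K]. *)
destruct (Rpower_exp_bounded (b + 1) c ltac:(lra) Hc) as (K & HK & HKb).
set (F := fun u => Rpower (u / (1 + u)) b).
set (f := fun u => b * (Rpower u (b - 1) * Rpower (1 + u) (- (b + 1)))).
assert (Hf : forall u, 0 < u -> is_derive F u (f u)).
{ intros u Hu; unfold F.
  assert (Hq : 0 < u / (1 + u)) by (apply Rdiv_lt_0_compat; lra).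
  evar_last.
  - apply (is_derive_comp (K := R_AbsRing) (V := R_NormedModule) (fun v => Rpower v b)
      (fun v => v / (1 + v))).
    + apply is_derive_Rpower, Hq.
    + auto_derive; [lra | reflexivity].
  - unfold scal; cbn; unfold mult; cbn; unfold f.
    assert (E : Rpower (u / (1 + u)) (b - 1)
      = Rpower u (b - 1) * (Rpower (1 + u) (- (b + 1)) * (1 + u) ^ 2)).
    { rewrite <- (Rpower_pow 2) by lra; rewrite <- Rpower_plus.
      unfold Rpower; rewrite <- exp_plus; f_equal.
      rewrite ln_div by lra; cbn; ring. }
    rewrite E; field; lra. }
assert (Cf : forall u, 0 < u -> continuous f u).
{ intros u Hu; apply (continuous_mult (K := R_AbsRing)); [apply continuous_const|].
  apply (continuous_mult (K := R_AbsRing)); [now apply continuous_Rpower|].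
  apply (continuous_comp (fun v => 1 + v) (fun v => Rpower v (- (b + 1)))).
  - apply (ex_derive_continuous (K := R_AbsRing) (V := R_NormedModule)); auto_derive; trivial.
  - apply continuous_Rpower; lra. }
assert (BF : forall u, 0 < u -> 0 <= F u <= 1).
{ intros u Hu; unfold F; split; [left; apply exp_pos|].
  apply Rle_trans with (exp 0); [|rewrite exp_0; lra]; apply exp_le.
  rewrite <- (Rmult_0_r b); apply Rmult_le_compat_l; [lra|].
  rewrite <- ln_1; left; apply ln_increasing; [apply Rdiv_lt_0_compat; lra|].
  apply (Rmult_lt_reg_r (1 + u)); [lra|]; unfold Rdiv.
  rewrite Rmult_assoc, Rinv_l, Rmult_1_r by lra; lra. }
apply (is_int0oo_monotone _ (K / b)).
- intros u Hu; now apply continuous_Gamma_kernel.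
- intros u _; left; apply Gamma_kernel_pos.
- intros x y Hx Hxy.
  assert (I : is_RInt f x y (F y - F x)).
  { apply (is_RInt_derive (V := R_CompleteNormedModule) F f); intros z Hz;
    rewrite Rmin_left in Hz by lra; [apply Hf | apply Cf]; lra. }
  apply Rle_trans with (RInt (fun u => K / b * f u) x y).
  + apply RInt_le; [lra | | |].
    * apply ex_RInt_pos; [apply continuous_Gamma_kernel | lra | lra].
    * apply ex_RInt_pos; [|lra | lra]; intros u Hu.
      apply (continuous_mult (K := R_AbsRing)); [apply continuous_const | auto].
    * intros u Hu; unfold Gamma_kernel, f.
      replace (K / b * (b * (Rpower u (b - 1) * Rpower (1 + u) (- (b + 1)))))
        with (Rpower u (b - 1) * (K * Rpower (1 + u) (- (b + 1)))) by (field; lra).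
      apply Rmult_le_compat_l; [left; apply exp_pos|].
      specialize (HKb u ltac:(lra)).
      apply Rmult_le_reg_l with (Rpower (1 + u) (b + 1)); [apply exp_pos|].
      rewrite Rpower_Ropp.
      replace (Rpower (1 + u) (b + 1) * (K * / Rpower (1 + u) (b + 1))) with K; [exact HKb|].
      field; apply Rgt_not_eq, exp_pos.
  + rewrite (RInt_eq _ _ _ (K / b * (F y - F x))).
    * pose proof (BF x Hx); pose proof (BF y ltac:(lra)).
      rewrite <- (Rmult_1_r (K / b)) at 2; apply Rmult_le_compat_l; [|lra].
      left; now apply Rdiv_lt_0_compat.
    * exact (is_RInt_scal (V := R_NormedModule) f x y (K / b) _ I).
Qed.

(** Equal to [Gamma(b) c^(-b)], which is established in [RGamma_scaled_scale]; until then only its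
    finiteness matters, as the constant in dominations. *)
Definition RGamma_scaled (b c : R) : R :=
  RInt_gen (V := R_CompleteNormedModule) (Gamma_kernel b c) (at_right 0) (Rbar_locally p_infty).

Lemma RGamma_scaled_correct (b c : R) : 0 < b -> 0 < c -> is_int0oo (Gamma_kernel b c) (RGamma_scaled b c).
Proof.
intros Hb Hc; destruct (ex_Gamma_kernel b c Hb Hc) as [l Hl].
exact (RInt_gen_correct (V := R_CompleteNormedModule) (Gamma_kernel b c) (ex_intro _ l Hl)).
Qed.

(** * Complex powers of positive reals *)

(** Written with the real logarithm to keep the argument function out of differentiation in [u]; for
    [0 < u] it agrees with [Cpower]. *)
Definition Rcpower (u : R) (a : C) : C := Cexp (a * RtoC (ln u)).

Lemma Clog_pos (u : R) : 0 < u -> Clog (RtoC u) = RtoC (ln u).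
Proof.
intros Hu; unfold Clog, Carg; rewrite Cmod_R, Rabs_pos_eq, Re_R, Im_R by lra.
destruct (Rle_dec 0 0) as [_|n]; [|lra].
replace (u / u) with 1 by (field; lra); rewrite acos_1; reflexivity.
Qed.

Lemma Cpower_pos (u : R) (a : C) : 0 < u -> Cpower (RtoC u) a = Rcpower u a.
Proof. intros Hu; unfold Cpower; now rewrite Clog_pos. Qed.

Lemma Cmod_Rcpower (u : R) (a : C) : Cmod (Rcpower u a) = Rpower u (Re a).
Proof. unfold Rcpower, Rpower; now rewrite Cmod_Cexp, Re_multR. Qed.

Lemma Rcpower_plus (u : R) (a b : C) : Rcpower u (a + b) = (Rcpower u a * Rcpower u b)%C.
Proof. unfold Rcpower; rewrite <- Cexp_add; f_equal; ring. Qed.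

Lemma Rcpower_1 (u : R) : 0 < u -> Rcpower u 1 = RtoC u.
Proof. intros Hu; unfold Rcpower; now rewrite Cmult_1_l, Cexp_R, exp_ln. Qed.

Lemma Rcpower_R (u x : R) : Rcpower u (RtoC x) = RtoC (Rpower u x).
Proof. unfold Rcpower, Rpower; now rewrite <- RtoC_mult, Cexp_R. Qed.

Lemma Rcpower_split (u : R) (a : C) : 0 < u -> Rcpower u a = (RtoC u * Rcpower u (a - 1))%C.
Proof. intros Hu; rewrite <- (Rcpower_1 u Hu), <- Rcpower_plus; f_equal; ring. Qed.

Lemma derC_Rcpower (a : C) (u : R) : 0 < u -> derC (fun v => Rcpower v a) u (a * Rcpower u (a - 1))%C.
Proof.
intros Hu; eapply derC_eq.
- apply derC_Cexp, derC_scal, (derC_R ln u (/ u)), is_derive_Reals, derivable_pt_lim_ln, Hu.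
- cbv beta; change (Cexp (a * RtoC (ln u))) with (Rcpower u a).
  rewrite (Rcpower_split u a Hu), RtoC_inv by lra.
  field; intros E; apply RtoC_inj in E; lra.
Qed.

Lemma contC_Rcpower (a : C) (u : R) : 0 < u -> contC (fun v => Rcpower v a) u.
Proof. intros Hu; eapply derC_contC, derC_Rcpower, Hu. Qed.

Lemma derC_Cexp_lin (z : C) (u : R) :
  derC (fun v => Cexp (- (z * RtoC v))) u (- z * Cexp (- (z * RtoC u)))%C.
Proof.
eapply derC_eq; [apply derC_Cexp, derC_opp, derC_scal, derC_id | cbv beta; ring].
Qed.

Lemma contC_Cexp_lin (z : C) (u : R) : contC (fun v => Cexp (- (z * RtoC v))) u.
Proof. eapply derC_contC, derC_Cexp_lin. Qed.

Lemma Cmod_Cexp_lin (z : C) (u : R) : Cmod (Cexp (- (z * RtoC u))) = exp (- (Re z * u)).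
Proof. now rewrite Cmod_Cexp, Re_opp, Re_multR. Qed.

(** * Laplace transforms of functions with power growth *)

(** A growth class controlled at both ends, for which the transform converges absolutely on the
    whole right half-plane. It contains [u^(a-1)] and, with [b = 1], bounded functions, and
    multiplication by [u] only raises [b] by 1. *)
Definition power_bounded (w : R -> C) (b M : R) : Prop :=
  0 < b /\ (forall u, 0 < u -> contC w u) /\
  (forall u, 0 < u -> Cmod (w u) <= M * Rpower u (b - 1)).

Definition CLaplace (w : R -> C) (z : C) : C := CInt0oo (fun u => Cexp (- (z * RtoC u)) * w u)%C.

Definition mul_id (w : R -> C) : R -> C := fun u => (RtoC u * w u)%C.

Lemma power_bounded_mul_id (w : R -> C) (b M : R) : power_bounded w b M -> power_bounded (mul_id w) (b + 1) M.
Proof.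
intros (Hb & Cw & Bw); split; [lra|]; split.
- intros u Hu; apply contC_mult; [eapply derC_contC, derC_id | auto].
- intros u Hu; unfold mul_id; rewrite Cmod_mult, Cmod_R, Rabs_pos_eq by lra.
  replace (b + 1 - 1) with b by ring; rewrite (Rpower_split u b Hu).
  specialize (Bw u Hu); nra.
Qed.

Lemma power_bounded_Rcpower (a : C) : 0 < Re a -> power_bounded (fun u => Rcpower u (a - 1)) (Re a) 1.
Proof.
intros Ha; split; [exact Ha|]; split; [intros; now apply contC_Rcpower|].
intros u Hu; rewrite Cmod_Rcpower, Re_minus, Re_R; lra.
Qed.

(** The majorant [M u^(b-1) exp (- c u)] depends on [z] only through [c], so the bound is uniform on
    the half-plane [c <= Re z]. *)
Lemma CLaplace_dominated (w : R -> C) (b M c : R) (z : C) : power_bounded w b M -> 0 < c -> c <= Re z ->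
  is_Cint0oo (fun u => Cexp (- (z * RtoC u)) * w u)%C (CLaplace w z) /\ Cmod (CLaplace w z) <= 2 * (M * RGamma_scaled b c).
Proof.
intros (Hb & Cw & Bw) Hc Hcz.
destruct (is_Cint0oo_dominated (fun u => Cexp (- (z * RtoC u)) * w u)%C (fun u => M * Gamma_kernel b c u)
  (M * RGamma_scaled b c)) as (l & Hl & Bl).
- intros u Hu; apply contC_mult; [apply contC_Cexp_lin | auto].
- intros u Hu; apply (continuous_mult (K := R_AbsRing)); [apply continuous_const|].
  now apply continuous_Gamma_kernel.
- intros u Hu; rewrite Cmod_mult, Cmod_Cexp_lin; unfold Gamma_kernel.
  specialize (Bw u Hu); rewrite (Rmult_comm (Rpower _ _)), <- Rmult_assoc, (Rmult_comm M), Rmult_assoc.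
  apply Rmult_le_compat; [left; apply exp_pos | apply Cmod_ge_0 | apply exp_le; nra | exact Bw].
- apply is_int0oo_scal, RGamma_scaled_correct; assumption.
- unfold CLaplace; rewrite (CInt0oo_eq _ _ Hl); split; assumption.
Qed.

Lemma CLaplace_correct (w : R -> C) (b M : R) (z : C) : power_bounded w b M -> 0 < Re z ->
  is_Cint0oo (fun u => Cexp (- (z * RtoC u)) * w u)%C (CLaplace w z).
Proof. intros Hw Hz; apply (CLaplace_dominated w b M (Re z) z Hw Hz (Rle_refl _)). Qed.

(** The left side is the transform of [w] with the extra factor [exp (- h u) - 1 + h u], which
    [Cexp_quad] bounds by [2 |h|^2 u^2 exp (|h| u)]. The square raises [b] by 2, and the exponential
    lowers the decay rate from [Re z] to [c]. *)
Lemma CLaplace_quad (w : R -> C) (b M c : R) (z h : C) : power_bounded w b M -> 0 < c -> c + Cmod h <= Re z ->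
  Cmod (CLaplace w (z + h) - CLaplace w z - h * - CLaplace (mul_id w) z) <= 4 * M * RGamma_scaled (b + 2) c * Cmod h ^ 2.
Proof.
intros Hw Hc Hch.
assert (Hz : 0 < Re z) by (pose proof (Cmod_ge_0 h); lra).
assert (Hzh : 0 < Re (z + h)).
{ rewrite Re_plus; pose proof (re_le_Cmod h) as H; apply Rabs_le_between in H; lra. }
pose proof (CLaplace_correct w b M z Hw Hz) as I0.
pose proof (CLaplace_correct w b M (z + h) Hw Hzh) as I1.
pose proof (CLaplace_correct (mul_id w) (b + 1) M z (power_bounded_mul_id _ _ _ Hw) Hz) as I2.
pose proof (is_Cint0oo_plus _ _ _ _ (is_Cint0oo_minus _ _ _ _ I1 I0) (is_Cint0oo_scal _ h _ I2)) as I.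
destruct Hw as (Hb & Cw & Bw).
replace (CLaplace w (z + h) - CLaplace w z - h * - CLaplace (mul_id w) z)%C
  with (CLaplace w (z + h) - CLaplace w z + h * CLaplace (mul_id w) z)%C by ring.
replace (4 * M * RGamma_scaled (b + 2) c * Cmod h ^ 2) with (2 * (2 * M * Cmod h ^ 2 * RGamma_scaled (b + 2) c)) by ring.
apply (is_Cint0oo_bound _ _ (fun u => 2 * M * Cmod h ^ 2 * Gamma_kernel (b + 2) c u) _) with (2 := I).
- intros u Hu; unfold mul_id.
  replace (Cexp (- ((z + h) * RtoC u)) * w u - Cexp (- (z * RtoC u)) * w u +
     h * (Cexp (- (z * RtoC u)) * (RtoC u * w u)))%C
   with (Cexp (- (z * RtoC u)) * w u * (Cexp (- (h * RtoC u)) - 1 - (- (h * RtoC u))))%C.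
  2:{ replace (- ((z + h) * RtoC u))%C with (- (z * RtoC u) + - (h * RtoC u))%C by ring.
      rewrite Cexp_add; ring. }
  rewrite !Cmod_mult, Cmod_Cexp_lin.
  pose proof (Cexp_quad (- (h * RtoC u))) as Q.
  rewrite Cmod_opp, Cmod_mult, Cmod_R, Rabs_pos_eq in Q by lra.
  unfold Gamma_kernel; specialize (Bw u Hu).
  replace (b + 2 - 1) with (b - 1 + 1 + 1) by ring.
  rewrite !Rpower_plus, !Rpower_1 by exact Hu.
  apply Rle_trans with ((exp (- (Re z * u)) * (M * Rpower u (b - 1)))
    * (2 * (Cmod h * u) ^ 2 * exp (Cmod h * u))).
  + apply Rmult_le_compat; [| apply Cmod_ge_0 | | exact Q].
    * apply Rmult_le_pos; [left; apply exp_pos | apply Cmod_ge_0].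
    * apply Rmult_le_compat_l; [left; apply exp_pos | exact Bw].
  + assert (E : exp (- (Re z * u)) * exp (Cmod h * u) <= exp (- (c * u))).
    { rewrite <- exp_plus; apply exp_le; nra. }
    assert (PM : 0 <= M * Rpower u (b - 1)) by (eapply Rle_trans; [apply Cmod_ge_0 | exact Bw]).
    replace (exp (- (Re z * u)) * (M * Rpower u (b - 1)) * (2 * (Cmod h * u) ^ 2 * exp (Cmod h * u)))
      with (2 * Cmod h ^ 2 * u ^ 2 * (M * Rpower u (b - 1)) * (exp (- (Re z * u)) * exp (Cmod h * u))) by ring.
    replace (2 * M * Cmod h ^ 2 * (Rpower u (b - 1) * u * u * exp (- (c * u))))
      with (2 * Cmod h ^ 2 * u ^ 2 * (M * Rpower u (b - 1)) * exp (- (c * u))) by ring.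
    apply Rmult_le_compat_l; [|exact E].
    apply Rmult_le_pos; [|exact PM].
    apply Rmult_le_pos; [|apply pow2_ge_0].
    pose proof (pow2_ge_0 (Cmod h)); lra.
- apply is_int0oo_scal, RGamma_scaled_correct; lra.
Qed.

(** Stated along a path [g] with quadratic remainder, because two paths occur later: [exp (t Log z)]
    for the Gamma integral and a straight ray for analytic continuation. *)
Lemma CLaplace_derC (w : R -> C) (b M : R) (g : R -> C) (x K r : R) (l : C) :
  power_bounded w b M -> 0 < Re (g x) -> 0 < r ->
  (forall h, Rabs h < r -> Cmod (g (x + h)%R - g x - RtoC h * l) <= K * h ^ 2) ->
  derC (fun t => CLaplace w (g t)) x (- l * CLaplace (mul_id w) (g x))%C.
Proof.
intros Hw Hz Hr Hg.
(* [L] is a Lipschitz constant of [g] at [x] for [|h| < r]. The smaller radius keeps the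
   displacement below [c], half of the real part available. *)
set (L := Cmod l + Rabs K * r).
set (c := Re (g x) / 2).
assert (HL : 0 <= L).
{ unfold L; pose proof (Cmod_ge_0 l); pose proof (Rabs_pos K); nra. }
assert (Hr' : 0 < Rmin r (c / (L + 1))).
{ apply Rmin_glb_lt; [exact Hr|]; apply Rdiv_lt_0_compat; [unfold c; lra | lra]. }
apply (derC_quad _ x _ (Rabs (4 * M * RGamma_scaled (b + 2) c) * L ^ 2 + Rabs K * Cmod (CLaplace (mul_id w) (g x)))
  (Rmin r (c / (L + 1))) Hr').
intros h Hh.
assert (Hhr := Rlt_le_trans _ _ _ Hh (Rmin_l _ _)).
assert (Hhc := Rlt_le_trans _ _ _ Hh (Rmin_r _ _)).
apply Rlt_div_r in Hhc; [|lra].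
specialize (Hg h Hhr); set (k := (g (x + h)%R - g x)%C).
assert (Hk : Cmod k <= L * Rabs h).
{ replace k with ((g (x + h)%R - g x - RtoC h * l) + RtoC h * l)%C by (unfold k; ring).
  eapply Rle_trans; [apply Cmod_triangle|]; rewrite Cmod_mult, Cmod_R.
  rewrite <- (pow2_abs h) in Hg; unfold L.
  pose proof (Rabs_pos h); pose proof (Rle_abs K); pose proof (Rabs_pos K).
  assert (K * Rabs h ^ 2 <= Rabs K * r * Rabs h); [|lra].
  apply Rle_trans with (Rabs K * Rabs h ^ 2); [apply Rmult_le_compat_r; nra|].
  replace (Rabs K * Rabs h ^ 2) with (Rabs K * Rabs h * Rabs h) by ring.
  apply Rmult_le_compat_r; [lra|]; apply Rmult_le_compat_l; lra. }
pose proof (Rabs_pos h).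
assert (Q := CLaplace_quad w b M c (g x) k Hw ltac:(unfold c; lra) ltac:(unfold c in *; nra)).
replace (g x + k)%C with (g (x + h)%R) in Q by (unfold k; ring).
(* Two errors are separated: that of the transform for the actual displacement [k], and that of the
   path against its linearisation [h l]. *)
replace (CLaplace w (g (x + h)%R) - CLaplace w (g x) - RtoC h * (- l * CLaplace (mul_id w) (g x)))%C
  with ((CLaplace w (g (x + h)%R) - CLaplace w (g x) - k * - CLaplace (mul_id w) (g x))
    - (k - RtoC h * l) * CLaplace (mul_id w) (g x))%C by ring.
eapply Rle_trans; [apply Cmod_triangle|]; rewrite Cmod_opp, Cmod_mult.
rewrite Rmult_plus_distr_r; apply Rplus_le_compat.
- eapply Rle_trans; [exact Q|].
  eapply Rle_trans; [apply Rmult_le_compat_r; [apply pow2_ge_0 | apply Rle_abs]|].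
  rewrite (Rmult_assoc (Rabs _)); apply Rmult_le_compat_l; [apply Rabs_pos|].
  rewrite <- (pow2_abs h), <- Rpow_mult_distr; apply pow_incr; split; [apply Cmod_ge_0 | exact Hk].
- replace (Rabs K * Cmod (CLaplace (mul_id w) (g x)) * h ^ 2)
    with (Rabs K * h ^ 2 * Cmod (CLaplace (mul_id w) (g x))) by ring.
  apply Rmult_le_compat_r; [apply Cmod_ge_0|]; eapply Rle_trans; [exact Hg|].
  apply Rmult_le_compat_r; [apply pow2_ge_0 | apply Rle_abs].
Qed.

Lemma Rpower_exp_decay (m c : R) : 0 <= m -> 0 < c ->
  exists K, 0 < K /\ forall u, 0 < u -> Rpower u m * exp (- (c * u)) <= K / u.
Proof.
intros Hm Hc; destruct (Rpower_exp_bounded (m + 1) c ltac:(lra) Hc) as (K & HK & HKb).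
exists K; split; [exact HK|]; intros u Hu.
apply (Rmult_le_reg_r u); [exact Hu|].
replace (K / u * u) with K by (field; lra).
eapply Rle_trans; [|apply (HKb u Hu)].
rewrite (Rmult_comm (Rpower u m)), Rmult_assoc, (Rmult_comm (Rpower (1 + u) _)).
apply Rmult_le_compat_l; [left; apply exp_pos|].
rewrite <- (Rpower_1 u) at 2 by exact Hu; rewrite <- Rpower_plus.
apply Rpower_mono; lra.
Qed.

(** Integration of the derivative of [exp (- z u) u^a], whose boundary terms vanish: at 0 because
    [0 < Re a], at infinity because [0 < Re z]. At [z = 1] this is the functional equation of
    Gamma. *)
Lemma CLaplace_Rcpower_parts (a z : C) : 0 < Re a -> 0 < Re z ->
  (z * CLaplace (fun u => Rcpower u a) z = a * CLaplace (fun u => Rcpower u (a - 1)) z)%C.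
Proof.
intros Ha Hz.
pose proof (CLaplace_correct _ _ _ z (power_bounded_Rcpower a Ha) Hz) as I1.
assert (Ha1 : 0 < Re (a + 1)) by (rewrite Re_plus, Re_R; lra).
pose proof (CLaplace_correct _ _ _ z (power_bounded_Rcpower (a + 1) Ha1) Hz) as I2.
assert (E : forall u, Rcpower u (a + 1 - 1) = Rcpower u a) by (intros; f_equal; ring).
assert (I2' : is_Cint0oo (fun u => Cexp (- (z * RtoC u)) * Rcpower u a)%C (CLaplace (fun u => Rcpower u a) z)).
{ unfold CLaplace; rewrite (CInt0oo_eq _ (CLaplace (fun u => Rcpower u (a + 1 - 1)) z));
    (eapply is_Cint0oo_ext; [|exact I2]); intros u Hu; cbv beta; now rewrite E. }
assert (D : is_Cint0oo (fun u => - z * Cexp (- (z * RtoC u)) * Rcpower u a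
    + Cexp (- (z * RtoC u)) * (a * Rcpower u (a - 1)))%C (0 - 0)%C).
{ apply (is_Cint0oo_derive (fun u => Cexp (- (z * RtoC u)) * Rcpower u a)%C).
  - intros u Hu; apply (derC_mult (fun u => Cexp (- (z * RtoC u))) (fun v => Rcpower v a));
      [apply derC_Cexp_lin | now apply derC_Rcpower].
  - intros u Hu; apply contC_plus; apply contC_mult.
    + apply contC_mult; [apply contC_const | apply contC_Cexp_lin].
    + now apply contC_Rcpower.
    + apply contC_Cexp_lin.
    + apply contC_mult; [apply contC_const | now apply contC_Rcpower].
  (* The witness is the point where [u^(Re a)] equals [eps]; the exponential factor is at most 1 in
     modulus. *)
  - apply lim0CP; intros eps Heps; exists (Rpower eps (/ Re a)); split; [apply exp_pos|].
    intros u Hu Hue; unfold Cminus; rewrite Copp_0, Cplus_0_r.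
    rewrite Cmod_mult, Cmod_Cexp_lin, Cmod_Rcpower.
    apply Rle_lt_trans with (1 * Rpower u (Re a)).
    + apply Rmult_le_compat_r; [left; apply exp_pos|].
      apply Rle_trans with (exp 0); [apply exp_le; nra | rewrite exp_0; lra].
    + rewrite Rmult_1_l; apply Rlt_le_trans with (Rpower (Rpower eps (/ Re a)) (Re a)).
      * apply exp_increasing, Rmult_lt_compat_l; [exact Ha|]; now apply ln_increasing.
      * rewrite Rpower_mult, Rinv_l, Rpower_1 by lra; lra.
  - apply limooCP; intros eps Heps.
    destruct (Rpower_exp_decay (Re a) (Re z)) as (K & HK & HKb); [lra | lra|].
    exists (K / eps); intros u Hue.
    assert (Hu : 0 < u) by (apply Rlt_trans with (2 := Hue), Rdiv_lt_0_compat; lra).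
    unfold Cminus; rewrite Copp_0, Cplus_0_r, Cmod_mult, Cmod_Cexp_lin, Cmod_Rcpower, Rmult_comm.
    eapply Rle_lt_trans; [apply HKb, Hu|].
    apply Rlt_div_l; [exact Hu|]; apply Rlt_div_l in Hue; lra. }
pose proof (is_Cint0oo_plus _ _ _ _ (is_Cint0oo_scal _ (- z) _ I2') (is_Cint0oo_scal _ a _ I1)) as S.
assert (EQ : (- z * CLaplace (fun u => Rcpower u a) z + a * CLaplace (fun u => Rcpower u (a - 1)) z)%C = (0 - 0)%C).
{ eapply is_Cint0oo_unique; [|exact D]; eapply is_Cint0oo_ext; [|exact S]; intros u Hu; cbv beta; ring. }
transitivity (a * CLaplace (fun u => Rcpower u (a - 1)) z
  - (- z * CLaplace (fun u => Rcpower u a) z + a * CLaplace (fun u => Rcpower u (a - 1)) z))%C; [ring|].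
rewrite EQ; ring.
Qed.

Lemma CGamma_CLaplace (a : C) : 0 < Re a -> CGamma a = CLaplace (fun u => Rcpower u (a - 1)) 1.
Proof.
intros Ha; unfold CGamma; apply CInt0oo_eq.
eapply is_Cint0oo_ext; [|apply (CLaplace_correct _ _ _ 1 (power_bounded_Rcpower a Ha)); rewrite Re_R; lra].
intros u Hu; cbv beta.
rewrite Cpower_pos, Cmult_1_l, <- RtoC_opp, Cexp_R by exact Hu; ring.
Qed.

Lemma CGamma_succ (a : C) : 0 < Re a -> CGamma (a + 1) = (a * CGamma a)%C.
Proof.
intros Ha; rewrite !CGamma_CLaplace by (rewrite ?Re_plus, ?Re_R; lra).
rewrite <- CLaplace_Rcpower_parts, Cmult_1_l by (rewrite ?Re_R; lra).
unfold CLaplace; f_equal; apply functional_extensionality; intros u; do 2 f_equal; ring.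
Qed.

(** * The principal argument in the right half-plane *)

(** The definition through [acos] changes form at the real axis; [atan] gives one smooth expression
    on the half-plane, with the bound [PI / 2] built in. *)
Lemma Carg_atan (z : C) : 0 < Re z -> Carg z = atan (Im z / Re z).
Proof.
intros Hz.
assert (Hz0 : z <> 0%C) by (intros ->; rewrite Re_R in Hz; lra).
pose proof (proj1 (Cmod_gt_0 z) Hz0) as Hm.
pose proof (Cmod2_alt z) as E2.
assert (Hq : 0 < Re z / Cmod z) by (now apply Rdiv_lt_0_compat).
assert (A : acos (Re z / Cmod z) = atan (Rabs (Im z) / Re z)).
{ rewrite acos_atan by exact Hq; f_equal.
  replace (1 - (Re z / Cmod z)²) with ((Im z / Cmod z)²).
  - rewrite sqrt_Rsqr_abs, Rabs_div, (Rabs_pos_eq (Cmod z)) by lra; field; lra.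
  - unfold Rsqr; apply (Rmult_eq_reg_r (Cmod z ^ 2)); [|nra].
    replace ((1 - Re z / Cmod z * (Re z / Cmod z)) * Cmod z ^ 2)
      with (Cmod z ^ 2 - Re z ^ 2) by (field; lra).
    replace (Im z / Cmod z * (Im z / Cmod z) * Cmod z ^ 2) with (Im z ^ 2) by (field; lra).
    lra. }
unfold Carg; rewrite A; destruct (Rle_dec 0 (Im z)) as [H|H].
- now rewrite Rabs_pos_eq.
- rewrite Rabs_left by lra; rewrite <- atan_opp; f_equal; field; lra.
Qed.

Lemma Carg_bound (z : C) : 0 < Re z -> - (PI / 2) < Carg z < PI / 2.
Proof. intros Hz; rewrite Carg_atan by exact Hz; pose proof (atan_bound (Im z / Re z)); lra. Qed.

(** The point [exp (t Log z)] has argument [t arg z], still inside the interval from [- PI / 2] to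
    [PI / 2]. *)
Lemma Re_Cexp_path (z : C) (t : R) : 0 < Re z -> 0 <= t <= 1 ->
  0 < Re (Cexp (RtoC t * Clog z)).
Proof.
intros Hz Ht; unfold Cexp; cbn [Re fst].
apply Rmult_lt_0_compat; [apply exp_pos|].
rewrite Im_Rmult; unfold Clog; cbn [Im snd].
pose proof (Carg_bound z Hz); apply cos_gt_0; nra.
Qed.

Lemma RtoC_neq_0 (z : C) : 0 < Re z -> z <> 0%C.
Proof. intros Hz ->; rewrite Re_R in Hz; lra. Qed.

(* Along [tau -> exp (tau Log z)], which joins 1 to [z] inside the half-plane,
   the derivative of the left-hand side is [- a Log z] times itself, by parts. *)
Lemma CLaplace_Rcpower (a z : C) : 0 < Re a -> 0 < Re z ->
  CLaplace (fun u => Rcpower u (a - 1)) z = (CGamma a * Cpower z (- a))%C.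
Proof.
intros Ha Hz.
set (L := Clog z); set (g := fun t => Cexp (RtoC t * L)).
set (W := fun u => Rcpower u (a - 1)).
assert (Eg : forall t, 0 <= t <= 1 -> derC (fun t => CLaplace W (g t)) t (- (L * g t) * CLaplace (mul_id W) (g t))%C).
{ intros t Ht.
  apply (CLaplace_derC W (Re a) 1 g t (Cmod (g t) * (2 * Cmod L ^ 2 * exp (Cmod L))) 1);
    [now apply power_bounded_Rcpower | now apply Re_Cexp_path | lra|].
  intros h Hh.
  replace (g (t + h)%R - g t - RtoC h * (L * g t))%C
    with (g t * (Cexp (RtoC h * L) - 1 - RtoC h * L))%C.
  2:{ unfold g; rewrite RtoC_plus, Cmult_plus_distr_r, Cexp_add; ring. }
  rewrite Cmod_mult, Rmult_assoc; apply Rmult_le_compat_l; [apply Cmod_ge_0|].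
  eapply Rle_trans; [apply Cexp_quad|]; rewrite Cmod_mult, Cmod_R.
  replace (2 * Cmod L ^ 2 * exp (Cmod L) * h ^ 2) with (2 * (Rabs h * Cmod L) ^ 2 * exp (Cmod L))
    by (rewrite Rpow_mult_distr, pow2_abs; ring).
  apply Rmult_le_compat_l; [pose proof (pow2_ge_0 (Rabs h * Cmod L)); lra|].
  apply exp_le; pose proof (Cmod_ge_0 L); nra. }
assert (Em : forall t, 0 <= t <= 1 -> (g t * CLaplace (mul_id W) (g t) = a * CLaplace W (g t))%C).
{ intros t Ht; unfold W; rewrite <- CLaplace_Rcpower_parts by (auto; now apply Re_Cexp_path).
  f_equal; unfold CLaplace, mul_id.
  pose proof (Re_Cexp_path z t Hz Ht) as Hg.
  assert (Ha1 : 0 < Re (a + 1)) by (rewrite Re_plus, Re_R; lra).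
  pose proof (CLaplace_correct _ _ _ (g t) (power_bounded_Rcpower (a + 1) Ha1) Hg) as I.
  rewrite (CInt0oo_eq _ (CLaplace (fun u => Rcpower u (a + 1 - 1)) (g t))).
  - symmetry; apply CInt0oo_eq; eapply is_Cint0oo_ext; [|exact I].
    intros u Hu; cbv beta; do 2 f_equal; ring.
  - eapply is_Cint0oo_ext; [|exact I]; intros u Hu; cbv beta; f_equal.
    rewrite <- Rcpower_split by exact Hu; f_equal; ring. }
(* [exp (t a L)] is the integrating factor. At [t = 0] the path is at 1, where the transform is
   Gamma, and at [t = 1] it has reached [z]. *)
assert (K : (CLaplace W (g 0) * Cexp (RtoC 0 * (a * L)) = CLaplace W (g 1) * Cexp (RtoC 1 * (a * L)))%C).
{ apply (derC_zero_const (fun t => CLaplace W (g t) * Cexp (RtoC t * (a * L)))%C); [lra|].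
  intros t Ht; eapply derC_eq.
  - apply derC_mult; [now apply Eg|].
    apply derC_Cexp, (derC_mult RtoC (fun _ => (a * L)%C)); [apply derC_id | apply derC_const].
  - cbv beta.
    transitivity ((- L * (g t * CLaplace (mul_id W) (g t)) + L * (a * CLaplace W (g t)))
      * Cexp (RtoC t * (a * L)))%C; [ring|].
    rewrite Em by exact Ht; ring. }
unfold g in K; rewrite !Cmult_0_l, !Cmult_1_l, Cexp_0, Cmult_1_r in K.
unfold L in K at 1; rewrite Cexp_Clog in K by (now apply RtoC_neq_0).
rewrite CGamma_CLaplace by exact Ha; fold W; rewrite K; unfold Cpower; fold L.
rewrite <- Cmult_assoc, <- Cexp_add.
replace (a * L + - a * L)%C with (RtoC 0) by ring; rewrite Cexp_0; ring.
Qed.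

(** * Lower bound for the Gamma function *)

Lemma Cint0oo_R (f : R -> R) (l : R) : is_int0oo f l -> is_Cint0oo (fun u => RtoC (f u)) (RtoC l).
Proof.
intros H; split; [exact H|].
apply (is_int0oo_ext (fun u => 0 * f u)); [intros; rewrite Im_R; ring|].
assert (E := is_int0oo_scal f 0 l H); rewrite Rmult_0_l in E; exact E.
Qed.

Lemma RGamma_scaled_CLaplace (b c : R) : 0 < b -> 0 < c ->
  CLaplace (fun u => Rcpower u (RtoC b - 1)) (RtoC c) = RtoC (RGamma_scaled b c).
Proof.
intros Hb Hc; apply CInt0oo_eq.
apply (is_Cint0oo_ext (fun u => RtoC (Gamma_kernel b c u))); [|now apply Cint0oo_R, RGamma_scaled_correct].
intros u Hu; unfold Gamma_kernel.
rewrite <- RtoC_minus, Rcpower_R, RtoC_mult, <- Cexp_R, RtoC_opp, RtoC_mult; ring.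
Qed.

Definition RGamma (x : R) : R := RGamma_scaled x 1.

Lemma CGamma_R (x : R) : 0 < x -> CGamma (RtoC x) = RtoC (RGamma x).
Proof. intros Hx; rewrite CGamma_CLaplace by (rewrite Re_R; lra); apply RGamma_scaled_CLaplace; lra. Qed.

(** The substitution rule for the real integral is read off from the complex formula
    [CLaplace_Rcpower] at real arguments. *)
Lemma RGamma_scaled_scale (b c : R) : 0 < b -> 0 < c -> RGamma_scaled b c = RGamma b * Rpower c (- b).
Proof.
intros Hb Hc; apply RtoC_inj; rewrite <- RGamma_scaled_CLaplace by assumption.
rewrite CLaplace_Rcpower by (rewrite Re_R; assumption).
rewrite CGamma_R, Cpower_pos, <- RtoC_opp, Rcpower_R, <- RtoC_mult by assumption; reflexivity.
Qed.

Lemma RGamma_succ (x : R) : 0 < x -> RGamma (x + 1) = x * RGamma x.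
Proof.
intros Hx; apply RtoC_inj; rewrite RtoC_mult, <- !CGamma_R by lra.
rewrite RtoC_plus; apply CGamma_succ; rewrite Re_R; exact Hx.
Qed.

(** Only the integral over [[r, r + 1]] is kept, with [u^(x-1) = u^x / u >= r^x / (r + 1)] there. As
    [r] is free, Gamma outgrows every exponential, which yields convergence of the Prabhakar series
    at every [u]. *)
Lemma RGamma_lower (x r : R) : 0 < x -> 0 < r -> Rpower r x * exp (- (r + 1)) / (r + 1) <= RGamma x.
Proof.
intros Hx Hr.
apply Rle_trans with (RInt (Gamma_kernel x 1) r (r + 1)).
- replace (Rpower r x * exp (- (r + 1)) / (r + 1))
    with (RInt (fun _ => Rpower r x * exp (- (r + 1)) / (r + 1)) r (r + 1))
    by (rewrite RInt_const; unfold scal; cbn; unfold mult; cbn; ring).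
  apply RInt_le; [lra | apply ex_RInt_const | apply ex_RInt_pos; [apply continuous_Gamma_kernel | lra | lra] |].
  intros u Hu; unfold Gamma_kernel.
  replace (Rpower r x * exp (- (r + 1)) / (r + 1)) with (Rpower r x / (r + 1) * exp (- (r + 1)))
    by (field; lra).
  apply Rmult_le_compat; [|left; apply exp_pos| |apply exp_le; lra].
  + left; apply Rdiv_lt_0_compat; [apply exp_pos | lra].
  + apply Rle_div_l; [lra|].
    apply Rle_trans with (Rpower u x); [apply Rpower_mono; lra|].
    rewrite (Rpower_split u x) by lra; rewrite Rmult_comm.
    apply Rmult_le_compat_l; [left; apply exp_pos | lra].
- apply is_int0oo_RInt_le; [apply continuous_Gamma_kernel | intros; left; apply Gamma_kernel_pos
    | apply RGamma_scaled_correct; lra | lra | lra].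
Qed.

Lemma RGamma_pos (x : R) : 0 < x -> 0 < RGamma x.
Proof.
intros Hx; eapply Rlt_le_trans; [|apply (RGamma_lower x 1); lra].
apply Rdiv_lt_0_compat; [|lra]; apply Rmult_lt_0_compat; apply exp_pos.
Qed.

Lemma cos_lower (v : R) : 1 - v ^ 2 <= cos v.
Proof.
assert (T := taylor2_R cos (fun x => - sin x) (fun x => - cos x) 0 v 1).
rewrite Rplus_0_l, cos_0, sin_0 in T.
assert (H : Rabs (cos v - 1 - v * - 0) <= 1 * v ^ 2).
{ apply T; intros y _.
  - apply is_derive_cos.
  - apply (is_derive_opp (K := R_AbsRing) (V := R_NormedModule) sin), is_derive_sin.
  - rewrite Rabs_Ropp; apply Rabs_le, COS_bound. }
apply Rabs_le_between in H; lra.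
Qed.

(** With [v = ln r / 2] the right side is [4 (exp v - exp (- v))^2], and
    [|v| <= |exp v - exp (- v)|]. The bound uses only [r] and [/ r], whose means against the Gamma
    kernel are explicit. *)
Lemma ln2_upper (r : R) : 0 < r -> ln r ^ 2 <= 4 * (r - 2 + / r).
Proof.
intros Hr; set (v := ln r / 2).
assert (E1 : exp v * exp v = r).
{ rewrite <- exp_plus; unfold v; replace (ln r / 2 + ln r / 2) with (ln r) by field.
  now apply exp_ln. }
assert (E2 : exp v * exp (- v) = 1) by (rewrite <- exp_plus, Rplus_opp_r; apply exp_0).
assert (E3 : exp (- v) * exp (- v) = / r).
{ apply (Rmult_eq_reg_l r); [|lra]; rewrite Rinv_r by lra; rewrite <- E1.
  transitivity ((exp v * exp (- v)) * (exp v * exp (- v))); [ring | rewrite E2; ring]. }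
assert (E : r - 2 + / r = (exp v - exp (- v)) ^ 2) by nra.
rewrite E; replace (ln r) with (2 * v) by (unfold v; field).
pose proof (exp_ineq1_le v); pose proof (exp_ineq1_le (- v)).
pose proof (exp_pos v); pose proof (exp_pos (- v)).
assert (v ^ 2 <= (exp v - exp (- v)) ^ 2); [|lra].
destruct (Rle_lt_dec 0 v) as [Hv|Hv].
- assert (exp (- v) <= 1) by (rewrite <- exp_0; apply exp_le; lra); apply pow_incr; lra.
- assert (exp v <= 1) by (rewrite <- exp_0; apply exp_le; lra).
  replace (v ^ 2) with ((- v) ^ 2) by ring.
  replace ((exp v - exp (- v)) ^ 2) with ((exp (- v) - exp v) ^ 2) by ring; apply pow_incr; lra.
Qed.

(* [Gamma (x + i y) / Gamma x] is the mean of [exp (i y log U)] for a Gamma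
   distributed [U], and [log U] concentrates around [log x] as [x] grows. *)
Lemma CGamma_lower_large (x y : R) : 1 < x ->
  RGamma x * (1 - 4 * y ^ 2 / (x - 1)) <= Cmod (CGamma (x, y)).
Proof.
intros Hx.
set (a := (x, y) : C).
assert (Ha : Re a = x) by reflexivity.
(* A unimodular factor that removes the phase [x^(i y)], so that the integrand oscillates like
   [cos (y ln (u / x))], close to 1 near the bulk [u = x] of the mass. *)
set (e := Cexp (- (Ci * RtoC (y * ln x)))).
assert (He : Cmod e = 1).
{ unfold e; rewrite Cmod_Cexp, Re_opp, Re_multR; cbn; rewrite Rmult_0_l, Ropp_0; apply exp_0. }
assert (I : is_Cint0oo (fun u => e * (Cexp (- (1 * RtoC u)) * Rcpower u (a - 1)))%C (e * CGamma a)%C).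
{ apply is_Cint0oo_scal; rewrite CGamma_CLaplace by lra.
  apply (CLaplace_correct _ x 1); [rewrite <- Ha; apply power_bounded_Rcpower; lra | rewrite Re_R; lra]. }
destruct I as [I _].
assert (ER : forall u, 0 < u -> Re (e * (Cexp (- (1 * RtoC u)) * Rcpower u (a - 1)))
  = Gamma_kernel x 1 u * cos (y * ln (u / x))).
{ intros u Hu; unfold e, Rcpower; rewrite <- !Cexp_add; unfold Cexp; cbn [Re fst].
  rewrite !Re_plus, !Im_plus, !Re_opp, !Im_opp, !Re_multR, !Im_multR, Re_minus, Im_minus.
  unfold Gamma_kernel, Rpower; rewrite <- exp_plus, !Re_R, !Im_R, Ha.
  rewrite ln_div by lra; unfold a; cbn; f_equal; f_equal; ring. }
(* This integrates the kernel times [1 - 4 y^2 (u/x - 2 + x/u)]: the factor [u] shifts Gamma up to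
   [x + 1], the factor [/ u] down to [x - 1], which is positive as [1 < x]. *)
assert (J : is_int0oo (fun u => (1 + 8 * y ^ 2) * Gamma_kernel x 1 u
     - (4 * y ^ 2 / x * Gamma_kernel (x + 1) 1 u + 4 * y ^ 2 * x * Gamma_kernel (x - 1) 1 u))
   ((1 + 8 * y ^ 2) * RGamma x - (4 * y ^ 2 / x * RGamma (x + 1) + 4 * y ^ 2 * x * RGamma (x - 1)))).
{ apply is_int0oo_minus; [|apply is_int0oo_plus]; apply is_int0oo_scal, RGamma_scaled_correct; lra. }
assert (Q : (1 + 8 * y ^ 2) * RGamma x - (4 * y ^ 2 / x * RGamma (x + 1) + 4 * y ^ 2 * x * RGamma (x - 1))
  <= Re (e * CGamma a)).
{ eapply is_int0oo_le; [|exact J | exact I]; intros u Hu; cbv beta; rewrite ER by exact Hu.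
  assert (G1 : Gamma_kernel (x + 1) 1 u = u * Gamma_kernel x 1 u).
  { unfold Gamma_kernel; rewrite (Rpower_split u (x + 1 - 1)) by exact Hu.
    replace (x + 1 - 1 - 1) with (x - 1) by ring; ring. }
  assert (G2 : Gamma_kernel (x - 1) 1 u = Gamma_kernel x 1 u / u).
  { unfold Gamma_kernel; rewrite (Rpower_split u (x - 1)) by exact Hu; field; lra. }
  rewrite G1, G2.
  replace ((1 + 8 * y ^ 2) * Gamma_kernel x 1 u - (4 * y ^ 2 / x * (u * Gamma_kernel x 1 u) + 4 * y ^ 2 * x * (Gamma_kernel x 1 u / u)))
    with (Gamma_kernel x 1 u * (1 - y ^ 2 * (4 * (u / x - 2 + / (u / x))))) by (field; lra).
  apply Rmult_le_compat_l; [left; apply Gamma_kernel_pos|].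
  eapply Rle_trans; [|apply cos_lower]; rewrite Rpow_mult_distr.
  assert (Hux : 0 < u / x) by (apply Rdiv_lt_0_compat; lra).
  pose proof (ln2_upper (u / x) Hux); pose proof (pow2_ge_0 y); nra. }
assert (E1 : RGamma (x + 1) = x * RGamma x) by (apply RGamma_succ; lra).
assert (E2 : RGamma (x - 1) = RGamma x / (x - 1)).
{ replace (RGamma x) with (RGamma (x - 1 + 1)) by (f_equal; ring); rewrite RGamma_succ by lra; field; lra. }
rewrite E1, E2 in Q.
replace ((1 + 8 * y ^ 2) * RGamma x - (4 * y ^ 2 / x * (x * RGamma x) + 4 * y ^ 2 * x * (RGamma x / (x - 1))))
  with (RGamma x * (1 - 4 * y ^ 2 / (x - 1))) in Q by (field; lra).
eapply Rle_trans; [exact Q|].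
eapply Rle_trans; [eapply Rle_trans; [apply Rle_abs | apply re_le_Cmod]|].
rewrite Cmod_mult, He; lra.
Qed.

(** With [q = y^2 / x^2] the modulus is [x sqrt (1 + q)]. The exponential form turns the product of
    such factors in [CGamma_ratio] into a sum of exponents. *)
Lemma Cmod_cone_le (x y : R) : 0 < x -> Cmod (x, y) <= x * exp (y ^ 2 / x ^ 2).
Proof.
intros Hx; pose proof (exp_ineq1_le (y ^ 2 / x ^ 2)) as H; set (q := y ^ 2 / x ^ 2) in *.
assert (Hq : 0 <= q) by (apply Rmult_le_pos; [apply pow2_ge_0 | left; apply Rinv_0_lt_compat; nra]).
assert (Eq : q * x ^ 2 = y ^ 2) by (unfold q; field; lra).
apply Rsqr_incr_0_var; [|pose proof (exp_pos q); nra].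
pose proof (Cmod2_alt (x, y)) as E; cbn [Re Im fst snd] in E.
unfold Rsqr; replace (Cmod (x, y) * Cmod (x, y)) with (Cmod (x, y) ^ 2) by ring.
rewrite E.
assert (1 + q <= exp q * exp q) by nra.
assert (x ^ 2 * (1 + q) <= x ^ 2 * (exp q * exp q)) by (apply Rmult_le_compat_l; nra).
nra.
Qed.

(** Each use of the functional equation costs a factor [|x + t + i y| / (x + t) <= exp (y^2 / (x +
    t)^2)]. The exponent is at most [y^2 (x + 1) / x] times [/ (x + t) - / (x + t + 1)], because
    [(x + t + 1) / (x + t) <= (x + 1) / x], and the sum telescopes. *)
Lemma CGamma_ratio (x y : R) (n : nat) : 0 < x ->
  Cmod (CGamma ((x, y) + RtoC (INR n))) * RGamma x
  <= Cmod (CGamma (x, y)) * RGamma (x + INR n) * exp (y ^ 2 * (x + 1) / x * (/ x - / (x + INR n))).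
Proof.
intros Hx; induction n as [|n IH].
- cbn [INR]; rewrite Cplus_0_r, Rplus_0_r, Rminus_eq_0, Rmult_0_r, exp_0; lra.
- rewrite S_INR; set (t := INR n) in *; assert (Ht : 0 <= t) by apply pos_INR.
  replace ((x, y) + RtoC (t + 1))%C with ((x, y) + RtoC t + 1)%C by (rewrite RtoC_plus; ring).
  replace (x + (t + 1)) with (x + t + 1) by ring.
  rewrite CGamma_succ by (rewrite Re_plus, Re_R; cbn; lra).
  rewrite RGamma_succ, Cmod_mult by lra.
  replace ((x, y) + RtoC t)%C with (x + t, y) at 1
    by (apply C_eq; unfold Re, Im, Cplus, RtoC; cbn [fst snd]; ring).
  pose proof (Cmod_cone_le (x + t) y ltac:(lra)) as H1.
  set (k := y ^ 2 * (x + 1) / x) in *.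
  assert (H2 : y ^ 2 / (x + t) ^ 2 <= k * (/ (x + t) - / (x + t + 1))).
  { replace (k * (/ (x + t) - / (x + t + 1)))
      with (y ^ 2 / (x + t) ^ 2 * ((x + 1) * (x + t) / (x * (x + t + 1)))) by (unfold k; field; lra).
    rewrite <- Rmult_1_r at 1; apply Rmult_le_compat_l.
    - apply Rmult_le_pos; [apply pow2_ge_0 | left; apply Rinv_0_lt_compat; nra].
    - apply Rle_div_r; [nra | nra]. }
  replace (k * (/ x - / (x + t + 1)))
    with (k * (/ (x + t) - / (x + t + 1)) + k * (/ x - / (x + t))) by ring.
  rewrite exp_plus.
  apply exp_le in H2.
  set (A := Cmod (x + t, y)) in *; set (E1 := exp (y ^ 2 / (x + t) ^ 2)) in *.
  set (E2 := exp (k * (/ (x + t) - / (x + t + 1)))) in *.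
  assert (HA : A <= (x + t) * E2) by nra.
  replace (A * Cmod (CGamma ((x, y) + RtoC t)) * RGamma x)
    with (A * (Cmod (CGamma ((x, y) + RtoC t)) * RGamma x)) by ring.
  replace (Cmod (CGamma (x, y)) * ((x + t) * RGamma (x + t)) * (E2 * exp (k * (/ x - / (x + t)))))
    with (((x + t) * E2) * (Cmod (CGamma (x, y)) * RGamma (x + t) * exp (k * (/ x - / (x + t))))) by ring.
  apply Rmult_le_compat; [apply Cmod_ge_0 | | exact HA | exact IH].
  apply Rmult_le_pos; [apply Cmod_ge_0 | left; now apply RGamma_pos].
Qed.

(** The argument is shifted by [n > 1 + 8 y^2], where [CGamma_lower_large] loses at most a factor 2,
    and brought back by [CGamma_ratio], whose exponent is bounded independently of [n]. *)
Lemma CGamma_lower (a : C) : 0 < Re a ->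
  RGamma (Re a) * exp (- (Im a ^ 2 * (Re a + 1) / Re a ^ 2)) <= 2 * Cmod (CGamma a).
Proof.
destruct a as [x y]; cbn [Re Im fst snd]; intros Hx.
destruct (INR_unbounded (1 + 8 * y ^ 2)) as [n Hn].
assert (Hxn : 1 < x + INR n) by (pose proof (pow2_ge_0 y); lra).
pose proof (CGamma_lower_large (x + INR n) y Hxn) as L.
pose proof (CGamma_ratio x y n Hx) as Q.
replace ((x, y) + RtoC (INR n))%C with (x + INR n, y) in Q
  by (apply C_eq; unfold Re, Im, Cplus, RtoC; cbn [fst snd]; ring).
pose proof (RGamma_pos x Hx) as P1; pose proof (RGamma_pos (x + INR n) ltac:(lra)) as P2.
assert (H1 : / 2 <= 1 - 4 * y ^ 2 / (x + INR n - 1)).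
{ assert (4 * y ^ 2 / (x + INR n - 1) <= / 2); [|lra].
  apply Rle_div_l; lra. }
set (E := y ^ 2 * (x + 1) / x * (/ x - / (x + INR n))) in *.
set (B := y ^ 2 * (x + 1) / x ^ 2).
assert (HE : E <= B).
{ unfold E, B; replace (y ^ 2 * (x + 1) / x ^ 2) with (y ^ 2 * (x + 1) / x * / x) by (field; lra).
  apply Rmult_le_compat_l.
  - apply Rmult_le_pos; [|left; now apply Rinv_0_lt_compat].
    apply Rmult_le_pos; [apply pow2_ge_0 | lra].
  - assert (0 < / (x + INR n)) by (apply Rinv_0_lt_compat; lra); lra. }
apply exp_le in HE.
pose proof (Cmod_ge_0 (CGamma (x, y))) as P3.
set (g := Cmod (CGamma (x, y))) in *; set (G := RGamma (x + INR n)) in *.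
assert (S : G * (/ 2 * RGamma x) <= G * (g * exp B)).
{ apply Rle_trans with (g * G * exp E); [|].
  - eapply Rle_trans; [|exact Q].
    replace (G * (/ 2 * RGamma x)) with (G * / 2 * RGamma x) by ring.
    apply Rmult_le_compat_r; [lra|]; eapply Rle_trans; [|exact L].
    apply Rmult_le_compat_l; lra.
  - replace (G * (g * exp B)) with (g * G * exp B) by ring.
    apply Rmult_le_compat_l; [nra | exact HE]. }
apply Rmult_le_reg_l in S; [|exact P2].
rewrite exp_Ropp; apply Rle_div_l; [apply exp_pos | lra].
Qed.

Lemma CGamma_neq_0 (a : C) : 0 < Re a -> CGamma a <> 0%C.
Proof.
intros Ha; apply Cmod_gt_0; pose proof (CGamma_lower a Ha) as H.
assert (0 < RGamma (Re a) * exp (- (Im a ^ 2 * (Re a + 1) / Re a ^ 2))); [|lra].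
apply Rmult_lt_0_compat; [now apply RGamma_pos | apply exp_pos].
Qed.

(** * Series of complex numbers *)

Definition is_CS (a : nat -> C) (l : C) : Prop :=
  is_series (fun k => Re (a k)) (Re l) /\ is_series (fun k => Im (a k)) (Im l).

Lemma is_CS_eq (a : nat -> C) (l : C) : is_CS a l -> CSeries a = l.
Proof.
intros [H1 H2]; apply C_eq; [exact (is_series_unique _ _ H1) | exact (is_series_unique _ _ H2)].
Qed.

Lemma is_CS_dom (a : nat -> C) (m : nat -> R) :
  (forall k, Cmod (a k) <= m k) -> ex_series m -> is_CS a (CSeries a).
Proof.
intros H Hm; split; apply Series_correct; apply (ex_series_dom _ m); try exact Hm; intros k.
- exact (Rle_trans _ _ _ (re_le_Cmod _) (H k)).
- exact (Rle_trans _ _ _ (im_le_Cmod _) (H k)).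
Qed.

Lemma is_CS_ext (a b : nat -> C) (l : C) : (forall k, a k = b k) -> is_CS a l -> is_CS b l.
Proof.
intros E [H1 H2]; split; (eapply is_series_ext; [|eassumption]); intros k; cbn; now rewrite E.
Qed.

Lemma CSeries_ext (a b : nat -> C) : (forall k, a k = b k) -> CSeries a = CSeries b.
Proof. intros E; unfold CSeries; f_equal; apply Series_ext; intros k; now rewrite E. Qed.

Lemma is_CS_plus (a b : nat -> C) (l m : C) :
  is_CS a l -> is_CS b m -> is_CS (fun k => a k + b k)%C (l + m)%C.
Proof.
intros [H1 H2] [K1 K2]; split;
  [exact (is_series_plus _ _ _ _ H1 K1) | exact (is_series_plus _ _ _ _ H2 K2)].
Qed.

Lemma is_CS_scal (c : C) (a : nat -> C) (l : C) : is_CS a l -> is_CS (fun k => c * a k)%C (c * l)%C.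
Proof.
assert (S : forall (x : R) b m, is_series b m -> is_series (fun k => x * b k) (x * m))
  by (intros x b m Hb; exact (is_series_scal (K := R_AbsRing) x b m Hb)).
intros [H1 H2]; split.
- exact (is_series_minus _ _ _ _ (S (Re c) _ _ H1) (S (Im c) _ _ H2)).
- exact (is_series_plus _ _ _ _ (S (Re c) _ _ H2) (S (Im c) _ _ H1)).
Qed.

Lemma CSeries_bound (a : nat -> C) (m : nat -> R) :
  (forall k, Cmod (a k) <= m k) -> ex_series m -> Cmod (CSeries a) <= 2 * Series m.
Proof.
intros H Hm.
assert (B : forall f : nat -> R, (forall k, Rabs (f k) <= m k) -> Rabs (Series f) <= Series m).
{ intros f Hf; eapply Rle_trans.
  - apply Series_Rabs; apply (ex_series_dom _ m); [intros k; rewrite Rabs_Rabsolu; auto | exact Hm].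
  - apply Series_le; [intros k; split; [apply Rabs_pos | auto] | exact Hm]. }
eapply Rle_trans; [apply Cmod_le_sum|]; unfold CSeries; cbn [Re Im fst snd].
assert (B1 := B (fun k => Re (a k)) (fun k => Rle_trans _ _ _ (re_le_Cmod _) (H k))).
assert (B2 := B (fun k => Im (a k)) (fun k => Rle_trans _ _ _ (im_le_Cmod _) (H k))).
lra.
Qed.

(** * Pochhammer symbols *)

Fixpoint Cpoch (d : C) (k : nat) : C :=
  match k with O => 1%C | S k' => (Cpoch d k' * (d + RtoC (INR k')))%C end.

Fixpoint Rpoch (b : R) (k : nat) : R :=
  match k with O => 1 | S k' => Rpoch b k' * (b + INR k') end.

Lemma Rpoch_head (b : R) (k : nat) : Rpoch b (S k) = b * Rpoch (b + 1) k.
Proof.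
induction k as [|k IH]; [cbn; ring|].
change (Rpoch b (S (S k))) with (Rpoch b (S k) * (b + INR (S k))).
rewrite IH, S_INR; cbn [Rpoch]; ring.
Qed.

Lemma Cmod_Cpoch (a : C) (b : R) (k : nat) : Cmod a <= b -> Cmod (Cpoch a k) <= Rpoch b k.
Proof.
intros Hb; induction k as [|k IH]; cbn [Rpoch Cpoch]; [rewrite Cmod_1; lra|].
rewrite Cmod_mult; apply Rmult_le_compat; [apply Cmod_ge_0 | apply Cmod_ge_0 | exact IH |].
eapply Rle_trans; [apply Cmod_triangle|]; rewrite Cmod_R, Rabs_pos_eq by apply pos_INR; lra.
Qed.

(** One term of the binomial series of [(1 - r)^(-b)] is at most its sum. The induction avoids that
    series: the difference of the two sides at [n + 1], as a function of [r], has derivative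
    [(n + 1) b] times the difference at [n] with [b + 1], whence the quantification over [b]. *)
Lemma Rpoch_bound (n : nat) : forall b r, 0 <= b -> 0 <= r < 1 ->
  Rpoch b n * r ^ n <= INR (fact n) * Rpower (1 - r) (- b).
Proof.
induction n as [|n IH]; intros b r Hb Hr.
- cbn [Rpoch fact pow INR]; rewrite !Rmult_1_l; unfold Rpower.
  apply Rle_trans with (exp 0); [rewrite exp_0; lra|]; apply exp_le.
  pose proof (ln_le_sub1 (1 - r) ltac:(lra)); nra.
- set (phi := fun x => INR (fact (S n)) * Rpower (1 - x) (- b) - Rpoch b (S n) * x ^ S n).
  set (dphi := fun x => INR (fact (S n)) * (b * Rpower (1 - x) (- b - 1))
     - Rpoch b (S n) * (INR (S n) * x ^ n)).
  assert (D : forall x, x < 1 -> is_derive phi x (dphi x)).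
  { intros x Hx; apply (is_derive_minus (K := R_AbsRing) (V := R_NormedModule)).
    - apply (is_derive_scal (fun x => Rpower (1 - x) (- b))).
      evar_last.
      + apply (is_derive_comp (K := R_AbsRing) (V := R_NormedModule) (fun v => Rpower v (- b))
          (fun v => 1 - v)).
        * apply is_derive_Rpower; lra.
        * auto_derive; [trivial | reflexivity].
      + unfold scal; cbn; unfold mult; cbn; ring.
    - apply (is_derive_scal (fun x => x ^ S n)).
      evar_last; [apply is_derive_pow, (is_derive_id (K := R_AbsRing))|].
      cbn [pred]; unfold one; cbn -[INR]; ring. }
  assert (P : forall x, 0 <= x < 1 -> 0 <= dphi x).
  { intros x Hx; unfold dphi; rewrite Rpoch_head, fact_simpl, mult_INR.
    specialize (IH (b + 1) x ltac:(lra) Hx).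
    replace (- (b + 1)) with (- b - 1) in IH by ring.
    pose proof (pos_INR (S n)).
    assert (0 <= INR (S n) * b) by nra.
    assert (INR (S n) * b * (Rpoch (b + 1) n * x ^ n)
      <= INR (S n) * b * (INR (fact n) * Rpower (1 - x) (- b - 1))) by (now apply Rmult_le_compat_l).
    lra. }
  assert (Q : 0 <= phi r).
  { destruct (MVT_gen phi 0 r dphi) as (c & Hc & E).
    - intros x Hx; rewrite Rmax_right in Hx by lra; apply D; lra.
    - intros x Hx; rewrite Rmax_right in Hx by lra; apply continuity_pt_filterlim.
      apply (ex_derive_continuous (K := R_AbsRing) (V := R_NormedModule)).
      eexists; apply D; lra.
    - rewrite Rmin_left, Rmax_right in Hc by lra.
      pose proof (P c ltac:(lra)).
      assert (0 <= phi 0).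
      { unfold phi; rewrite pow_i, Rmult_0_r, Rminus_0_r by lia.
        apply Rmult_le_pos; [apply pos_INR | left; apply exp_pos]. }
      nra. }
  unfold phi in Q; lra.
Qed.

Lemma INR_fact_pos (n : nat) : 0 < INR (fact n).
Proof. apply lt_0_INR, lt_O_fact. Qed.

Definition binom_coef (d q : C) (k : nat) : C := (Cpoch d k * / RtoC (INR (fact k)) * q ^ k)%C.

(** The free [r] balances the constant against the ratio: [r] between [|q|] and 1 gives summability,
    while [r = / 2] suffices when any geometric bound will do. *)
Lemma binom_coef_bound (d q : C) (r : R) (k : nat) : 0 < r < 1 ->
  Cmod (binom_coef d q k) <= Rpower (1 - r) (- Cmod d) * (Cmod q / r) ^ k.
Proof.
intros Hr; unfold binom_coef; pose proof (INR_fact_pos k) as Pf.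
assert (RtoC (INR (fact k)) <> 0%C) by (intros E; apply RtoC_inj in E; lra).
rewrite !Cmod_mult, Cmod_inv, Cmod_pow, Cmod_R, Rabs_pos_eq by (assumption || lra).
pose proof (Cmod_Cpoch d (Cmod d) k (Rle_refl _)) as H1.
pose proof (Rpoch_bound k (Cmod d) r (Cmod_ge_0 d) ltac:(lra)) as H2.
unfold Rdiv; rewrite Rpow_mult_distr, (Rmult_comm (Cmod q ^ k)), <- Rmult_assoc.
apply Rmult_le_compat_r; [apply pow_le, Cmod_ge_0|].
rewrite pow_inv.
assert (0 < r ^ k) by (apply pow_lt; lra).
apply (Rmult_le_reg_r (INR (fact k) * r ^ k)); [nra|].
replace (Cmod (Cpoch d k) * / INR (fact k) * (INR (fact k) * r ^ k))
  with (Cmod (Cpoch d k) * r ^ k) by (field; lra).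
replace (Rpower (1 - r) (- Cmod d) * / r ^ k * (INR (fact k) * r ^ k))
  with (INR (fact k) * Rpower (1 - r) (- Cmod d)) by (field; lra).
nra.
Qed.

Lemma ex_series_eq (a b : nat -> R) : (forall k, a k = b k) -> ex_series a -> ex_series b.
Proof. exact (ex_series_ext a b). Qed.

Lemma ex_series_geom_scal (A q : R) : 0 <= q < 1 -> ex_series (fun k => A * q ^ k).
Proof.
intros Hq; apply (ex_series_scal (K := R_AbsRing) (V := R_NormedModule)).
apply ex_series_geom; rewrite Rabs_pos_eq; lra.
Qed.

Lemma binom_coef_summable (d q : C) : Cmod q < 1 ->
  exists m : nat -> R, (forall k, Cmod (binom_coef d q k) <= m k) /\ ex_series m.
Proof.
intros Hq; pose proof (Cmod_ge_0 q); set (r := (1 + Cmod q) / 2).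
exists (fun k => Rpower (1 - r) (- Cmod d) * (Cmod q / r) ^ k); split.
- intros k; apply binom_coef_bound; unfold r; lra.
- apply ex_series_geom_scal; split.
  + apply Rmult_le_pos; [lra | left; apply Rinv_0_lt_compat; unfold r; lra].
  + apply Rlt_div_l; unfold r; lra.
Qed.

(** * Reciprocal Gamma values in a sector around the positive axis *)

Definition cone (kap : R) (a : C) : Prop := 0 < Re a /\ Rabs (Im a) <= kap * Re a.

(** In the sector [(Im a)^2 / (Re a)^2 <= kap^2], so the loss in [CGamma_lower] is at most
    [exp (kap^2 (Re a + 1))]. Along [a = s k + t] this is geometric in [k]. *)
Lemma CGamma_inv_bound (kap : R) (a : C) : cone kap a ->
  / Cmod (CGamma a) <= 2 * exp (kap ^ 2) * (exp (kap ^ 2 * Re a) / RGamma (Re a)).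
Proof.
intros [Ha Hk]; pose proof (CGamma_lower a Ha) as L; pose proof (RGamma_pos _ Ha) as PG.
assert (P : 0 < Cmod (CGamma a)) by (apply Cmod_gt_0, CGamma_neq_0, Ha).
assert (E : exp (- (kap ^ 2 * (Re a + 1))) <= exp (- (Im a ^ 2 * (Re a + 1) / Re a ^ 2))).
{ apply exp_le, Ropp_le_contravar.
  apply Rle_div_l; [nra|].
  assert (Im a ^ 2 <= kap ^ 2 * Re a ^ 2).
  { rewrite <- (pow2_abs (Im a)), <- Rpow_mult_distr; apply pow_incr; split; [apply Rabs_pos | exact Hk]. }
  replace (kap ^ 2 * (Re a + 1) * Re a ^ 2) with (kap ^ 2 * Re a ^ 2 * (Re a + 1)) by ring.
  apply Rmult_le_compat_r; lra. }
rewrite exp_Ropp in E.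
assert (E2 : RGamma (Re a) * / exp (kap ^ 2 * (Re a + 1)) <= 2 * Cmod (CGamma a)) by nra.
replace (2 * exp (kap ^ 2) * (exp (kap ^ 2 * Re a) / RGamma (Re a)))
  with (2 * (exp (kap ^ 2 * (Re a + 1)) / RGamma (Re a))).
2:{ replace (kap ^ 2 * (Re a + 1)) with (kap ^ 2 + kap ^ 2 * Re a) by ring; rewrite exp_plus; field; lra. }
pose proof (exp_pos (kap ^ 2 * (Re a + 1))) as Pe; set (e := exp (kap ^ 2 * (Re a + 1))) in *.
apply (Rmult_le_reg_l (Cmod (CGamma a))); [exact P|]; rewrite Rinv_r by lra.
replace (Cmod (CGamma a) * (2 * (e / RGamma (Re a)))) with ((2 * Cmod (CGamma a)) * (e / RGamma (Re a))) by ring.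
apply Rle_trans with (RGamma (Re a) * / e * (e / RGamma (Re a))).
- right; field; lra.
- apply Rmult_le_compat_r; [|exact E2]; left; now apply Rdiv_lt_0_compat.
Qed.

(** * The Prabhakar function on a ray *)

Definition prab_exponent (s t : C) (k : nat) : C := (s * RtoC (INR k) + t)%C.
Definition prab_coef (s t d l : C) (k : nat) : C := (binom_coef d l k * / CGamma (prab_exponent s t k))%C.
(** This is [u^(t-1) E(l u^s)] with the powers of [u] gathered in each term, so that every term has
    an explicit Laplace transform; see [prab_fun_eq]. *)
Definition prab_fun (s t d l : C) (u : R) : C := CSeries (fun k => prab_coef s t d l k * Rcpower u (prab_exponent s t k - 1))%C.

Lemma Re_prab_exponent (s t : C) (k : nat) : Re (prab_exponent s t k) = Re s * INR k + Re t.
Proof. unfold prab_exponent; now rewrite Re_plus, Re_multR. Qed.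

Lemma cone_prab_exponent (kap : R) (s t : C) (k : nat) : cone kap s -> cone kap t -> cone kap (prab_exponent s t k).
Proof.
intros [Hs Ks] [Ht Kt]; pose proof (pos_INR k) as Pk; split; rewrite Re_prab_exponent; [nra|].
unfold prab_exponent; rewrite Im_plus, Im_multR.
eapply Rle_trans; [apply Rabs_triang|]; rewrite Rabs_mult, (Rabs_pos_eq (INR k)) by exact Pk; nra.
Qed.

Lemma exists_cone (s t : C) : 0 < Re s -> 0 < Re t -> exists kap, cone kap s /\ cone kap t.
Proof.
intros Hs Ht; exists (Rabs (Im s) / Re s + Rabs (Im t) / Re t).
assert (P1 : 0 <= Rabs (Im s) / Re s)
  by (apply Rmult_le_pos; [apply Rabs_pos | left; now apply Rinv_0_lt_compat]).
assert (P2 : 0 <= Rabs (Im t) / Re t)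
  by (apply Rmult_le_pos; [apply Rabs_pos | left; now apply Rinv_0_lt_compat]).
assert (E1 : Rabs (Im s) / Re s * Re s = Rabs (Im s)) by (field; lra).
assert (E2 : Rabs (Im t) / Re t * Re t = Rabs (Im t)) by (field; lra).
split; split; try assumption; nra.
Qed.

(* A majorant of [prab_coef k] whose Laplace transform is explicit. *)
Definition prab_majorant (A B mu : R) (s t : C) (k : nat) : R :=
  A * B ^ k * (exp (mu * Re (prab_exponent s t k)) / RGamma (Re (prab_exponent s t k))).

Lemma prab_coef_bound (kap : R) (s t d l : C) : cone kap s -> cone kap t ->
  exists A B, 0 < A /\ 0 < B /\ forall k, Cmod (prab_coef s t d l k) <= prab_majorant A B (kap ^ 2) s t k.
Proof.
intros Hs Ht; set (P := Rpower (1 - / 2) (- Cmod d)).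
(* The binomial coefficient is bounded with [r = / 2]; the added 1 keeps [B] positive when
   [l = 0]. *)
exists (P * (2 * exp (kap ^ 2))), (Cmod l / (/ 2) + 1).
assert (PP : 0 < P) by apply exp_pos.
assert (Pe := exp_pos (kap ^ 2)); assert (Pl := Cmod_ge_0 l).
split; [nra|]; split; [lra|]; intros k.
pose proof (cone_prab_exponent kap s t k Hs Ht) as Ha.
unfold prab_coef; rewrite Cmod_mult, Cmod_inv by (apply CGamma_neq_0, Ha).
pose proof (CGamma_inv_bound kap _ Ha) as H1.
pose proof (binom_coef_bound d l (/ 2) k ltac:(lra)) as H2; fold P in H2.
assert (H3 : (Cmod l / (/ 2)) ^ k <= (Cmod l / (/ 2) + 1) ^ k) by (apply pow_incr; lra).
unfold prab_majorant.
replace (P * (2 * exp (kap ^ 2)) * (Cmod l / / 2 + 1) ^ k *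
   (exp (kap ^ 2 * Re (prab_exponent s t k)) / RGamma (Re (prab_exponent s t k))))
 with (P * (Cmod l / / 2 + 1) ^ k
   * (2 * exp (kap ^ 2) * (exp (kap ^ 2 * Re (prab_exponent s t k)) / RGamma (Re (prab_exponent s t k))))) by ring.
apply Rmult_le_compat; [apply Cmod_ge_0 | | | exact H1].
- left; apply Rinv_0_lt_compat, Cmod_gt_0, CGamma_neq_0, Ha.
- eapply Rle_trans; [exact H2|]; apply Rmult_le_compat_l; lra.
Qed.

Lemma Rpower_prab_exponent (x : R) (s t : C) (k : nat) : 0 < x ->
  Rpower x (Re (prab_exponent s t k)) = Rpower x (Re t) * Rpower x (Re s) ^ k.
Proof.
intros Hx; rewrite Re_prab_exponent, Rplus_comm, Rpower_plus; f_equal.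
rewrite <- Rpower_mult, Rpower_pow; [reflexivity | apply exp_pos].
Qed.

Lemma ex_series_prab_exponent (A B : R) (s t : C) : 0 < B -> 0 < Re s ->
  exists x0, 0 < x0 /\ forall x, 0 < x -> x <= x0 ->
    ex_series (fun k => A * B ^ k * Rpower x (Re (prab_exponent s t k))).
Proof.
(* The solution of [B x^(Re s) = / 2]; below it the series is geometric with ratio at most 1/2. *)
intros HB Hs; exists (Rpower (/ (2 * B)) (/ Re s)); split; [apply exp_pos|]; intros x Hx Hx0.
apply (ex_series_eq (fun k => A * Rpower x (Re t) * (B * Rpower x (Re s)) ^ k)).
- intros k; rewrite Rpower_prab_exponent, Rpow_mult_distr by exact Hx; ring.
- apply ex_series_geom_scal; split.
  + apply Rmult_le_pos; [lra | left; apply exp_pos].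
  + apply Rle_lt_trans with (B * / (2 * B)).
    * apply Rmult_le_compat_l; [lra|].
      eapply Rle_trans; [apply Rpower_mono; [lra | exact Hx | exact Hx0]|].
      rewrite Rpower_mult, Rinv_l, Rpower_1; [lra | apply Rinv_0_lt_compat; lra | lra].
    * replace (B * / (2 * B)) with (/ 2) by (field; lra); lra.
Qed.

Lemma Rpower_exp_scal (mu x c : R) : 0 < c ->
  exp (mu * x) * Rpower c x = Rpower (exp mu * c) x.
Proof.
intros Hc; unfold Rpower; rewrite <- exp_plus, ln_mult, ln_exp by (try apply exp_pos; exact Hc).
f_equal; ring.
Qed.

(** [RGamma_lower] is used with [r x0 = exp mu * b]: the numerator is at most [(r x0)^a], and
    [r^a / Gamma(a)] is at most [(r + 1) exp (r + 1)], which leaves [x0^a], summable against [A B^k]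
    by the choice of [x0]. *)
Lemma prab_majorant_local (A B mu : R) (s t : C) (b : R) : 0 < A -> 0 < B -> 0 < Re s -> 0 < Re t -> 0 < b ->
  exists m : nat -> R, ex_series m /\ forall k u, 0 < u -> u <= b ->
    prab_majorant A B mu s t k * Rpower u (Re (prab_exponent s t k)) <= m k.
Proof.
intros HA HB Hs Ht Hb.
destruct (ex_series_prab_exponent A B s t HB Hs) as (x0 & Hx0 & Hser).
set (r := exp mu * b / x0).
assert (Hr : 0 < r).
{ apply Rdiv_lt_0_compat; [|exact Hx0]; apply Rmult_lt_0_compat; [apply exp_pos | exact Hb]. }
exists (fun k => (r + 1) * exp (r + 1) * (A * B ^ k * Rpower x0 (Re (prab_exponent s t k)))); split.
- apply (ex_series_scal (K := R_AbsRing) (V := R_NormedModule)), Hser; lra.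
- intros k u Hu Hub; unfold prab_majorant; set (a := Re (prab_exponent s t k)).
  assert (Ha : 0 < a) by (unfold a; rewrite Re_prab_exponent; pose proof (pos_INR k); nra).
  pose proof (RGamma_lower a r Ha Hr) as L; pose proof (RGamma_pos a Ha) as PG.
  assert (PB : 0 < A * B ^ k) by (apply Rmult_lt_0_compat; [exact HA | now apply pow_lt]).
  replace ((r + 1) * exp (r + 1) * (A * B ^ k * Rpower x0 a))
    with (A * B ^ k * ((r + 1) * exp (r + 1) * Rpower x0 a)) by ring.
  rewrite Rmult_assoc; apply Rmult_le_compat_l; [lra|].
  apply (Rmult_le_reg_r (RGamma a)); [exact PG|].
  replace (exp (mu * a) / RGamma a * Rpower u a * RGamma a) with (exp (mu * a) * Rpower u a) by (field; lra).
  rewrite Rpower_exp_scal by exact Hu.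
  apply Rle_trans with (Rpower (r * x0) a).
  + apply Rpower_mono; [lra | apply Rmult_lt_0_compat; [apply exp_pos | exact Hu] |].
    unfold r; replace (exp mu * b / x0 * x0) with (exp mu * b) by (field; lra).
    apply Rmult_le_compat_l; [left; apply exp_pos | exact Hub].
  + unfold Rpower at 1; rewrite ln_mult, Rmult_plus_distr_l, exp_plus by lra;
      fold (Rpower r a) (Rpower x0 a).
    pose proof (exp_pos (r + 1)) as Pe; rewrite exp_Ropp in L.
    assert (Px : 0 < Rpower x0 a) by apply exp_pos.
    replace ((r + 1) * exp (r + 1) * Rpower x0 a * RGamma a)
      with (((r + 1) * exp (r + 1) * RGamma a) * Rpower x0 a) by ring.
    apply Rmult_le_compat_r; [lra|].
    apply Rle_trans with ((r + 1) * exp (r + 1) * (Rpower r a * / exp (r + 1) / (r + 1))).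
    * right; field; lra.
    * apply Rmult_le_compat_l; [nra | exact L].
Qed.

Lemma prab_coef_term_local (kap : R) (s t d l : C) (b : R) : cone kap s -> cone kap t -> 0 < b ->
  exists m : nat -> R, ex_series m /\ forall k u, 0 < u -> u <= b ->
    Cmod (prab_coef s t d l k * Rcpower u (prab_exponent s t k - 1)) <= / u * m k.
Proof.
intros Hs Ht Hb; destruct (prab_coef_bound kap s t d l Hs Ht) as (A & B & HA & HB & HAB).
destruct (prab_majorant_local A B (kap ^ 2) s t b HA HB (proj1 Hs) (proj1 Ht) Hb) as (m & Sm & Hm).
exists m; split; [exact Sm|]; intros k u Hu Hub.
rewrite Cmod_mult, Cmod_Rcpower, Re_minus, Re_R.
apply (Rmult_le_reg_l u); [exact Hu|]; replace (u * (/ u * m k)) with (m k) by (field; lra).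
eapply Rle_trans; [|apply (Hm k u Hu Hub)].
rewrite (Rpower_split u (Re (prab_exponent s t k))) by exact Hu.
rewrite <- Rmult_assoc, (Rmult_comm u), Rmult_assoc.
apply Rmult_le_compat_r; [|apply HAB].
apply Rmult_le_pos; [lra | left; apply exp_pos].
Qed.

Lemma prab_fun_CS (s t d l : C) (u : R) : 0 < Re s -> 0 < Re t -> 0 < u ->
  is_CS (fun k => prab_coef s t d l k * Rcpower u (prab_exponent s t k - 1))%C (prab_fun s t d l u).
Proof.
intros Hs Ht Hu; destruct (exists_cone s t Hs Ht) as (kap & Cs & Ct).
destruct (prab_coef_term_local kap s t d l u Cs Ct Hu) as (m & Sm & Hm).
apply (is_CS_dom _ (fun k => / u * m k)); [intros k; apply Hm; lra|].
apply (ex_series_scal (K := R_AbsRing) (V := R_NormedModule)), Sm.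
Qed.

Lemma contC_prab_fun (s t d l : C) (u : R) : 0 < Re s -> 0 < Re t -> 0 < u ->
  contC (prab_fun s t d l) u.
Proof.
intros Hs Ht Hu; destruct (exists_cone s t Hs Ht) as (kap & Cs & Ct).
destruct (prab_coef_term_local kap s t d l (2 * u) Cs Ct ltac:(lra)) as (m & Sm & Hm).
assert (Cf : forall k, contC (fun u => prab_coef s t d l k * Rcpower u (prab_exponent s t k - 1))%C u).
{ intros k; apply contC_mult; [apply contC_const | now apply contC_Rcpower]. }
assert (Bf : forall k y, Rabs (y - u) < u / 2 ->
  Cmod (prab_coef s t d l k * Rcpower y (prab_exponent s t k - 1)) <= / (u / 2) * m k).
{ intros k y Hy; apply Rabs_def2 in Hy.
  eapply Rle_trans; [apply Hm; lra|].
  assert (Pm : 0 <= / y * m k) by (eapply Rle_trans; [apply Cmod_ge_0 | apply (Hm k y); lra]).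
  assert (Py : 0 < / y) by (apply Rinv_0_lt_compat; lra).
  apply Rmult_le_compat_r; [nra|]; apply Rinv_le_contravar; lra. }
assert (Sm' : ex_series (fun k => / (u / 2) * m k))
  by (apply (ex_series_scal (K := R_AbsRing) (V := R_NormedModule)), Sm).
split.
- apply (continuous_Series (fun k y => Re (prab_coef s t d l k * Rcpower y (prab_exponent s t k - 1)))
    (fun k => / (u / 2) * m k) u (u / 2)); [lra | intros k; apply Cf | | exact Sm'].
  intros k y Hy; exact (Rle_trans _ _ _ (re_le_Cmod _) (Bf k y Hy)).
- apply (continuous_Series (fun k y => Im (prab_coef s t d l k * Rcpower y (prab_exponent s t k - 1)))
    (fun k => / (u / 2) * m k) u (u / 2)); [lra | intros k; apply Cf | | exact Sm'].
  intros k y Hy; exact (Rle_trans _ _ _ (im_le_Cmod _) (Bf k y Hy)).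
Qed.

(** In the transform of the [k]-th majorant the Gamma values cancel, leaving
    [A B^k (exp (kap^2) / Re z)^a] with [a = Re (s k + t)]. This is summable once
    [exp (kap^2) / Re z <= x0], which is the origin of [K]. *)
Lemma prab_fun_Laplace (s t d l : C) : 0 < Re s -> 0 < Re t ->
  exists K, 0 < K /\ forall z, K < Re z ->
    is_Cint0oo (fun u => Cexp (- (z * RtoC u)) * prab_fun s t d l u)%C
      (CSeries (fun k => binom_coef d l k * Cpower z (- prab_exponent s t k)))%C.
Proof.
intros Hs Ht; destruct (exists_cone s t Hs Ht) as (kap & Cs & Ct).
destruct (prab_coef_bound kap s t d l Cs Ct) as (A & B & HA & HB & HAB).
destruct (ex_series_prab_exponent A B s t HB Hs) as (x0 & Hx0 & Hser).
exists (exp (kap ^ 2) / x0); split; [apply Rdiv_lt_0_compat; [apply exp_pos | exact Hx0]|].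
intros z Hz.
assert (Pz : 0 < Re z).
{ eapply Rlt_trans; [|exact Hz]; apply Rdiv_lt_0_compat; [apply exp_pos | exact Hx0]. }
assert (Pa : forall k, 0 < Re (prab_exponent s t k)) by (intros k; rewrite Re_prab_exponent; pose proof (pos_INR k); nra).
set (f := fun k u => (Cexp (- (z * RtoC u)) * (prab_coef s t d l k * Rcpower u (prab_exponent s t k - 1)))%C).
set (h := fun k u => prab_majorant A B (kap ^ 2) s t k * Gamma_kernel (Re (prab_exponent s t k)) (Re z) u).
set (H := fun k => prab_majorant A B (kap ^ 2) s t k * RGamma_scaled (Re (prab_exponent s t k)) (Re z)).
assert (Cf : forall k u, 0 < u -> contC (f k) u).
{ intros k u Hu; apply contC_mult; [apply contC_Cexp_lin|].
  apply contC_mult; [apply contC_const | now apply contC_Rcpower]. }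
assert (Ch : forall k u, 0 < u -> continuous (h k) u).
{ intros k u Hu; apply (continuous_mult (K := R_AbsRing)); [apply continuous_const|].
  now apply continuous_Gamma_kernel. }
assert (Bf : forall k u, 0 < u -> Cmod (f k u) <= h k u).
{ intros k u Hu; unfold f, h, Gamma_kernel.
  rewrite !Cmod_mult, Cmod_Cexp_lin, Cmod_Rcpower, Re_minus, Re_R, Rmult_comm, Rmult_assoc.
  apply Rmult_le_compat_r; [left; apply Rmult_lt_0_compat; apply exp_pos | apply HAB]. }
assert (If : forall k, is_Cint0oo (f k) (binom_coef d l k * Cpower z (- prab_exponent s t k))%C).
{ intros k; pose proof (CLaplace_correct _ _ _ z (power_bounded_Rcpower _ (Pa k)) Pz) as I.
  rewrite CLaplace_Rcpower in I by auto.
  eapply is_Cint0oo_eq.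
  - eapply is_Cint0oo_ext; [|exact (is_Cint0oo_scal _ (prab_coef s t d l k) _ I)]; intros u Hu; unfold f; ring.
  - unfold prab_coef; field; apply CGamma_neq_0, Pa. }
assert (Ih : forall k, is_int0oo (h k) (H k)) by (intros k; apply is_int0oo_scal, RGamma_scaled_correct; auto).
assert (SH : ex_series H).
{ apply (ex_series_eq (fun k => A * B ^ k * Rpower (exp (kap ^ 2) * / Re z) (Re (prab_exponent s t k)))).
  - intros k; unfold H, prab_majorant; rewrite RGamma_scaled_scale by auto.
    rewrite <- Rpower_exp_scal by (now apply Rinv_0_lt_compat).
    replace (Rpower (/ Re z) (Re (prab_exponent s t k))) with (Rpower (Re z) (- Re (prab_exponent s t k)))
      by (unfold Rpower; rewrite ln_Rinv by exact Pz; f_equal; ring).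
    pose proof (RGamma_pos _ (Pa k)); field; lra.
  - apply Hser.
    + apply Rmult_lt_0_compat; [apply exp_pos | now apply Rinv_0_lt_compat].
    + apply Rlt_div_l in Hz; [|exact Hx0].
      apply (Rmult_le_reg_r (Re z)); [exact Pz|].
      rewrite Rmult_assoc, Rinv_l by lra; lra. }
assert (Loc : forall a b, 0 < a -> a < b -> exists m : nat -> R, ex_series m /\
  forall k u, a <= u <= b -> Cmod (f k u) <= m k).
{ intros a b Ha Hab; destruct (prab_coef_term_local kap s t d l b Cs Ct ltac:(lra)) as (m & Sm & Hm).
  exists (fun k => / a * m k); split; [apply (ex_series_scal (K := R_AbsRing) (V := R_NormedModule)), Sm|].
  intros k u Hu; unfold f; rewrite Cmod_mult, Cmod_Cexp_lin.
  specialize (Hm k u ltac:(lra) ltac:(lra)).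
  assert (Pm : 0 <= / u * m k) by (eapply Rle_trans; [apply Cmod_ge_0 | exact Hm]).
  assert (Pu : 0 < / u) by (apply Rinv_0_lt_compat; lra).
  rewrite <- (Rmult_1_l (/ a * m k)); apply Rmult_le_compat;
    [left; apply exp_pos | apply Cmod_ge_0 | |].
  - apply Rle_trans with (exp 0); [apply exp_le; nra | rewrite exp_0; lra].
  - eapply Rle_trans; [exact Hm|].
    apply Rmult_le_compat_r; [nra|]; apply Rinv_le_contravar; lra. }
assert (I : is_Cint0oo (fun u => CSeries (fun k => f k u))
   (CSeries (fun k => binom_coef d l k * Cpower z (- prab_exponent s t k)))%C).
{ split.
  - apply (is_int0oo_Series (fun k u => Re (f k u)) h _ H); auto.
    + intros k u Hu; apply (Cf k u Hu).
    + intros k u Hu; exact (Rle_trans _ _ _ (re_le_Cmod _) (Bf k u Hu)).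
    + intros k; apply (If k).
    + intros a b Ha Hab; destruct (Loc a b Ha Hab) as (m & Sm & Hm); exists m; split; [exact Sm|].
      intros k u Hu; exact (Rle_trans _ _ _ (re_le_Cmod _) (Hm k u Hu)).
  - apply (is_int0oo_Series (fun k u => Im (f k u)) h _ H); auto.
    + intros k u Hu; apply (Cf k u Hu).
    + intros k u Hu; exact (Rle_trans _ _ _ (im_le_Cmod _) (Bf k u Hu)).
    + intros k; apply (If k).
    + intros a b Ha Hab; destruct (Loc a b Ha Hab) as (m & Sm & Hm); exists m; split; [exact Sm|].
      intros k u Hu; exact (Rle_trans _ _ _ (im_le_Cmod _) (Hm k u Hu)). }
eapply is_Cint0oo_ext; [|exact I]; intros u Hu; cbv beta.
apply is_CS_eq, is_CS_scal, prab_fun_CS; assumption.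
Qed.

(** * The binomial series *)

(** By continuity [f] stays in the right half-plane near [x], where the logarithm has coordinates
    [ln (sqrt (X^2 + Y^2))] and [atan (Y / X)]. *)
Lemma derC_Clog (f : R -> C) (x : R) (l : C) : derC f x l -> 0 < Re (f x) ->
  derC (fun t => Clog (f t)) x (l / f x)%C.
Proof.
intros Hf Hx; pose proof (derC_contC _ _ _ Hf) as [Cr _]; destruct Hf as [H1 H2].
assert (L : locally x (fun t => 0 < Re (f t))).
{ destruct (proj1 (continuous_R _ _) Cr (Re (f x)) Hx) as (d & Hd & HH).
  exists (mkposreal d Hd); intros y Hy; specialize (HH y Hy); cbv beta in HH.
  apply Rabs_def2 in HH; lra. }
assert (M2 : forall t, Cmod (f t) = sqrt (Re (f t) ^ 2 + Im (f t) ^ 2)) by reflexivity.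
assert (P : 0 < Re (f x) ^ 2 + Im (f x) ^ 2) by nra.
assert (Er : Re (l / f x) = (Re l * Re (f x) + Im l * Im (f x)) / (Re (f x) ^ 2 + Im (f x) ^ 2)).
{ unfold Cdiv, Cinv; rewrite Re_mult; unfold Re, Im in *; cbn [fst snd]; field; lra. }
assert (Ei : Im (l / f x) = (Im l * Re (f x) - Re l * Im (f x)) / (Re (f x) ^ 2 + Im (f x) ^ 2)).
{ unfold Cdiv, Cinv; rewrite Im_mult; unfold Re, Im in *; cbn [fst snd]; field; lra. }
split.
- apply (is_derive_ext (fun t => ln (sqrt (Re (f t) ^ 2 + Im (f t) ^ 2)))); [reflexivity|].
  rewrite Er.
  assert (Ps : 0 < sqrt (Re (f x) ^ 2 + Im (f x) ^ 2)) by (now apply sqrt_lt_R0).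
  set (X := fun t => Re (f t)) in *; set (Y := fun t => Im (f t)) in *.
  change (Re (f x)) with (X x) in *; change (Im (f x)) with (Y x) in *.
  apply (is_derive_ext (fun t => ln (sqrt (X t ^ 2 + Y t ^ 2)))); [reflexivity|].
  auto_derive.
  + repeat split; try (eexists; eassumption); cbn in *; lra.
  + replace (Derive (fun x0 => X x0) x) with (Re l) by (symmetry; exact (is_derive_unique X x _ H1));
    replace (Derive (fun x0 => Y x0) x) with (Im l) by (symmetry; exact (is_derive_unique Y x _ H2)).
    assert (Es : sqrt (X x ^ 2 + Y x ^ 2) * sqrt (X x ^ 2 + Y x ^ 2) = X x ^ 2 + Y x ^ 2)
      by (apply sqrt_sqrt; lra).
    replace (X x * (X x * 1) + Y x * (Y x * 1)) with (X x ^ 2 + Y x ^ 2) by ring.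
    rewrite <- Es at 3; field; lra.
- apply (is_derive_ext_loc (fun t => atan (Im (f t) / Re (f t)))).
  + apply filter_imp with (2 := L); intros t Ht.
    unfold Clog; cbn [Im snd]; symmetry; now apply Carg_atan.
  + rewrite Ei.
    set (X := fun t => Re (f t)) in *; set (Y := fun t => Im (f t)) in *.
    change (Re (f x)) with (X x) in *; change (Im (f x)) with (Y x) in *.
    apply (is_derive_ext (fun t => atan (Y t / X t))); [reflexivity|].
    auto_derive.
    * repeat split; try (eexists; eassumption); lra.
    * replace (Derive (fun x0 => X x0) x) with (Re l) by (symmetry; exact (is_derive_unique X x _ H1));
    replace (Derive (fun x0 => Y x0) x) with (Im l) by (symmetry; exact (is_derive_unique Y x _ H2)); unfold Rsqr; field.
      split; [cbn in P; nra | lra].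
Qed.

Lemma is_CS_shift (a : nat -> C) (l : C) :
  is_CS (fun k => a (S k)) l -> is_CS a (a 0%nat + l)%C.
Proof.
assert (S : forall (b : nat -> R) (m : R), is_series (fun k => b (S k)) m -> is_series b (b 0%nat + m)).
{ intros b m Hb; apply (is_series_decr_1 (K := R_AbsRing)).
  assert (E : m = b 0%nat + m + - b 0%nat) by ring; rewrite E in Hb; exact Hb. }
intros [H1 H2]; split;
  [exact (S (fun k => Re (a k)) _ H1) | exact (S (fun k => Im (a k)) _ H2)].
Qed.

Lemma binom_coef_succ (d q : C) (k : nat) :
  (RtoC (INR (S k)) * binom_coef d q (S k) = q * (d + RtoC (INR k)) * binom_coef d q k)%C.
Proof.
unfold binom_coef; cbn [Cpoch]; rewrite fact_simpl, mult_INR, RtoC_mult, Cpow_S.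
pose proof (INR_fact_pos k); pose proof (lt_0_INR (S k) ltac:(lia)).
field; split; intros E; apply RtoC_inj in E; lra.
Qed.

(** A radius strictly above 1 makes the power series differentiable at [t = 1] as well. The ratio
    [p = 2 / (1 + |q|)] satisfies [1 < p] and [p |q| < 1]. The sequence [a] stands for the real or
    the imaginary parts. *)
Lemma binom_coef_CV (d q : C) : Cmod q < 1 -> exists r, 1 < r /\
  (forall a : nat -> R, (forall k, Rabs (a k) <= Cmod (binom_coef d q k)) ->
     Rbar_le r (CV_radius a)).
Proof.
intros Hq; pose proof (Cmod_ge_0 q) as Pq; set (p := 2 / (1 + Cmod q)).
assert (Hp : 1 < p) by (unfold p; apply Rlt_div_r; lra).
assert (Hpq : p * Cmod q < 1).
{ unfold p; replace (2 / (1 + Cmod q) * Cmod q) with (2 * Cmod q / (1 + Cmod q)) by (field; lra).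
  apply Rlt_div_l; lra. }
exists p; split; [exact Hp|]; intros a Ha.
apply (CV_radius_bounded a).
set (r := (1 + p * Cmod q) / 2).
assert (Pr : 0 <= p * Cmod q) by nra.
exists (Rpower (1 - r) (- Cmod d)); intros k.
rewrite Rabs_mult, (Rabs_pos_eq (p ^ k)) by (apply pow_le; lra).
eapply Rle_trans; [apply Rmult_le_compat_r; [apply pow_le; lra|]; eapply Rle_trans; [apply Ha|];
  apply (binom_coef_bound d q r k); unfold r; lra|].
rewrite Rmult_assoc, <- Rpow_mult_distr.
rewrite <- (Rmult_1_r (Rpower _ _)) at 2; apply Rmult_le_compat_l; [left; apply exp_pos|].
assert (0 < r) by (unfold r; lra).
assert (0 <= Cmod q / r * p <= 1).
{ replace (Cmod q / r * p) with (p * Cmod q / r) by (field; lra); split.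
  - apply Rmult_le_pos; [lra | left; now apply Rinv_0_lt_compat].
  - apply Rle_div_l; unfold r; lra. }
rewrite <- (pow1 k); apply pow_incr; lra.
Qed.

(* [B t = sum (d)_k / k! (q t)^k] satisfies [(1 - q t) B' = d q B]. *)
Lemma binomial_series (d q : C) : Cmod q < 1 -> CSeries (binom_coef d q) = Cpower (1 - q) (- d).
Proof.
intros Hq; destruct (binom_coef_CV d q Hq) as (r & Hr & HCV).
set (ar := fun k => Re (binom_coef d q k)); set (ai := fun k => Im (binom_coef d q k)).
assert (Vr : forall t, 0 <= t <= 1 -> Rbar_lt (Rabs t) (CV_radius ar)).
{ intros t Ht; rewrite Rabs_pos_eq by lra.
  eapply Rbar_lt_le_trans; [|exact (HCV ar (fun k => re_le_Cmod _))]; cbn; lra. }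
assert (Vi : forall t, 0 <= t <= 1 -> Rbar_lt (Rabs t) (CV_radius ai)).
{ intros t Ht; rewrite Rabs_pos_eq by lra.
  eapply Rbar_lt_le_trans; [|exact (HCV ai (fun k => im_le_Cmod _))]; cbn; lra. }
assert (EX : forall a t, Rbar_lt (Rabs t) (CV_radius a) -> is_series (fun k => a k * t ^ k) (PSeries a t)).
{ intros a t Ht; apply Series_correct, ex_series_Rabs, CV_disk_inside, Ht. }
set (B := fun t => ((PSeries ar t, PSeries ai t) : C)).
set (Bd := fun t => ((PSeries (PS_derive ar) t, PSeries (PS_derive ai) t) : C)).
assert (SB : forall t, 0 <= t <= 1 -> is_CS (fun k => binom_coef d q k * RtoC (t ^ k))%C (B t)).
{ intros t Ht; split.
  - apply (is_series_ext (fun k => ar k * t ^ k)); [intros k; now rewrite Re_multR|].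
    apply EX, Vr, Ht.
  - apply (is_series_ext (fun k => ai k * t ^ k)); [intros k; now rewrite Im_multR|].
    apply EX, Vi, Ht. }
assert (SBd : forall t, 0 <= t <= 1 ->
  is_CS (fun k => RtoC (INR (S k)) * binom_coef d q (S k) * RtoC (t ^ k))%C (Bd t)).
{ intros t Ht; split.
  - apply (is_series_ext (fun k => PS_derive ar k * t ^ k));
      [intros k; now rewrite Re_multR, Re_Rmult|].
    apply EX; rewrite CV_radius_derive; apply Vr, Ht.
  - apply (is_series_ext (fun k => PS_derive ai k * t ^ k));
      [intros k; now rewrite Im_multR, Im_Rmult|].
    apply EX; rewrite CV_radius_derive; apply Vi, Ht. }
assert (DB : forall t, 0 <= t <= 1 -> derC B t (Bd t)).
{ intros t Ht; split; [exact (is_derive_PSeries ar t (Vr t Ht)) | exact (is_derive_PSeries ai t (Vi t Ht))]. }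
(* Summed form of [(k + 1) b_(k+1) = q (d + k) b_k]; the part with the factor [k] is the series of
   [t B'], whose term at [k = 0] vanishes. *)
assert (ODE : forall t, 0 <= t <= 1 -> Bd t = (q * d * B t + q * (RtoC t * Bd t))%C).
{ intros t Ht.
  assert (S1 : is_CS (fun k => RtoC (INR k) * binom_coef d q k * RtoC (t ^ k))%C (RtoC t * Bd t)%C).
  { replace (RtoC t * Bd t)%C
      with ((RtoC (INR 0) * binom_coef d q 0 * RtoC (t ^ 0)) + RtoC t * Bd t)%C by (cbn [INR]; ring).
    apply (is_CS_shift (fun k => RtoC (INR k) * binom_coef d q k * RtoC (t ^ k))%C).
    eapply is_CS_ext; [|apply (is_CS_scal (RtoC t)), (SBd t Ht)]; intros k; cbv beta.
    change (t ^ S k) with (t * t ^ k); rewrite (RtoC_mult t); ring. }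
  pose proof (is_CS_plus _ _ _ _ (is_CS_scal (q * d) _ _ (SB t Ht)) (is_CS_scal q _ _ S1)) as S2.
  rewrite <- (is_CS_eq _ _ S2); symmetry; rewrite <- (is_CS_eq _ _ (SBd t Ht)).
  apply CSeries_ext; intros k; rewrite binom_coef_succ; ring. }
assert (B0 : B 0 = 1%C).
{ rewrite <- (is_CS_eq _ _ (SB 0 ltac:(lra))).
  transitivity (binom_coef d q 0 * RtoC (0 ^ 0) + 0 * Bd 0)%C.
  - apply is_CS_eq, (is_CS_shift (fun k => binom_coef d q k * RtoC (0 ^ k))%C).
    eapply is_CS_ext; [|apply (is_CS_scal 0%C), (SBd 0 ltac:(lra))]; intros k; cbv beta.
    rewrite (pow_i (S k)) by lia; ring.
  - unfold binom_coef; cbn [Cpoch fact pow INR]; unfold Cpow.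
    replace (/ 1)%C with (RtoC 1) by (rewrite <- RtoC_inv by lra; f_equal; field); ring. }
assert (Pos : forall t, 0 <= t <= 1 -> 0 < Re (1 - RtoC t * q)).
{ intros t Ht; rewrite Re_minus, Re_Rmult, Re_R.
  pose proof (re_le_Cmod q) as Hqr; apply Rabs_le_between in Hqr; nra. }
(* The integrating factor is [(1 - q t)^d] with the principal logarithm, which is differentiable
   along the segment because [1 - q t] keeps a positive real part. *)
assert (K : (B 0 * Cexp (d * Clog (1 - RtoC 0 * q)) = B 1 * Cexp (d * Clog (1 - RtoC 1 * q)))%C).
{ apply (derC_zero_const (fun t => B t * Cexp (d * Clog (1 - RtoC t * q)))%C); [lra|].
  intros t Ht; eapply derC_eq.
  - apply (derC_mult B); [apply DB, Ht|].
    apply derC_Cexp, derC_scal, derC_Clog; [|apply Pos, Ht].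
    apply (derC_minus (fun _ => 1%C) (fun t => RtoC t * q)%C); [apply derC_const|].
    apply (derC_mult RtoC (fun _ => q)); [apply derC_id | apply derC_const].
  - cbv beta; set (E := Cexp _).
    assert (N : (1 - RtoC t * q)%C <> 0%C) by (apply RtoC_neq_0, Pos, Ht).
    assert (O : (Bd t * (1 - RtoC t * q) = q * d * B t)%C).
    { transitivity (Bd t - q * (RtoC t * Bd t))%C; [ring|]; rewrite (ODE t Ht) at 1; ring. }
    transitivity ((Bd t * (1 - RtoC t * q) - q * d * B t) * E / (1 - RtoC t * q))%C; [field; exact N|].
    rewrite O; field; exact N. }
rewrite B0, Cmult_0_l, !Cmult_1_l in K.
replace (1 - 0)%C with (RtoC 1) in K by ring.
rewrite Clog_pos, ln_1, Cmult_0_r, Cexp_0 in K by lra.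
assert (EB : CSeries (binom_coef d q) = B 1).
{ rewrite <- (is_CS_eq _ _ (SB 1 ltac:(lra))); apply CSeries_ext; intros k.
  rewrite pow1; ring. }
rewrite EB; unfold Cpower.
replace (- d * Clog (1 - q))%C with (- (d * Clog (1 - q)))%C by ring.
rewrite Cexp_opp.
transitivity (B 1 * Cexp (d * Clog (1 - q)) * / Cexp (d * Clog (1 - q)))%C.
- field; apply Cexp_neq_0.
- rewrite <- K; ring.
Qed.

(** * Termwise differentiation *)

(** Termwise Taylor bounds [2 m_k h^2] add up to a quadratic remainder for the sum, for which the
    second derivatives need a summable majorant; the constant 4 includes the factor 2 of
    [CSeries_bound]. *)
Lemma derC_CSeries (f f1 f2 : nat -> R -> C) (m : nat -> R) (x r : R) : 0 < r ->
  (forall k y, Rabs (y - x) < r -> derC (f k) y (f1 k y)) ->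
  (forall k y, Rabs (y - x) < r -> derC (f1 k) y (f2 k y)) ->
  (forall k y, Rabs (y - x) < r -> Cmod (f k y) <= m k) ->
  (forall k y, Rabs (y - x) < r -> Cmod (f1 k y) <= m k) ->
  (forall k y, Rabs (y - x) < r -> Cmod (f2 k y) <= m k) -> ex_series m ->
  derC (fun y => CSeries (fun k => f k y)) x (CSeries (fun k => f1 k x)).
Proof.
intros Hr D1 D2 B0 B1 B2 Sm.
apply (derC_quad _ x _ (4 * Series m) r Hr); intros h Hh.
assert (Hx : Rabs (x - x) < r) by (rewrite Rminus_eq_0, Rabs_R0; exact Hr).
assert (Hxh : Rabs (x + h - x) < r) by (replace (x + h - x) with h by ring; exact Hh).
pose proof (is_CS_dom _ m (fun k => B0 k _ Hxh) Sm) as S1.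
pose proof (is_CS_dom _ m (fun k => B0 k _ Hx) Sm) as S2.
pose proof (is_CS_dom _ m (fun k => B1 k _ Hx) Sm) as S3.
pose proof (is_CS_plus _ _ _ _ (is_CS_plus _ _ _ _ S1 (is_CS_scal (-1)%C _ _ S2))
  (is_CS_scal (- RtoC h)%C _ _ S3)) as S4.
apply is_CS_eq in S4.
replace (CSeries (fun k => f k (x + h)%R) - CSeries (fun k => f k x)
   - RtoC h * CSeries (fun k => f1 k x))%C
  with (CSeries (fun k => f k (x + h)%R) + -1 * CSeries (fun k => f k x)
   + - RtoC h * CSeries (fun k => f1 k x))%C by ring.
rewrite <- S4.
replace (4 * Series m * h ^ 2) with (2 * (2 * h ^ 2 * Series m)) by ring.
rewrite <- Series_scal_l; apply CSeries_bound.
- intros k.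
  replace (f k (x + h)%R + -1 * f k x + - RtoC h * f1 k x)%C
    with (f k (x + h)%R - f k x - RtoC h * f1 k x)%C by ring.
  replace (2 * h ^ 2 * m k) with (2 * m k * h ^ 2) by ring.
  assert (I : forall y, Rmin x (x + h) <= y <= Rmax x (x + h) -> Rabs (y - x) < r).
  { intros y Hy; eapply Rle_lt_trans; [|exact Hh].
    revert Hy; unfold Rmin, Rmax; destruct Rle_dec; intros Hy;
      [rewrite !Rabs_pos_eq by lra | rewrite !Rabs_left1 by lra]; lra. }
  apply (taylor2_C (f k) (f1 k) (f2 k)); auto.
- apply (ex_series_scal (K := R_AbsRing) (V := R_NormedModule)), Sm.
Qed.

(** The [n]-th derivative of [x^(-a)]. *)
Definition neg_power_derive (n : nat) (a : C) (x : R) : C :=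
  ((-1) ^ n * Cpoch a n * Rcpower x (- a - RtoC (INR n)))%C.

Lemma derC_neg_power_derive (n : nat) (a : C) (x : R) : 0 < x -> derC (neg_power_derive n a) x (neg_power_derive (S n) a x).
Proof.
intros Hx; eapply derC_eq.
- apply (derC_scal ((-1) ^ n * Cpoch a n)%C (fun v => Rcpower v (- a - RtoC (INR n)))), derC_Rcpower, Hx.
- unfold neg_power_derive; rewrite S_INR, RtoC_plus, Cpow_S; cbn [Cpoch].
  replace (- a - (RtoC (INR n) + 1))%C with (- a - RtoC (INR n) - 1)%C by ring; ring.
Qed.

(** The growth of [(a)_n] in [a] is absorbed by [x^(-Re a)], which makes [r] uniform over the whole
    sector. There [|a| <= g Re a], and [y = x0^(-1/g)] is chosen so that [Rpoch_bound] at [1 - y]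
    gives [|(a)_n| (1 - y)^n <= n! x0^(Re a)]. Since [1 < x0], one has [y < 1]. *)
Lemma neg_power_derive_bound (kap x0 : R) : 0 <= kap -> 1 < x0 -> exists r, 1 <= r /\
  forall n a x, cone kap a -> x0 <= x -> Cmod (neg_power_derive n a x) <= INR (fact n) * r ^ n.
Proof.
intros Hk Hx0; set (g := 1 + kap); set (y := Rpower x0 (- / g)).
assert (Py : 0 < y) by apply exp_pos.
assert (Pg : 0 < / g) by (apply Rinv_0_lt_compat; unfold g; lra).
assert (Pl : 0 < ln x0) by (rewrite <- ln_1; apply ln_increasing; lra).
assert (Hy : y < 1).
{ unfold y, Rpower; rewrite <- exp_0; apply exp_increasing; nra. }
exists (/ (1 - y)); split.
{ rewrite <- Rinv_1; apply Rinv_le_contravar; lra. }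
intros n a x [Ha Ka] Hx.
assert (Ca : Cmod a <= g * Re a).
{ eapply Rle_trans; [apply Cmod_le_sum|]; rewrite (Rabs_pos_eq (Re a)) by lra; unfold g; lra. }
pose proof (Cmod_Cpoch a _ n Ca) as H1.
pose proof (Rpoch_bound n (g * Re a) (1 - y) ltac:(unfold g; nra) ltac:(lra)) as H2.
replace (1 - (1 - y)) with y in H2 by ring.
assert (E : Rpower y (- (g * Re a)) = Rpower x0 (Re a)).
{ unfold y; rewrite Rpower_mult; f_equal; field; unfold g; lra. }
rewrite E in H2.
unfold neg_power_derive; rewrite !Cmod_mult, Cmod_pow, Cmod_Rcpower.
replace (Cmod (-1)) with 1 by (rewrite Cmod_R, Rabs_left; lra).
rewrite pow1, Rmult_1_l, Re_minus, Re_opp, Re_R.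
assert (P : 0 < (1 - y) ^ n) by (apply pow_lt; lra).
rewrite pow_inv.
apply (Rmult_le_reg_r ((1 - y) ^ n)); [exact P|].
replace (INR (fact n) * / (1 - y) ^ n * (1 - y) ^ n) with (INR (fact n)) by (field; lra).
pose proof (INR_fact_pos n) as Pf.
assert (Q : Rpower x0 (Re a) * Rpower x (- Re a - INR n) <= 1).
{ unfold Rpower; rewrite <- exp_plus.
  apply Rle_trans with (exp 0); [apply exp_le | rewrite exp_0; lra].
  assert (ln x0 <= ln x).
  { destruct Hx as [Hx| ->]; [left; apply ln_increasing; lra | lra]. }
  pose proof (pos_INR n); nra. }
assert (Pp : 0 < Rpower x (- Re a - INR n)) by apply exp_pos.
apply Rle_trans with (INR (fact n) * Rpower x0 (Re a) * Rpower x (- Re a - INR n)).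
- replace (Cmod (Cpoch a n) * Rpower x (- Re a - INR n) * (1 - y) ^ n)
    with (Cmod (Cpoch a n) * (1 - y) ^ n * Rpower x (- Re a - INR n)) by ring.
  apply Rmult_le_compat_r; [lra|]; nra.
- rewrite Rmult_assoc, <- Rmult_1_r; apply Rmult_le_compat_l; lra.
Qed.

(** * An identity theorem *)

(** The bound of a binomial coefficient by [2^N], in factorial form; the induction is Pascal's
    rule. *)
Lemma fact_add_le (N : nat) : forall n m, (n + m = N)%nat ->
  INR (fact N) <= INR (fact n) * INR (fact m) * 2 ^ N.
Proof.
induction N as [|N IH]; intros n m E.
- replace n with 0%nat by lia; replace m with 0%nat by lia; cbn; lra.
- assert (P : 1 <= 2 ^ S N) by (apply pow_R1_Rle; lra).
  destruct n as [|n]; [replace m with (S N) by lia; pose proof (INR_fact_pos (S N)); cbn [fact INR] in *; nra|].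
  destruct m as [|m]; [replace (S n) with (S N) by lia; pose proof (INR_fact_pos (S N)); cbn [fact INR] in *; nra|].
  pose proof (IH n (S m) ltac:(lia)) as H1; pose proof (IH (S n) m ltac:(lia)) as H2.
  assert (EN : INR (S N) = INR (S n) + INR (S m)) by (rewrite <- plus_INR; f_equal; lia).
  rewrite fact_simpl, mult_INR, EN.
  pose proof (pos_INR (S n)); pose proof (pos_INR (S m)).
  apply Rle_trans with (INR (S n) * (INR (fact n) * INR (fact (S m)) * 2 ^ N)
    + INR (S m) * (INR (fact (S n)) * INR (fact m) * 2 ^ N)).
  + rewrite Rmult_plus_distr_r; apply Rplus_le_compat; apply Rmult_le_compat_l; assumption.
  + rewrite (fact_simpl n), (fact_simpl m), !mult_INR; cbn [pow]; right; ring.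
Qed.

(** Both [K (c - y)^(m+1) / (m+1)! + g y] and the same with [- g y] are nonincreasing and vanish at
    [c], so they are nonnegative at [x]. *)
Lemma primitive_bound (g g1 : R -> R) (x c K : R) (m : nat) : x <= c ->
  (forall y, x <= y <= c -> is_derive g y (g1 y)) ->
  (forall y, x <= y <= c -> Rabs (g1 y) <= K * ((c - y) ^ m / INR (fact m))) -> g c = 0 ->
  Rabs (g x) <= K * ((c - x) ^ S m / INR (fact (S m))).
Proof.
intros Hxc Hg Hb Hc.
assert (S : forall e, (e = 1 \/ e = -1) -> 0 <= K * ((c - x) ^ S m / INR (fact (S m))) + e * g x).
{ intros e He.
  set (phi := fun y => K * ((c - y) ^ S m / INR (fact (S m))) + e * g y).
  set (dphi := fun y => - (K * ((c - y) ^ m / INR (fact m))) + e * g1 y).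
  destruct (MVT_gen phi x c dphi) as (z & Hz & Ez).
  - intros y Hy; rewrite Rmin_left, Rmax_right in Hy by lra.
    apply (is_derive_plus (K := R_AbsRing) (V := R_NormedModule)); [|apply is_derive_scal, Hg; lra].
    replace (- (K * ((c - y) ^ m / INR (fact m))))
      with (K * (INR (S m) * (-1) * (c - y) ^ m * / INR (fact (S m)))).
    + apply is_derive_scal.
      apply (is_derive_ext (fun y => / INR (fact (S m)) * (c - y) ^ S m)); [intros; cbv beta; unfold Rdiv; apply Rmult_comm|].
      rewrite Rmult_comm; apply is_derive_scal.
      apply (is_derive_pow (fun y => c - y) (S m)); auto_derive; [trivial | ring].
    + rewrite fact_simpl, mult_INR.
      pose proof (INR_fact_pos m); pose proof (lt_0_INR (S m) ltac:(lia)); field; lra.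
  - intros y Hy; rewrite Rmin_left, Rmax_right in Hy by lra; apply continuity_pt_filterlim.
    apply (continuous_plus (V := R_NormedModule)).
    + apply (ex_derive_continuous (K := R_AbsRing) (V := R_NormedModule)); auto_derive; trivial.
    + apply (continuous_mult (K := R_AbsRing)); [apply continuous_const|].
      apply (ex_derive_continuous (K := R_AbsRing) (V := R_NormedModule)); eexists; apply Hg; lra.
  - rewrite Rmin_left, Rmax_right in Hz by lra.
    specialize (Hb z Hz); apply Rabs_le_between in Hb.
    assert (dphi z <= 0) by (unfold dphi; destruct He as [-> | ->]; lra).
    assert (Ec : phi c = 0).
    { unfold phi; rewrite Hc, Rminus_eq_0, pow_i by lia; unfold Rdiv; ring. }
    change (0 <= phi x); nra. }
pose proof (S 1 (or_introl eq_refl)); pose proof (S (-1) (or_intror eq_refl)).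
apply Rabs_le; lra.
Qed.

(** All derivatives vanish at [c], so iterating [primitive_bound] leaves only the Taylor remainder,
    at most [A (2 r (c - x))^m] for every [m]. The step length [/ (4 r)] makes the base at most
    1/2. *)
Lemma identity_step (g : nat -> R -> R) (a b M r c : R) : 0 <= M -> 1 <= r -> a < c < b ->
  (forall n x, a < x < b -> is_derive (g n) x (g (S n) x)) ->
  (forall n x, a < x < b -> Rabs (g n x) <= M * (INR (fact n) * r ^ n)) ->
  (forall n, g n c = 0) ->
  forall n x, a < x <= c -> c - x <= / (4 * r) -> g n x = 0.
Proof.
intros HM Hr Hc D B Z.
assert (T : forall m n x, a < x <= c ->
  Rabs (g n x) <= M * (INR (fact (n + m)) * r ^ (n + m)) * ((c - x) ^ m / INR (fact m))).
{ induction m as [|m IH]; intros n x Hx.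
  - rewrite Nat.add_0_r; cbn [pow fact INR].
    eapply Rle_trans; [apply B; lra | right; field].
  - apply (primitive_bound (g n) (g (S n))); [lra | | | apply Z].
    + intros y Hy; apply D; lra.
    + intros y Hy; replace (n + S m)%nat with (S n + m)%nat by lia; apply IH; lra. }
intros n x Hx Hd.
set (A := M * INR (fact n) * (2 * r) ^ n).
assert (PA : 0 <= A).
{ apply Rmult_le_pos; [apply Rmult_le_pos; [exact HM | apply pos_INR] | apply pow_le; lra]. }
assert (G : forall m, Rabs (g n x) <= A * (/ 2) ^ m).
{ intros m; eapply Rle_trans; [apply (T m n x Hx)|].
  pose proof (fact_add_le (n + m) n m eq_refl) as F.
  pose proof (INR_fact_pos m) as Pm; pose proof (INR_fact_pos n) as Pn.
  assert (Pd : 0 <= (c - x) ^ m / INR (fact m)).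
  { apply Rmult_le_pos; [apply pow_le; lra | left; now apply Rinv_0_lt_compat]. }
  apply Rle_trans with (M * (INR (fact n) * INR (fact m) * 2 ^ (n + m) * r ^ (n + m))
    * ((c - x) ^ m / INR (fact m))).
  - apply Rmult_le_compat_r; [exact Pd|]; apply Rmult_le_compat_l; [exact HM|].
    apply Rmult_le_compat_r; [apply pow_le; lra | exact F].
  - rewrite !pow_add.
    replace (M * (INR (fact n) * INR (fact m) * (2 ^ n * 2 ^ m) * (r ^ n * r ^ m))
      * ((c - x) ^ m / INR (fact m)))
     with (A * (2 * r * (c - x)) ^ m)
     by (unfold A; rewrite !Rpow_mult_distr; field; lra).
    apply Rmult_le_compat_l; [exact PA|]; apply pow_incr; split; [nra|].
    apply (Rmult_le_compat_l (2 * r)) in Hd; [|lra].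
    replace (2 * r * / (4 * r)) with (/ 2) in Hd by (field; lra); exact Hd. }
apply Rabs_eq_0; apply Rle_antisym; [|apply Rabs_pos].
apply Rnot_lt_le; intros Hlt.
destruct (pow_lt_1_zero (/ 2) ltac:(rewrite Rabs_pos_eq; lra) (Rabs (g n x) / (A + 1))) as [N HN].
{ apply Rdiv_lt_0_compat; lra. }
specialize (HN N (le_n N)); specialize (G N).
rewrite Rabs_pos_eq in HN by (apply pow_le; lra).
apply Rlt_div_r in HN; [|lra].
assert (0 < (/ 2) ^ N) by (apply pow_lt; lra); nra.
Qed.

(** All derivatives vanish on the right-hand piece. From its midpoint [c] the zero set is extended
    leftwards by steps of length [e], fixed because [r] is uniform, so finitely many steps reach any
    [x]. *)
Lemma identity_R (g : nat -> R -> R) (a b b' M r : R) : 0 <= M -> 1 <= r -> a < b' < b ->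
  (forall n x, a < x < b -> is_derive (g n) x (g (S n) x)) ->
  (forall n x, a < x < b -> Rabs (g n x) <= M * (INR (fact n) * r ^ n)) ->
  (forall x, b' < x < b -> g 0%nat x = 0) ->
  forall x, a < x < b -> g 0%nat x = 0.
Proof.
intros HM Hr Hb D B Z.
assert (Zn : forall n x, b' < x < b -> g n x = 0).
{ induction n as [|n IH]; [exact Z|]; intros x Hx.
  rewrite <- (is_derive_unique _ _ _ (D n x ltac:(lra))).
  apply is_derive_unique, (is_derive_ext_loc (fun _ => 0)).
  - assert (Hd : 0 < Rmin (x - b') (b - x)) by (apply Rmin_glb_lt; lra).
    exists (mkposreal _ Hd); intros y Hy; symmetry; apply IH.
    change (Rabs (y - x) < Rmin (x - b') (b - x)) in Hy.
    pose proof (Rmin_l (x - b') (b - x)); pose proof (Rmin_r (x - b') (b - x)).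
    apply Rabs_def2 in Hy; lra.
  - exact (is_derive_const (K := R_AbsRing) (V := R_NormedModule) 0 x). }
set (c := (b' + b) / 2); set (e := / (4 * r)).
assert (Pe : 0 < e) by (apply Rinv_0_lt_compat; lra).
assert (J : forall j n x, a < x <= c -> c - x <= INR j * e -> g n x = 0).
{ induction j as [|j IH]; intros n x Hx Hj.
  - cbn [INR] in Hj; apply Zn; unfold c in *; lra.
  - rewrite S_INR in Hj.
    destruct (Rle_dec (c - x) (INR j * e)) as [Hl|Hl]; [now apply IH|].
    (* The new centre lies at most [e] to the right of [x] and is already covered by the first [j]
       steps. *)
    apply (identity_step g a b M r (Rmin c (x + e))); auto.
    + split; [apply Rmin_glb_lt; unfold c; lra|].
      eapply Rle_lt_trans; [apply Rmin_l | unfold c; lra].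
    + intros k; apply IH.
      * split; [apply Rmin_glb_lt; lra | apply Rmin_l].
      * unfold Rmin; destruct Rle_dec; [|lra].
        pose proof (pos_INR j); nra.
    + split; [lra | apply Rmin_glb; lra].
    + fold e; pose proof (Rmin_r c (x + e)); lra. }
intros x Hx; destruct (Rle_dec x c) as [Hl|Hl].
- destruct (INR_unbounded ((c - x) / e)) as [j Hj].
  apply (J j); [lra|]; apply Rlt_div_l in Hj; lra.
- apply Z; unfold c in *; lra.
Qed.

(** [F] lists the successive derivatives. The constants [M] and [r] serve the whole interval, which
    gives continuation a fixed step length. *)
Definition analytic_on (f : R -> C) (a b : R) : Prop :=
  exists (F : nat -> R -> C) (M r : R), 0 <= M /\ 1 <= r /\
  (forall x, a < x < b -> F 0%nat x = f x) /\
  (forall n x, a < x < b -> derC (F n) x (F (S n) x)) /\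
  (forall n x, a < x < b -> Cmod (F n x) <= M * (INR (fact n) * r ^ n)).

Lemma analytic_on_identity (f : R -> C) (a b b' : R) : analytic_on f a b -> a < b' < b ->
  (forall x, b' < x < b -> f x = 0%C) -> forall x, a < x < b -> f x = 0%C.
Proof.
intros (F & M & r & HM & Hr & E & D & B) Hb Z x Hx.
rewrite <- E by exact Hx; apply C_eq.
- apply (identity_R (fun n x => Re (F n x)) a b b' M r); auto.
  + intros n y Hy; apply (D n y Hy).
  + intros n y Hy; exact (Rle_trans _ _ _ (re_le_Cmod _) (B n y Hy)).
  + intros y Hy; rewrite E, Z by lra; reflexivity.
- apply (identity_R (fun n x => Im (F n x)) a b b' M r); auto.
  + intros n y Hy; apply (D n y Hy).
  + intros n y Hy; exact (Rle_trans _ _ _ (im_le_Cmod _) (B n y Hy)).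
  + intros y Hy; rewrite E, Z by lra; reflexivity.
Qed.

Lemma analytic_on_scal (c : C) (f : R -> C) (a b : R) : analytic_on f a b -> analytic_on (fun x => c * f x)%C a b.
Proof.
intros (F & M & r & HM & Hr & E & D & B).
exists (fun n x => c * F n x)%C, (Cmod c * M), r; pose proof (Cmod_ge_0 c).
split; [nra|]; split; [exact Hr|]; split; [|split].
- intros x Hx; now rewrite E.
- intros n x Hx; apply derC_scal; auto.
- intros n x Hx; rewrite Cmod_mult, Rmult_assoc; apply Rmult_le_compat_l; auto.
Qed.

Lemma analytic_on_minus (f g : R -> C) (a b : R) : analytic_on f a b -> analytic_on g a b -> analytic_on (fun x => f x - g x)%C a b.
Proof.
intros (F & M & r & HM & Hr & E & D & B) (G & M' & r' & HM' & Hr' & E' & D' & B').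
exists (fun n x => F n x - G n x)%C, (M + M'), (Rmax r r').
split; [lra|]; split; [eapply Rle_trans; [exact Hr | apply Rmax_l]|]; split; [|split].
- intros x Hx; now rewrite E, E'.
- intros n x Hx; apply derC_minus; auto.
- intros n x Hx; eapply Rle_trans; [apply Cmod_triangle|]; rewrite Cmod_opp.
  rewrite Rmult_plus_distr_r; apply Rplus_le_compat.
  + eapply Rle_trans; [apply B, Hx|]; apply Rmult_le_compat_l; [exact HM|].
    apply Rmult_le_compat_l; [apply pos_INR|]; apply pow_incr; split; [lra | apply Rmax_l].
  + eapply Rle_trans; [apply B', Hx|]; apply Rmult_le_compat_l; [exact HM'|].
    apply Rmult_le_compat_l; [apply pos_INR|]; apply pow_incr; split; [lra | apply Rmax_r].
Qed.

(** Leibniz's rule has just two terms here, [(x - e) f^(n) + n f^(n-1)]. At [n = 0] the default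
    [pred 0 = 0] is harmless because of the factor [INR 0]. *)
Lemma analytic_on_linear (e : R) (f : R -> C) (a b : R) : analytic_on f a b -> analytic_on (fun x => RtoC (x - e) * f x)%C a b.
Proof.
intros (F & M & r & HM & Hr & E & D & B).
set (K := Rabs a + Rabs b + Rabs e).
exists (fun n x => RtoC (x - e) * F n x + RtoC (INR n) * F (pred n) x)%C, ((K + 1) * M), r.
assert (PK : 0 <= K) by (unfold K; pose proof (Rabs_pos a); pose proof (Rabs_pos b); pose proof (Rabs_pos e); lra).
split; [nra|]; split; [exact Hr|]; split; [|split].
- intros x Hx; cbn [INR]; rewrite E by exact Hx; ring.
- intros n x Hx.
  assert (DL : derC (fun x => RtoC (x - e)) x 1%C).
  { apply (derC_R (fun x => x - e)); auto_derive; [trivial | ring]. }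
  assert (DR : derC (fun x => RtoC (INR n) * F (pred n) x)%C x (RtoC (INR n) * F n x)%C).
  { destruct n as [|n]; [|apply (derC_scal (RtoC (INR (S n))) (F n)), D, Hx].
    apply (derC_ext (fun _ => 0%C)); [intros t; cbn [INR]; ring|].
    replace (RtoC (INR 0) * F 0%nat x)%C with (RtoC 0) by (cbn [INR]; ring); apply derC_const. }
  eapply derC_eq.
  + apply derC_plus; [apply (derC_mult _ (F n)); [exact DL | apply D, Hx] | exact DR].
  + rewrite S_INR, RtoC_plus; cbn [pred]; ring.
- intros n x Hx; eapply Rle_trans; [apply Cmod_triangle|].
  rewrite !Cmod_mult, !Cmod_R, (Rabs_pos_eq (INR n)) by apply pos_INR.
  assert (Hxe : Rabs (x - e) <= K).
  { unfold K; apply Rabs_le; pose proof (Rle_abs b); pose proof (Rle_abs (- a)).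
    pose proof (Rle_abs e); pose proof (Rle_abs (- e)); pose proof (Rabs_pos a); pose proof (Rabs_pos b).
    rewrite Rabs_Ropp in *; lra. }
  replace ((K + 1) * M * (INR (fact n) * r ^ n))
    with (K * (M * (INR (fact n) * r ^ n)) + M * (INR (fact n) * r ^ n)) by ring.
  apply Rplus_le_compat.
  + apply Rmult_le_compat; auto using Rabs_pos, Cmod_ge_0.
  + destruct n as [|n]; cbn [pred].
    * cbn [INR fact pow]; rewrite Rmult_0_l; lra.
    * eapply Rle_trans; [apply Rmult_le_compat_l; [apply pos_INR | apply B, Hx]|].
      rewrite fact_simpl, mult_INR; cbn [pow].
      replace (INR (S n) * (M * (INR (fact n) * r ^ n))) with (M * (INR (S n) * INR (fact n) * r ^ n)) by ring.
      apply Rmult_le_compat_l; [exact HM|]; apply Rmult_le_compat_l.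
      -- apply Rmult_le_pos; apply pos_INR.
      -- rewrite <- (Rmult_1_l (r ^ n)) at 1; apply Rmult_le_compat_r; [apply pow_le; lra | exact Hr].
Qed.

(** The expansion of [x^(-t) (1 - q x^(-s))^(-d)]. With [q = l z^(-s)] it is the transform at [x z]
    up to the factor [z^(-t)]. *)
Definition binom_ray (s t d q : C) (x : R) : C := CSeries (fun k => binom_coef d q k * Rcpower x (- prab_exponent s t k))%C.

Lemma analytic_on_binom_ray (s t d q : C) (a b : R) : 0 < Re s -> 0 < Re t -> Cmod q < 1 -> 1 < a ->
  analytic_on (binom_ray s t d q) a b.
Proof.
intros Hs Ht Hq Ha; destruct (exists_cone s t Hs Ht) as (kap & Cs & Ct).
assert (Hk : 0 <= kap).
{ destruct Cs as [P K]; pose proof (Rabs_pos (Im s)); apply Rnot_lt_le; intros Hn; nra. }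
destruct (neg_power_derive_bound kap a Hk Ha) as (r & Hr & HB).
destruct (binom_coef_summable d q Hq) as (m & Hm & Sm).
assert (Pm : forall k, 0 <= m k) by (intros k; exact (Rle_trans _ _ _ (Cmod_ge_0 _) (Hm k))).
assert (BB : forall n k x, a <= x ->
  Cmod (binom_coef d q k * neg_power_derive n (prab_exponent s t k) x) <= INR (fact n) * r ^ n * m k).
{ intros n k x Hx; rewrite Cmod_mult, Rmult_comm.
  apply Rmult_le_compat; [apply Cmod_ge_0 | apply Cmod_ge_0 | | apply Hm].
  apply HB; [now apply cone_prab_exponent | exact Hx]. }
assert (SS : forall c, ex_series (fun k => c * m k))
  by (intros c; apply (ex_series_scal (K := R_AbsRing) (V := R_NormedModule)), Sm).
exists (fun n x => CSeries (fun k => binom_coef d q k * neg_power_derive n (prab_exponent s t k) x)%C), (2 * Series m), r.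
assert (P0 : 0 <= Series m) by (now apply Series_nonneg).
split; [lra|]; split; [exact Hr|]; split; [|split].
- intros x Hx; apply CSeries_ext; intros k; unfold neg_power_derive; cbn [Cpoch INR Cpow].
  f_equal; rewrite Cmult_1_l, Cmult_1_l; f_equal; ring.
- intros n x Hx.
  set (c := fun n => INR (fact n) * r ^ n).
  assert (Pc : forall n, 0 <= c n)
    by (intros i; apply Rmult_le_pos; [apply pos_INR | apply pow_le; lra]).
  assert (Dq : forall n k y, Rabs (y - x) < x - a ->
    derC (fun y => binom_coef d q k * neg_power_derive n (prab_exponent s t k) y)%C y (binom_coef d q k * neg_power_derive (S n) (prab_exponent s t k) y)%C).
  { intros i k y Hy; apply derC_scal, derC_neg_power_derive; apply Rabs_def2 in Hy; lra. }
  (* One majorant for the three consecutive orders that termwise differentiation compares. *)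
  assert (Bq : forall i k y, (i = n \/ i = S n \/ i = S (S n)) -> Rabs (y - x) < x - a ->
    Cmod (binom_coef d q k * neg_power_derive i (prab_exponent s t k) y) <= (c n + c (S n) + c (S (S n))) * m k).
  { intros i k y Hi Hy; eapply Rle_trans; [apply BB; apply Rabs_def2 in Hy; lra|].
    apply Rmult_le_compat_r; [apply Pm|]; fold (c i).
    pose proof (Pc n); pose proof (Pc (S n)); pose proof (Pc (S (S n))).
    destruct Hi as [-> | [-> | ->]]; lra. }
  assert (Hxa : 0 < x - a) by lra.
  exact (derC_CSeries (fun k y => binom_coef d q k * neg_power_derive n (prab_exponent s t k) y)%C
    (fun k y => binom_coef d q k * neg_power_derive (S n) (prab_exponent s t k) y)%C
    (fun k y => binom_coef d q k * neg_power_derive (S (S n)) (prab_exponent s t k) y)%C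
    (fun k => (c n + c (S n) + c (S (S n))) * m k) x (x - a) Hxa (Dq n) (Dq (S n))
    (fun k y => Bq n k y (or_introl eq_refl))
    (fun k y => Bq (S n) k y (or_intror (or_introl eq_refl)))
    (fun k y => Bq (S (S n)) k y (or_intror (or_intror eq_refl))) (SS _)).
- intros n x Hx.
  replace (2 * Series m * (INR (fact n) * r ^ n)) with (2 * (INR (fact n) * r ^ n * Series m)) by ring.
  rewrite <- Series_scal_l; apply CSeries_bound; [|apply SS].
  intros k; apply BB; lra.
Qed.

(** For [1 <= x] the factors [x^(-(s k + t))] have modulus at most 1, so the majorant of the
    binomial series works uniformly up to [x = 1]. *)
Lemma binom_ray_lim1 (s t d q : C) : 0 < Re s -> 0 < Re t -> Cmod q < 1 ->
  lim0C (fun p => binom_ray s t d q (1 + p)) (CSeries (binom_coef d q)).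
Proof.
intros Hs Ht Hq; destruct (binom_coef_summable d q Hq) as (m & Hm & Sm).
assert (Pa : forall k, 0 < Re (prab_exponent s t k)) by (intros k; rewrite Re_prab_exponent; pose proof (pos_INR k); nra).
(* Writing [|p|] for [p] makes the majorant valid on both sides of 0. *)
set (f := fun k p => (binom_coef d q k * Rcpower (1 + Rabs p) (- prab_exponent s t k))%C).
assert (Cabs : forall k, contC (f k) 0).
{ intros k; apply contC_mult; [apply contC_const|].
  assert (H1 : contC (fun v => Rcpower v (- prab_exponent s t k)) (1 + Rabs 0))
    by (apply contC_Rcpower; rewrite Rabs_R0; lra).
  assert (H2 : continuous (fun p => 1 + Rabs p) 0).
  { apply (continuous_plus (V := R_NormedModule)); [apply continuous_const | apply continuous_Rabs]. }
  destruct H1 as [H1 H1']; split;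
    [exact (continuous_comp _ _ 0 H2 H1) | exact (continuous_comp _ _ 0 H2 H1')]. }
assert (Bf : forall k p, Cmod (f k p) <= m k).
{ intros k p; unfold f; rewrite Cmod_mult, Cmod_Rcpower, Re_opp.
  rewrite <- (Rmult_1_r (m k)); apply Rmult_le_compat; [apply Cmod_ge_0 | left; apply exp_pos | apply Hm|].
  unfold Rpower; apply Rle_trans with (exp 0); [apply exp_le | rewrite exp_0; lra].
  assert (0 <= ln (1 + Rabs p)).
  { rewrite <- ln_1; destruct (Rabs_pos p) as [Hp| <-];
      [left; apply ln_increasing; lra | right; f_equal; ring]. }
  specialize (Pa k); nra. }
assert (E0 : CSeries (fun k => f k 0) = CSeries (binom_coef d q)).
{ apply CSeries_ext; intros k; unfold f, Rcpower.
  rewrite Rabs_R0, Rplus_0_r, ln_1, Cmult_0_r, Cexp_0; ring. }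
assert (K : forall g : nat -> R -> R, (forall k, continuous (g k) 0) ->
  (forall k p, Rabs (g k p) <= m k) ->
  lim0 (fun p => Series (fun k => g k p)) (Series (fun k => g k 0))).
{ intros g Cg Bg; apply lim0P; intros eps Heps.
  destruct (proj1 (continuous_R _ 0) (continuous_Series g m 0 1 Rlt_0_1 Cg
    (fun k y _ => Bg k y) Sm) eps Heps) as (dd & Hd & HH).
  exists dd; split; [exact Hd|]; intros p Hp Hpd; apply HH.
  rewrite Rminus_0_r, Rabs_pos_eq; lra. }
assert (EE : forall p, 0 < p -> binom_ray s t d q (1 + p) = CSeries (fun k => f k p)).
{ intros p Hp; apply CSeries_ext; intros k; unfold f; now rewrite Rabs_pos_eq by lra. }
assert (L : lim0C (fun p => CSeries (fun k => f k p)) (CSeries (fun k => f k 0))).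
{ split.
  - apply (K (fun k p => Re (f k p))); [intros k; apply Cabs|].
    intros k p; exact (Rle_trans _ _ _ (re_le_Cmod _) (Bf k p)).
  - apply (K (fun k p => Im (f k p))); [intros k; apply Cabs|].
    intros k p; exact (Rle_trans _ _ _ (im_le_Cmod _) (Bf k p)). }
rewrite E0 in L; apply lim0CP; intros eps Heps.
destruct (proj1 (lim0CP _ _) L eps Heps) as (dd & Hd & HH).
exists dd; split; [exact Hd|]; intros p Hp Hpd; rewrite EE by exact Hp; now apply HH.
Qed.

(** * Abel's theorem for Laplace integrals *)

Lemma bounded_of_limits (f : R -> R) (l0 loo : R) :
  (forall u, 0 < u -> continuous f u) -> lim0 f l0 -> limoo f loo ->
  exists B, 0 <= B /\ forall u, 0 < u -> Rabs (f u) <= B.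
Proof.
intros Cf H0 Hoo.
destruct (proj1 (lim0P _ _) H0 1 Rlt_0_1) as (d & Hd & K0).
destruct (proj1 (limooP _ _) Hoo 1 Rlt_0_1) as (M & KM).
set (e := d / 2); set (N := Rmax M e + 1).
assert (Hmid : exists B, forall u, e <= u <= N -> Rabs (f u) <= B).
{ assert (HeN : e <= N) by (unfold N; pose proof (Rmax_r M e); lra).
  assert (Ca : forall c, e <= c <= N -> continuity_pt (fun u => Rabs (f u)) c).
  { intros c Hc; apply continuity_pt_filterlim.
    apply (continuous_comp f Rabs); [apply Cf; unfold e in *; lra | apply continuous_Rabs]. }
  destruct (continuity_ab_maj _ _ _ HeN Ca) as (x & Hx & _).
  exists (Rabs (f x)); exact Hx. }
destruct Hmid as [B HB].
exists (Rmax B (Rabs l0 + Rabs loo + 1)).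
assert (P : 0 <= Rabs l0 + Rabs loo + 1) by (pose proof (Rabs_pos l0); pose proof (Rabs_pos loo); lra).
split; [eapply Rle_trans; [exact P | apply Rmax_r]|]; intros u Hu.
destruct (Rlt_le_dec u e) as [H|H]; [|destruct (Rle_dec u N) as [H'|H']].
- eapply Rle_trans; [|apply Rmax_r]; specialize (K0 u Hu ltac:(unfold e in *; lra)).
  replace (f u) with ((f u - l0) + l0) by ring.
  eapply Rle_trans; [apply Rabs_triang|]; pose proof (Rabs_pos loo); lra.
- eapply Rle_trans; [|apply Rmax_l]; apply HB; lra.
- eapply Rle_trans; [|apply Rmax_r]; specialize (KM u ltac:(unfold N in *; pose proof (Rmax_l M e); lra)).
  replace (f u) with ((f u - loo) + loo) by ring.
  eapply Rle_trans; [apply Rabs_triang|]; pose proof (Rabs_pos l0); lra.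
Qed.

Lemma is_derive_RInt_1 (f : R -> R) (u : R) : (forall v, 0 < v -> continuous f v) -> 0 < u ->
  is_derive (fun v => RInt f 1 v) u (f u).
Proof.
intros Cf Hu; apply (is_derive_RInt (V := R_NormedModule) f (fun v => RInt f 1 v) 1 u).
- exists (mkposreal u Hu); intros v Hv; change (Rabs (v - u) < u) in Hv; apply Rabs_def2 in Hv.
  apply (RInt_correct (V := R_CompleteNormedModule)), ex_RInt_pos; [exact Cf | lra | lra].
- now apply Cf.
Qed.

(** [Phi] is the integral from 0, so its limit at infinity is the full integral [V]. Having limits
    at both ends it is bounded, even if [f] is only conditionally integrable. *)
Lemma primitive_Cint0oo (f : R -> C) (V : C) : (forall u, 0 < u -> contC f u) -> is_Cint0oo f V ->
  exists (Phi : R -> C) (B : R), (forall u, 0 < u -> derC Phi u (f u)) /\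
    lim0C Phi 0%C /\ limooC Phi V /\ 0 <= B /\ (forall u, 0 < u -> Cmod (Phi u) <= B).
Proof.
intros Cf [I1 I2].
assert (K : forall g v, (forall u, 0 < u -> continuous g u) -> is_int0oo g v ->
  exists (P : R -> R) (B : R), (forall u, 0 < u -> is_derive P u (g u)) /\ lim0 P 0 /\ limoo P v
    /\ 0 <= B /\ forall u, 0 < u -> Rabs (P u) <= B).
{ intros g v Cg Ig; destruct (is_int0oo_primitive_limits g v Cg Ig) as (l0 & loo & L0 & Loo & ->).
  set (P := fun u => RInt g 1 u - l0).
  assert (D : forall u, 0 < u -> is_derive P u (g u)).
  { intros u Hu; replace (g u) with (g u - 0) by ring.
    apply (is_derive_minus (K := R_AbsRing) (V := R_NormedModule) (fun v => RInt g 1 v) (fun _ => l0));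
      [now apply is_derive_RInt_1|].
    exact (is_derive_const (K := R_AbsRing) (V := R_NormedModule) l0 u). }
  assert (Q0 : lim0 P 0).
  { apply lim0P; intros eps Heps; destruct (proj1 (lim0P _ _) L0 eps Heps) as (d & Hd & H).
    exists d; split; [exact Hd|]; intros a Ha Had; unfold P; rewrite Rminus_0_r; now apply H. }
  assert (Qoo : limoo P (loo - l0)).
  { apply limooP; intros eps Heps; destruct (proj1 (limooP _ _) Loo eps Heps) as (M & H).
    exists M; intros a Ha; unfold P.
    replace (RInt g 1 a - l0 - (loo - l0)) with (RInt g 1 a - loo) by ring; now apply H. }
  destruct (bounded_of_limits P 0 (loo - l0)) as (B & HB & HB'); [|exact Q0 | exact Qoo|].
  - intros u Hu; apply (ex_derive_continuous (K := R_AbsRing) (V := R_NormedModule)).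
    eexists; apply D, Hu.
  - exists P, B; auto. }
destruct (K (fun u => Re (f u)) (Re V) (fun u Hu => proj1 (Cf u Hu)) I1)
  as (P1 & B1 & D1 & Z1 & O1 & N1 & H1).
destruct (K (fun u => Im (f u)) (Im V) (fun u Hu => proj2 (Cf u Hu)) I2)
  as (P2 & B2 & D2 & Z2 & O2 & N2 & H2).
exists (fun u => (P1 u, P2 u)), (B1 + B2).
split; [intros u Hu; split; [apply D1, Hu | apply D2, Hu]|].
split; [split; assumption|]; split; [split; assumption|]; split; [lra|].
intros u Hu; eapply Rle_trans; [apply Cmod_le_sum|]; cbn [Re Im fst snd].
specialize (H1 u Hu); specialize (H2 u Hu); lra.
Qed.

Lemma power_bounded_bounded (Phi : R -> C) (B : R) : (forall u, 0 < u -> contC Phi u) ->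
  (forall u, 0 < u -> Cmod (Phi u) <= B) -> power_bounded Phi 1 B.
Proof.
intros Cp Hp; split; [lra|]; split; [exact Cp|]; intros u Hu.
rewrite Rminus_eq_0, Rpower_O, Rmult_1_r by exact Hu; auto.
Qed.

Lemma exp_decay (c : R) : 0 < c -> forall eps, 0 < eps -> exists M, forall u, M < u -> exp (- (c * u)) < eps.
Proof.
intros Hc eps Heps; exists (- ln eps / c); intros u Hu.
rewrite <- (exp_ln eps) at 1 by exact Heps; apply exp_increasing.
apply Rlt_div_l in Hu; [lra | exact Hc].
Qed.

(** Integration by parts; [- l] is the boundary term at 0, and boundedness of [Phi] removes the one
    at infinity. Convergence on the left is thereby obtained from that of an absolutely convergent
    integral. *)
Lemma CLaplace_primitive (f Phi : R -> C) (z l : C) (B : R) : 0 < Re z ->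
  (forall u, 0 < u -> contC f u) -> (forall u, 0 < u -> derC Phi u (f u)) ->
  lim0C Phi l -> (forall u, 0 < u -> Cmod (Phi u) <= B) ->
  is_Cint0oo (fun u => Cexp (- (z * RtoC u)) * f u)%C (z * CLaplace Phi z - l)%C.
Proof.
intros Hz Cf DP L0 HB.
assert (CP : forall u, 0 < u -> contC Phi u) by (intros u Hu; eapply derC_contC, DP, Hu).
pose proof (CLaplace_correct Phi 1 B z (power_bounded_bounded Phi B CP HB) Hz) as I.
assert (PB : 0 <= B) by (eapply Rle_trans; [apply Cmod_ge_0 | apply (HB 1); lra]).
set (F := fun u => (Cexp (- (z * RtoC u)) * Phi u)%C).
assert (J : is_Cint0oo (fun u => - z * Cexp (- (z * RtoC u)) * Phi u + Cexp (- (z * RtoC u)) * f u)%C (0 - l)%C).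
{ apply (is_Cint0oo_derive F).
  - intros u Hu; apply (derC_mult (fun u => Cexp (- (z * RtoC u))) Phi);
      [apply derC_Cexp_lin | now apply DP].
  - intros u Hu; apply contC_plus; apply contC_mult.
    + apply contC_mult; [apply contC_const | apply contC_Cexp_lin].
    + now apply CP.
    + apply contC_Cexp_lin.
    + now apply Cf.
  - apply lim0CP; intros eps Heps.
    destruct (proj1 (lim0CP _ _) L0 (eps / 2)) as (d & Hd & H0); [lra|].
    assert (CE : contC (fun u => Cexp (- (z * RtoC u))) 0) by apply contC_Cexp_lin.
    assert (LE : lim0C (fun u => Cexp (- (z * RtoC u))) 1%C).
    { destruct CE as [C1 C2].
      assert (E0 : Cexp (- (z * RtoC 0)) = 1%C) by (rewrite Cmult_0_r, Copp_0; apply Cexp_0).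
      rewrite <- E0; split; apply lim0P; intros e He.
      - destruct (proj1 (continuous_R _ _) C1 e He) as (d' & Hd' & H'); exists d'; split; [exact Hd'|].
        intros a Ha Had; apply H'; rewrite Rminus_0_r, Rabs_pos_eq; lra.
      - destruct (proj1 (continuous_R _ _) C2 e He) as (d' & Hd' & H'); exists d'; split; [exact Hd'|].
        intros a Ha Had; apply H'; rewrite Rminus_0_r, Rabs_pos_eq; lra. }
    pose proof (Cmod_ge_0 l) as Pl.
    destruct (proj1 (lim0CP _ _) LE (eps / (2 * (B + 1)))) as (d' & Hd' & H1).
    { apply Rdiv_lt_0_compat; lra. }
    exists (Rmin d d'); split; [now apply Rmin_glb_lt|]; intros a Ha Had.
    specialize (H0 a Ha (Rlt_le_trans _ _ _ Had (Rmin_l _ _))).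
    specialize (H1 a Ha (Rlt_le_trans _ _ _ Had (Rmin_r _ _))).
    replace (F a - l)%C with ((Cexp (- (z * RtoC a)) - 1) * Phi a + (Phi a - l))%C by (unfold F; ring).
    eapply Rle_lt_trans; [apply Cmod_triangle|]; rewrite Cmod_mult.
    specialize (HB a Ha).
    apply Rlt_div_r in H1; [|lra].
    pose proof (Cmod_ge_0 (Cexp (- (z * RtoC a)) - 1)); nra.
  - apply limooCP; intros eps Heps.
    destruct (exp_decay (Re z) Hz (eps / (B + 1))) as (M & HM); [apply Rdiv_lt_0_compat; lra|].
    exists (Rmax M 0); intros u Hu.
    assert (Hu0 : 0 < u) by (eapply Rle_lt_trans; [apply (Rmax_r M 0) | exact Hu]).
    specialize (HM u (Rle_lt_trans _ _ _ (Rmax_l M 0) Hu)); specialize (HB u Hu0).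
    unfold Cminus; rewrite Copp_0, Cplus_0_r; unfold F; rewrite Cmod_mult, Cmod_Cexp_lin.
    apply Rlt_div_r in HM; [|lra].
    pose proof (exp_pos (- (Re z * u))); nra. }
eapply is_Cint0oo_eq; [eapply is_Cint0oo_ext; [|exact (is_Cint0oo_plus _ _ _ _ (is_Cint0oo_scal _ z _ I) J)]|].
- intros u Hu; cbv beta; ring.
- ring.
Qed.

(** Integration by parts with [f = 0] and the constant primitive [V]: the left integral is 0, hence
    so is [z] times the transform minus [V]. *)
Lemma CLaplace_const (z V : C) : 0 < Re z -> (z * CLaplace (fun _ => V) z)%C = V.
Proof.
intros Hz.
assert (L0 : lim0C (fun _ => V) V).
{ apply lim0CP; intros eps Heps; exists 1; split; [lra|]; intros a _ _.
  unfold Cminus; rewrite Cplus_opp_r, Cmod_0; exact Heps. }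
pose proof (CLaplace_primitive (fun _ => 0%C) (fun _ => V) z V (Cmod V) Hz
  (fun u _ => contC_const _ u) (fun u _ => derC_const V u) L0 (fun u _ => Rle_refl _)) as I.
assert (Z : is_Cint0oo (fun u => Cexp (- (z * RtoC u)) * 0)%C 0%C).
{ pose proof (is_Cint0oo_scal _ 0%C _ I) as I0.
  eapply is_Cint0oo_eq; [eapply is_Cint0oo_ext; [|exact I0]|]; [intros u Hu; cbv beta; ring | ring]. }
pose proof (is_Cint0oo_unique _ _ _ I Z) as E.
transitivity (z * CLaplace (fun _ => V) z - V + V)%C; [ring | rewrite E; ring].
Qed.

(** By [CLaplace_const] the difference from [V] is [p z] times the transform of [Phi - V]. Beyond
    [N] this function is below [e], and the factor [p] cancels against [/ (p Re z)]; the part up to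
    [N] stays bounded, so [p] makes it small. *)
Lemma abel_limit (Phi : R -> C) (z V : C) (B : R) : 0 < Re z ->
  (forall u, 0 < u -> contC Phi u) -> (forall u, 0 < u -> Cmod (Phi u) <= B) -> limooC Phi V ->
  lim0C (fun p => RtoC p * z * CLaplace Phi (RtoC p * z))%C V.
Proof.
intros Hz CP HB LV; apply lim0CP; intros eps Heps.
set (G := RGamma 1); assert (PG : 0 < G) by (apply RGamma_pos; lra).
pose proof (Cmod_ge_0 V) as PV; pose proof (Cmod_ge_0 z) as Pz.
assert (PB : 0 <= B) by (eapply Rle_trans; [apply Cmod_ge_0 | apply (HB 1); lra]).
set (e := eps / (4 * (Cmod z * G / Re z + 1))).
assert (Pq : 0 <= Cmod z * G / Re z).
{ apply Rmult_le_pos; [nra | left; now apply Rinv_0_lt_compat]. }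
assert (He : 0 < e) by (apply Rdiv_lt_0_compat; lra).
destruct (proj1 (limooCP _ _) LV e He) as (N & HN).
(* On [(0, N]] the constant [B + |V|] is at most [D exp (- u)], so the majorant is a sum of two
   Gamma kernels on the whole half-line. *)
set (D := (B + Cmod V) * exp N).
assert (PD : 0 <= D) by (apply Rmult_le_pos; [lra | left; apply exp_pos]).
set (d := eps / (4 * (Cmod z * D * G + 1))).
assert (Pd0 : 0 <= Cmod z * D * G) by (apply Rmult_le_pos; [apply Rmult_le_pos|]; lra).
assert (Pd : 0 < d) by (apply Rdiv_lt_0_compat; lra).
exists d; split; [exact Pd|]; intros p Hp Hpd.
assert (Hpz : 0 < Re (RtoC p * z)) by (rewrite Re_Rmult; now apply Rmult_lt_0_compat).
pose proof (CLaplace_correct Phi 1 B _ (power_bounded_bounded Phi B CP HB) Hpz) as I1.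
pose proof (CLaplace_correct (fun _ => V) 1 (Cmod V) _
  (power_bounded_bounded (fun _ => V) (Cmod V) (fun u _ => contC_const _ u) (fun u _ => Rle_refl _)) Hpz) as I2.
pose proof (is_Cint0oo_minus _ _ _ _ I1 I2) as I.
assert (EV := CLaplace_const (RtoC p * z) V Hpz).
replace (RtoC p * z * CLaplace Phi (RtoC p * z) - V)%C
  with (RtoC p * z * (CLaplace Phi (RtoC p * z) - CLaplace (fun _ => V) (RtoC p * z)))%C
  by (transitivity (RtoC p * z * CLaplace Phi (RtoC p * z) - RtoC p * z * CLaplace (fun _ => V) (RtoC p * z))%C;
      [ring | now rewrite EV]).
assert (BI : Cmod (CLaplace Phi (RtoC p * z) - CLaplace (fun _ => V) (RtoC p * z))
  <= 2 * (e * RGamma_scaled 1 (p * Re z) + D * RGamma_scaled 1 1)).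
{ apply (is_Cint0oo_bound _ _ (fun u => e * Gamma_kernel 1 (p * Re z) u + D * Gamma_kernel 1 1 u) _) with (2 := I).
  - intros u Hu.
    replace (Cexp (- (RtoC p * z * RtoC u)) * Phi u - Cexp (- (RtoC p * z * RtoC u)) * V)%C
      with (Cexp (- (RtoC p * z * RtoC u)) * (Phi u - V))%C by ring.
    rewrite Cmod_mult, Cmod_Cexp_lin, Re_Rmult; unfold Gamma_kernel.
    rewrite Rminus_eq_0, !Rpower_O, !Rmult_1_l by exact Hu.
    assert (E1 : exp (- (p * Re z * u)) <= 1).
    { apply Rle_trans with (exp 0); [apply exp_le | rewrite exp_0; lra].
      assert (0 < p * Re z) by (now apply Rmult_lt_0_compat); nra. }
    pose proof (exp_pos (- (p * Re z * u))) as P1; pose proof (exp_pos (- u)) as P2.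
    destruct (Rlt_le_dec N u) as [H|H].
    + specialize (HN u H); pose proof (Cmod_ge_0 (Phi u - V)); nra.
    + assert (E2 : 1 <= exp N * exp (- u)).
      { rewrite <- exp_plus; apply Rle_trans with (exp 0); [rewrite exp_0; lra | apply exp_le; lra]. }
      assert (E3 : Cmod (Phi u - V) <= B + Cmod V).
      { eapply Rle_trans; [apply Cmod_triangle|]; rewrite Cmod_opp; specialize (HB u Hu); lra. }
      unfold D; replace ((B + Cmod V) * exp N * exp (- u)) with ((B + Cmod V) * (exp N * exp (- u))) by ring.
      pose proof (Cmod_ge_0 (Phi u - V)); nra.
  - apply is_int0oo_plus; apply is_int0oo_scal, RGamma_scaled_correct; try lra.
    now apply Rmult_lt_0_compat. }
rewrite !Cmod_mult, Cmod_R, Rabs_pos_eq by lra.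
rewrite !RGamma_scaled_scale in BI by (try lra; now apply Rmult_lt_0_compat).
fold G in BI.
rewrite !Rpower_Ropp, !Rpower_1 in BI by (try lra; now apply Rmult_lt_0_compat).
eapply Rle_lt_trans; [apply Rmult_le_compat_l; [nra | exact BI]|].
replace (p * Cmod z * (2 * (e * (G * / (p * Re z)) + D * (G * / 1))))
  with (2 * (Cmod z * G / Re z) * e + 2 * (Cmod z * D * G) * p) by (field; lra).
assert (HX : forall X, 0 <= X -> 2 * (X + 1) * (eps / (4 * (X + 1))) = eps / 2)
  by (intros X HX; field; lra).
assert (H1 : 2 * (Cmod z * G / Re z) * e <= eps / 2).
{ apply Rle_trans with (2 * (Cmod z * G / Re z + 1) * e); [nra|].
  right; now apply HX. }
assert (H2 : 2 * (Cmod z * D * G) * p < eps / 2).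
{ apply Rlt_le_trans with (2 * (Cmod z * D * G + 1) * d); [nra|].
  right; now apply HX. }
lra.
Qed.

Fixpoint mul_id_iter (n : nat) (w : R -> C) : R -> C :=
  match n with O => w | S n' => mul_id (mul_id_iter n' w) end.

Lemma power_bounded_mul_id_iter (w : R -> C) (B : R) (n : nat) : power_bounded w 1 B -> power_bounded (mul_id_iter n w) (INR n + 1) B.
Proof.
intros Hw; induction n as [|n IH]; cbn [mul_id_iter].
- cbn [INR]; now rewrite Rplus_0_l.
- rewrite S_INR; now apply power_bounded_mul_id.
Qed.

Lemma RGamma_fact (n : nat) : RGamma (INR n + 1) = INR (fact n) * RGamma 1.
Proof.
induction n as [|n IH].
- cbn [INR fact]; rewrite Rplus_0_l; ring.
- rewrite RGamma_succ by (apply lt_0_INR; lia).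
  rewrite S_INR at 2; rewrite IH, fact_simpl, mult_INR; ring.
Qed.

(** The [n]-th derivative is [(- z)^n] times the transform of [u^n Phi], of modulus at most
    [2 B |z|^n Gamma(n+1) / c^(n+1)], where [c] is positive because [e < a]. The geometric rate is
    [|z| / c], increased by 1 so that it is at least 1. *)
Lemma analytic_on_CLaplace (Phi : R -> C) (z : C) (B e a b : R) : 0 < Re z -> 0 <= B -> power_bounded Phi 1 B -> e < a ->
  analytic_on (fun x => CLaplace Phi (RtoC (x - e) * z)) a b.
Proof.
intros Hz PB Hw Ha.
set (c := (a - e) * Re z).
assert (Hc : 0 < c) by (apply Rmult_lt_0_compat; lra).
set (r := Cmod z / c).
assert (Pr : 0 <= r) by (apply Rmult_le_pos; [apply Cmod_ge_0 | left; now apply Rinv_0_lt_compat]).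
pose proof (RGamma_pos 1 Rlt_0_1) as PG.
exists (fun n x => (- z) ^ n * CLaplace (mul_id_iter n Phi) (RtoC (x - e) * z))%C, (2 * B * RGamma 1 / c), (r + 1).
assert (Rez : forall x, a < x < b -> c <= Re (RtoC (x - e) * z)).
{ intros x Hx; rewrite Re_Rmult; unfold c; nra. }
split; [apply Rmult_le_pos; [nra | left; now apply Rinv_0_lt_compat]|].
split; [lra|]; split; [|split].
- intros x Hx; cbn [Cpow mul_id_iter]; ring.
- intros n x Hx; eapply derC_eq.
  + apply (derC_scal ((- z) ^ n)%C).
    apply (CLaplace_derC (mul_id_iter n Phi) _ B (fun x => RtoC (x - e) * z)%C x 0 1 z (power_bounded_mul_id_iter Phi B n Hw));
      [specialize (Rez x Hx); lra | lra|].
    intros h _.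
    replace (RtoC (x + h - e) * z - RtoC (x - e) * z - RtoC h * z)%C with (RtoC 0)
      by (rewrite !RtoC_minus, RtoC_plus; ring).
    rewrite Cmod_0; lra.
  + rewrite Cpow_S; cbn [mul_id_iter]; ring.
- intros n x Hx; rewrite Cmod_mult, Cmod_pow, Cmod_opp.
  destruct (CLaplace_dominated _ _ _ c _ (power_bounded_mul_id_iter Phi B n Hw) Hc (Rez x Hx)) as [_ L].
  rewrite RGamma_scaled_scale, RGamma_fact in L by (try exact Hc; pose proof (pos_INR n); lra).
  replace (- (INR n + 1)) with (- INR n + - (1)) in L by ring.
  rewrite Rpower_plus, !Rpower_Ropp, Rpower_pow, Rpower_1 in L by exact Hc.
  eapply Rle_trans; [apply Rmult_le_compat_l; [apply pow_le, Cmod_ge_0 | exact L]|].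
  assert (Pc : 0 < c ^ n) by (now apply pow_lt).
  replace (Cmod z ^ n * (2 * (B * (INR (fact n) * RGamma 1 * (/ c ^ n * / c)))))
    with (2 * B * RGamma 1 / c * (INR (fact n) * r ^ n)).
  2:{ unfold r, Rdiv; rewrite Rpow_mult_distr, pow_inv; field; lra. }
  apply Rmult_le_compat_l; [apply Rmult_le_pos; [nra | left; now apply Rinv_0_lt_compat]|].
  apply Rmult_le_compat_l; [apply pos_INR|]; apply pow_incr; lra.
Qed.

(** * The Laplace transform of one idempotent component *)

Lemma Clog_scal (x : R) (z : C) : 0 < x -> z <> 0%C -> Clog (RtoC x * z) = (RtoC (ln x) + Clog z)%C.
Proof.
intros Hx Hz; pose proof (proj1 (Cmod_gt_0 z) Hz) as Hm.
unfold Clog, Carg; rewrite Cmod_mult, Cmod_R, Rabs_pos_eq, Re_Rmult, Im_Rmult by lra.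
replace (x * Re z / (x * Cmod z)) with (Re z / Cmod z) by (field; lra).
apply C_eq; cbn; [now apply ln_mult|].
rewrite Rplus_0_l.
destruct (Rle_dec 0 (x * Im z)) as [H|H]; destruct (Rle_dec 0 (Im z)) as [H'|H']; try reflexivity; exfalso.
- apply H'; nra.
- apply H; nra.
Qed.

(** Scaling by [x > 0] leaves the argument unchanged, so powers of [x z] factor without a branch
    correction and [l^k] combines with [z^(- s k)] into the [k]-th power of [l z^(-s)]. *)
Lemma series_on_ray (s t d l z : C) (x : R) : 0 < x -> 0 < Re z ->
  CSeries (fun k => binom_coef d l k * Cpower (RtoC x * z) (- prab_exponent s t k))%C
  = CSeries (fun k => Cpower z (- t) * (binom_coef d (l * Cpower z (- s)) k * Rcpower x (- prab_exponent s t k)))%C.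
Proof.
intros Hx Hz; apply CSeries_ext; intros k.
assert (E1 : Cpower (RtoC x * z) (- prab_exponent s t k) = (Rcpower x (- prab_exponent s t k) * Cpower z (- prab_exponent s t k))%C).
{ unfold Cpower, Rcpower; rewrite Clog_scal by (auto using RtoC_neq_0); rewrite <- Cexp_add; f_equal; ring. }
assert (E2 : Cpower z (- prab_exponent s t k) = (Cpower z (- t) * Cpower z (- s) ^ k)%C).
{ unfold prab_exponent; clear E1; induction k as [|k IH].
  - cbn [INR Cpow]; rewrite Cmult_1_r; f_equal; ring.
  - rewrite Cpow_S.
    transitivity (Cpower z (- s) * (Cpower z (- t) * Cpower z (- s) ^ k))%C; [|ring].
    rewrite <- IH; unfold Cpower; rewrite <- Cexp_add, S_INR, RtoC_plus; f_equal; ring. }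
rewrite E1, E2; unfold binom_coef; rewrite Cpow_mult_l; ring.
Qed.

(* Convergence at [z] gives the transform on the whole ray [x z], [x > 1];
   there the ray stays inside [|l w^(-s)| < 1] since [x^(-Re s) < 1]. *)
Lemma prab_fun_Laplace_value (s t d l z V : C) : 0 < Re s -> 0 < Re t -> 0 < Re z ->
  Cmod (l * Cpower z (- s)) < 1 ->
  is_Cint0oo (fun u => Cexp (- (z * RtoC u)) * prab_fun s t d l u)%C V -> V = Cquot_branch z s t d l.
Proof.
intros Hs Ht Hz Hq I.
set (q := (l * Cpower z (- s))%C) in *.
set (f := fun u => (Cexp (- (z * RtoC u)) * prab_fun s t d l u)%C) in *.
assert (Cf : forall u, 0 < u -> contC f u).
{ intros u Hu; apply contC_mult; [apply contC_Cexp_lin | now apply contC_prab_fun]. }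
destruct (primitive_Cint0oo f V Cf I) as (Phi & B & DP & L0 & LV & PB & HB).
assert (CP : forall u, 0 < u -> contC Phi u) by (intros u Hu; eapply derC_contC, DP, Hu).
(* The transform at [x z] after integration by parts: since [exp (- x z u)] is [exp (- z u)] times
   [exp (- (x - 1) z u)], it becomes a transform of [Phi] at [(x - 1) z]. *)
set (H := fun x => (RtoC (x - 1) * (z * CLaplace Phi (RtoC (x - 1) * z)))%C).
assert (IH : forall x, 1 < x -> is_Cint0oo (fun u => Cexp (- (RtoC x * z * RtoC u)) * prab_fun s t d l u)%C (H x)).
{ intros x Hx.
  assert (Hxz : 0 < Re (RtoC (x - 1) * z)) by (rewrite Re_Rmult; apply Rmult_lt_0_compat; lra).
  pose proof (CLaplace_primitive f Phi _ _ B Hxz Cf DP L0 HB) as J.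
  eapply is_Cint0oo_eq; [eapply is_Cint0oo_ext; [|exact J]|].
  - intros u Hu; unfold f; rewrite Cmult_assoc, <- Cexp_add; do 2 f_equal.
    rewrite RtoC_minus; ring.
  - unfold H; ring. }
destruct (prab_fun_Laplace s t d l Hs Ht) as (K & PK & HK).
(* Beyond [b0] the ray lies in the half-plane where termwise integration is valid. *)
set (b0 := Rmax 1 (K / Re z) + 1).
assert (Hb0 : 1 < b0 /\ K < b0 * Re z).
{ pose proof (Rmax_l 1 (K / Re z)); pose proof (Rmax_r 1 (K / Re z)).
  split; [unfold b0; lra|]; apply Rlt_div_l; [exact Hz | unfold b0; lra]. }
assert (SQ : forall x, 1 < x -> is_CS (fun k => binom_coef d q k * Rcpower x (- prab_exponent s t k))%C (binom_ray s t d q x)).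
{ intros x Hx; destruct (binom_coef_summable d q Hq) as (m & Hm & Sm).
  apply (is_CS_dom _ m); [|exact Sm]; intros k; rewrite Cmod_mult, Cmod_Rcpower, Re_opp.
  rewrite <- (Rmult_1_r (m k)); apply Rmult_le_compat;
    [apply Cmod_ge_0 | left; apply exp_pos | apply Hm|].
  apply Rle_trans with (exp 0); [apply exp_le | rewrite exp_0; lra].
  assert (0 < ln x) by (rewrite <- ln_1; apply ln_increasing; lra).
  rewrite Re_prab_exponent; pose proof (pos_INR k); assert (0 <= Re s * INR k + Re t) by nra; nra. }
assert (EQ : forall x, 1 < x -> (H x - Cpower z (- t) * binom_ray s t d q x)%C = 0%C).
{ intros x Hx.
  (* An interval containing both [x] and a piece beyond [b0], with its left end strictly above 1, as
     analyticity of both sides requires. *)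
  set (b := Rmax x b0 + 1); set (a := (1 + Rmin x b0) / 2).
  pose proof (Rmax_l x b0); pose proof (Rmax_r x b0); pose proof (Rmin_l x b0); pose proof (Rmin_r x b0).
  assert (Ha : 1 < a) by (unfold a; pose proof (Rmin_glb_lt x b0 1 Hx (proj1 Hb0)); lra).
  apply (analytic_on_identity (fun x => H x - Cpower z (- t) * binom_ray s t d q x)%C a b b0).
  - apply analytic_on_minus.
    + apply (analytic_on_linear 1 (fun x => z * CLaplace Phi (RtoC (x - 1) * z))%C), analytic_on_scal.
      apply (analytic_on_CLaplace Phi z B 1 a b Hz PB (power_bounded_bounded Phi B CP HB) Ha).
    + apply analytic_on_scal, analytic_on_binom_ray; assumption.
  - unfold a, b; lra.
  - intros y Hy.
    assert (Hy1 : 1 < y) by lra.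
    assert (HKy : K < Re (RtoC y * z)).
    { rewrite Re_Rmult; apply Rlt_trans with (1 := proj2 Hb0), Rmult_lt_compat_r; lra. }
    rewrite (is_Cint0oo_unique _ _ _ (IH y Hy1) (HK _ HKy)).
    rewrite series_on_ray by lra; fold q.
    rewrite (is_CS_eq _ _ (is_CS_scal (Cpower z (- t)) _ _ (SQ y Hy1))); ring.
  - unfold a, b; lra. }
assert (L1 : lim0C (fun p => H (1 + p)) V).
{ pose proof (abel_limit Phi z V B Hz CP HB LV) as L.
  apply lim0CP; intros eps Heps; destruct (proj1 (lim0CP _ _) L eps Heps) as (dd & Hd & HH).
  exists dd; split; [exact Hd|]; intros p Hp Hpd; specialize (HH p Hp Hpd).
  unfold H; replace (1 + p - 1) with p by ring; rewrite Cmult_assoc; exact HH. }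
assert (L2 := binom_ray_lim1 s t d q Hs Ht Hq).
rewrite Cquot_branchE; fold q; rewrite <- binomial_series by exact Hq.
set (W := CSeries (binom_coef d q)) in *; set (c := Cpower z (- t)) in *.
assert (N : Cmod (V - c * W) <= 0).
(* If the gap [e] were positive, a small [p] would give one common value, [H (1 + p) = c g], within
   [e / 2] of both [V] and [c W]. *)
{ apply Rnot_lt_le; intros Hlt; set (e := Cmod (V - c * W)) in *.
  pose proof (Cmod_ge_0 c) as Pc.
  destruct (proj1 (lim0CP _ _) L1 (e / 2)) as (d1 & Hd1 & H1); [lra|].
  destruct (proj1 (lim0CP _ _) L2 (e / (2 * (Cmod c + 1)))) as (d2 & Hd2 & H2);
    [apply Rdiv_lt_0_compat; lra|].
  set (p := Rmin d1 d2 / 2).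
  assert (Hp : 0 < p /\ p < d1 /\ p < d2).
  { unfold p; pose proof (Rmin_l d1 d2); pose proof (Rmin_r d1 d2).
    pose proof (Rmin_glb_lt d1 d2 0 Hd1 Hd2); lra. }
  specialize (H1 p (proj1 Hp) (proj1 (proj2 Hp))); specialize (H2 p (proj1 Hp) (proj2 (proj2 Hp))).
  specialize (EQ (1 + p) ltac:(lra)); cbv beta in H1, H2.
  set (h := H (1 + p)) in *; set (g := binom_ray s t d q (1 + p)) in *.
  assert (T : Cmod (V - c * W) <= Cmod (h - V) + Cmod c * Cmod (g - W)).
  { replace (V - c * W)%C
      with (- (h - V) + (c * (g - W)
        + (h - c * g)))%C by ring.
    rewrite EQ, Cplus_0_r; eapply Rle_trans; [apply Cmod_triangle|].
    rewrite Cmod_opp, Cmod_mult; lra. }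
  fold e in T.
  apply Rlt_div_r in H2; [|lra].
  pose proof (Cmod_ge_0 (g - W)); nra. }
assert (E0 : (V - c * W)%C = 0%C) by (apply Cmod_eq_0, Rle_antisym; [exact N | apply Cmod_ge_0]).
transitivity (V - c * W + c * W)%C; [ring | rewrite E0; ring].
Qed.

(** * Idempotent components *)

Lemma idem1_RtoT (x : R) : idem1 (RtoT x) = RtoC x. Proof. apply idem1_CtoT. Qed.
Lemma idem2_RtoT (x : R) : idem2 (RtoT x) = RtoC x. Proof. apply idem2_CtoT. Qed.

Lemma idem1_Tpow (x : bicomplex) (k : nat) : idem1 (Tpow x k) = (idem1 x ^ k)%C.
Proof.
induction k as [|k IH]; cbn [Tpow Cpow]; [apply idem1_RtoT | now rewrite idem1_mul, IH].
Qed.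
Lemma idem2_Tpow (x : bicomplex) (k : nat) : idem2 (Tpow x k) = (idem2 x ^ k)%C.
Proof.
induction k as [|k IH]; cbn [Tpow Cpow]; [apply idem2_RtoT | now rewrite idem2_mul, IH].
Qed.

Lemma idem1_Tpoch (d : bicomplex) (k : nat) : idem1 (Tpoch d k) = Cpoch (idem1 d) k.
Proof.
induction k as [|k IH]; cbn [Tpoch Cpoch]; [apply idem1_RtoT|].
now rewrite idem1_mul, idem1_add, idem1_RtoT, IH.
Qed.
Lemma idem2_Tpoch (d : bicomplex) (k : nat) : idem2 (Tpoch d k) = Cpoch (idem2 d) k.
Proof.
induction k as [|k IH]; cbn [Tpoch Cpoch]; [apply idem2_RtoT|].
now rewrite idem2_mul, idem2_add, idem2_RtoT, IH.
Qed.

Lemma idem1_div (x y : bicomplex) : idem1 (x / y)%BC = (idem1 x * / idem1 y)%C.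
Proof. unfold Tdiv, Tinv; now rewrite idem1_mul, of_idem1. Qed.
Lemma idem2_div (x y : bicomplex) : idem2 (x / y)%BC = (idem2 x * / idem2 y)%C.
Proof. unfold Tdiv, Tinv; now rewrite idem2_mul, of_idem2. Qed.

Definition CPrabhakar (s t d w : C) : C :=
  CSeries (fun k => Cpoch d k * / (RtoC (INR (fact k)) * CGamma (s * RtoC (INR k) + t)) * w ^ k)%C.

Lemma idem1_Prabhakar (s t d w : bicomplex) :
  idem1 (Prabhakar s t d w) = CPrabhakar (idem1 s) (idem1 t) (idem1 d) (idem1 w).
Proof.
unfold Prabhakar, TSeries; rewrite of_idem1; apply CSeries_ext; intros k.
unfold TGamma.
now rewrite idem1_mul, idem1_div, idem1_Tpoch, idem1_Tpow, idem1_mul, of_idem1,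
  idem1_add, idem1_mul, !idem1_RtoT.
Qed.
Lemma idem2_Prabhakar (s t d w : bicomplex) :
  idem2 (Prabhakar s t d w) = CPrabhakar (idem2 s) (idem2 t) (idem2 d) (idem2 w).
Proof.
unfold Prabhakar, TSeries; rewrite of_idem2; apply CSeries_ext; intros k.
unfold TGamma.
now rewrite idem2_mul, idem2_div, idem2_Tpoch, idem2_Tpow, idem2_mul, of_idem2,
  idem2_add, idem2_mul, !idem2_RtoT.
Qed.

(** Convergence is known for the series of [prab_fun], so the power [u^(t-1)] is divided out of that
    series to obtain [CPrabhakar]. *)
Lemma prab_fun_eq (s t d l : C) (u : R) : 0 < Re s -> 0 < Re t -> 0 < u ->
  prab_fun s t d l u = (Cpower (RtoC u) (t - 1) * CPrabhakar s t d (l * Cpower (RtoC u) s))%C.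
Proof.
intros Hs Ht Hu.
rewrite !Cpower_pos by exact Hu.
pose proof (prab_fun_CS s t d l u Hs Ht Hu) as S.
assert (Pk : forall k, Rcpower u (prab_exponent s t k - 1) = (Rcpower u (t - 1) * Rcpower u s ^ k)%C).
{ intros k; unfold prab_exponent; induction k as [|k IH].
  - cbn [INR Cpow]; rewrite Cmult_1_r; f_equal; ring.
  - rewrite Cpow_S; transitivity (Rcpower u s * (Rcpower u (t - 1) * Rcpower u s ^ k))%C; [|ring].
    rewrite <- IH, <- Rcpower_plus, S_INR, RtoC_plus; f_equal; ring. }
assert (Pa : forall k, 0 < Re (prab_exponent s t k)) by (intros k; rewrite Re_prab_exponent; pose proof (pos_INR k); nra).
pose proof (is_CS_scal (/ Rcpower u (t - 1))%C _ _ S) as S2.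
assert (E : CPrabhakar s t d (l * Rcpower u s) = (/ Rcpower u (t - 1) * prab_fun s t d l u)%C).
{ rewrite <- (is_CS_eq _ _ S2); apply CSeries_ext; intros k; rewrite Pk.
  unfold prab_coef, binom_coef; rewrite Cpow_mult_l; fold (prab_exponent s t k).
  pose proof (INR_fact_pos k).
  field; repeat split; try apply Cexp_neq_0; try apply CGamma_neq_0, Pa.
  intros E; apply RtoC_inj in E; lra. }
rewrite E; field; apply Cexp_neq_0.
Qed.

Definition Cintegrand (s t d l z : C) (u : R) : C :=
  (Cexp (- (z * RtoC u)) * (Cpower (RtoC u) (t - 1) * CPrabhakar s t d (l * Cpower (RtoC u) s)))%C.

Lemma Cintegrand_prab_fun (s t d l z V : C) : 0 < Re s -> 0 < Re t ->
  is_Cint0oo (Cintegrand s t d l z) V <-> is_Cint0oo (fun u => Cexp (- (z * RtoC u)) * prab_fun s t d l u)%C V.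
Proof.
intros Hs Ht; split; apply is_Cint0oo_ext; intros u Hu; unfold Cintegrand; now rewrite prab_fun_eq.
Qed.

Theorem theorem4p2 (zeta vsigma tau delta lambda : bicomplex)
  (Hvsigma : Rabs (TImj vsigma) < TRe vsigma)
  (Htau : Rabs (TImj tau) < TRe tau)
  (Hzeta : Rabs (TImj zeta) < TRe zeta)
  (Hlambda : Tprec (Tmodj (lambda * Tpower zeta (- vsigma))%BC) (RtoT 1)) :
  let f := fun t : R =>
    (Tpower (RtoT t) (tau - RtoT 1)
     * Prabhakar vsigma tau delta (lambda * Tpower (RtoT t) vsigma))%BC in
  (exists K : R, forall z : bicomplex,
     Rabs (TImj z) + K < TRe z -> ex_Laplace f z) /\
  (ex_Laplace f zeta ->
   Laplace f zeta = Tquot_branch zeta vsigma tau delta lambda).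
Proof.
intros f.
apply half_plane_idem in Hvsigma as [Hs1 Hs2].
apply half_plane_idem in Htau as [Ht1 Ht2].
apply half_plane_idem in Hzeta as [Hz1 Hz2].
apply Tprec_modj1 in Hlambda as [Hl1 Hl2].
unfold Tpower in Hl1, Hl2.
rewrite idem1_mul, of_idem1, idem1_opp in Hl1.
rewrite idem2_mul, of_idem2, idem2_opp in Hl2.
(* The projections commute with every operation of the integrand, at each real [u], so the two
   functions are equal outright and can be rewritten inside the integral. *)
assert (E1 : forall z, (fun u => idem1 (Texp (- (z * RtoT u)) * f u)%BC)
  = Cintegrand (idem1 vsigma) (idem1 tau) (idem1 delta) (idem1 lambda) (idem1 z)).
{ intros z; apply functional_extensionality; intros u; unfold f, Cintegrand, Texp, Tpower, Tsub.
  now rewrite !idem1_mul, idem1_Prabhakar, !of_idem1, idem1_opp, idem1_mul, idem1_add, idem1_opp,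
    !idem1_RtoT, idem1_mul, of_idem1. }
assert (E2 : forall z, (fun u => idem2 (Texp (- (z * RtoT u)) * f u)%BC)
  = Cintegrand (idem2 vsigma) (idem2 tau) (idem2 delta) (idem2 lambda) (idem2 z)).
{ intros z; apply functional_extensionality; intros u; unfold f, Cintegrand, Texp, Tpower, Tsub.
  now rewrite !idem2_mul, idem2_Prabhakar, !of_idem2, idem2_opp, idem2_mul, idem2_add, idem2_opp,
    !idem2_RtoT, idem2_mul, of_idem2. }
split.
- destruct (prab_fun_Laplace (idem1 vsigma) (idem1 tau) (idem1 delta) (idem1 lambda) Hs1 Ht1)
    as (K1 & P1 & H1).
  destruct (prab_fun_Laplace (idem2 vsigma) (idem2 tau) (idem2 delta) (idem2 lambda) Hs2 Ht2)
    as (K2 & P2 & H2).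
  exists (Rmax K1 K2); intros z Hz.
  (* The idempotent components have real parts [TRe z + TImj z] and [TRe z - TImj z], so the
     hypothesis on [z] puts both beyond the larger threshold. *)
  assert (Hz' : Rmax K1 K2 < Re (idem1 z) /\ Rmax K1 K2 < Re (idem2 z)).
  { destruct z as [[a b] [c d]]; unfold TImj, TRe, idem1, idem2 in *; cbn in *.
    pose proof (Rle_abs d); pose proof (Rle_abs (- d)) as Hd; rewrite Rabs_Ropp in Hd; lra. }
  destruct Hz' as [Z1 Z2]; pose proof (Rmax_l K1 K2); pose proof (Rmax_r K1 K2).
  split; unfold ex_CInt0oo; [rewrite E1 | rewrite E2]; eexists; apply is_Cint0oo_correct, Cintegrand_prab_fun;
    [assumption | assumption | apply H1; lra | assumption | assumption | apply H2; lra].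
- intros [[V1 I1] [V2 I2]].
  rewrite E1 in I1; rewrite E2 in I2.
  apply is_Cint0oo_complete in I1; apply is_Cint0oo_complete in I2.
  unfold Laplace, TInt0oo, Tquot_branch; rewrite E1, E2, (CInt0oo_eq _ _ I1), (CInt0oo_eq _ _ I2).
  rewrite <- (prab_fun_Laplace_value _ _ _ _ _ V1 Hs1 Ht1 Hz1 Hl1), <- (prab_fun_Laplace_value _ _ _ _ _ V2 Hs2 Ht2 Hz2 Hl2);
    [reflexivity | exact (proj1 (Cintegrand_prab_fun _ _ _ _ _ _ Hs2 Ht2) I2)
    | exact (proj1 (Cintegrand_prab_fun _ _ _ _ _ _ Hs1 Ht1) I1)].
Qed.
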